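(* Let $p$ be a prime and let $G$ be a finite group that is not $p$-solvable and has a non-trivial cyclic Sylow $p$-subgroup $P$. Then there exists a smallest normal subgroup $K$ of $G$ among the normal subgroups properly containing $O_{p'}(G)$, and the quotient group $L = K/O_{p'}(G)$ is simple non-abelian. Moreover, if $G \in \mathfrak{X}_p$, then $L \in \mathfrak{X}_p$.
   Context: $O_{p'}(G)$ is the largest normal subgroup of $G$ of order coprime to $p$. For a finite group $G$ and a prime $p$ dividing $|G|$, the Brauer graph has vertices labelled by the ordinary irreducible characters, with characters having the same restriction to $p$-regular classes put at a single vertex (an exceptional vertex), and edges labelled by the irreducible $p$-modular Brauer characters; $\chi$ and $\psi$ are joined if some irreducible Brauer character $\phi$ has non-zero decomposition numbers $d_{\chi\phi}\ne0\ne d_{\psi\phi}$. Its connected components are the $p$-blocks; the principal $p$-block contains the trivial character. If a Sylow $p$-subgroup of $G$ is cyclic, the graph of each $p$-block is a tree, called its Brauer tree. A star is a tree of diameter at most $2$. $\mathfrak{X}_p$ is the class of finite groups with non-trivial cyclic Sylow $p$-subgroup such that the Brauer tree of the principal $p$-block is a star. *)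

(* Defs.v *)
(* MathComp, with the classical reflection of propositions from boolp. *)
From HB Require Import structures.
From mathcomp Require Import all_boot all_order all_algebra all_fingroup.
From mathcomp Require Import all_solvable all_field all_character.
From mathcomp Require Import boolp.

Set Implicit Arguments.
Unset Strict Implicit.
Unset Printing Implicit Defensive.

Import GroupScope GRing.Theory.

(* In the definitions on graphs below, e is meant to be symmetric and irreflexive,
   i.e. the adjacency relation of a simple graph on T. *)

(* The length of a shortest path; the junk value #|T| when there is none. *)
Definition gdist (T : finType) (e : rel T) (x y : T) : nat :=
  find (fun n => [exists s : n.-tuple T, path e x s && (last x s == y)])
       (iota 0 #|T|).

Definition diameter (T : finType) (e : rel T) : nat :=
  \max_(x : T) \max_(y : T) gdist e x y.

Definition is_tree (T : finType) (e : rel T) : Prop :=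
  [/\ 0 < #|T|,
      forall x y : T, connect e x y
    & forall c : seq T, 2 < size c -> ~~ ucycleb e c].

Definition is_star (T : finType) (e : rel T) : Prop :=
  is_tree e /\ diameter e <= 2.

Definition p_solvable (p : nat) (gT : finGroupType) (G : {group gT}) : Prop :=
  exists2 s : seq {group gT},
    path (fun H K : {group gT} =>
            [&& H \subset K, K <| G & p.-group (K / H) || p^'.-group (K / H)])
         1%G s
    & last 1%G s = G.

Local Open Scope ring_scope.

Definition is_root_of_unity (R : nzRingType) (x : R) : Prop :=
  exists2 n : nat, (0 < n)%N & x ^+ n = 1.

(* An embedding of the roots of unity of F into the complex (algebraic) ones;
   values of theta outside the roots of unity of F are irrelevant. For F
   algebraically closed of characteristic p, it identifies the group of roots
   of unity of F with that of complex roots of unity of order prime to p, as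
   reduction modulo a maximal ideal above p does; such a theta always exists. *)
Definition brauer_lift (F : closedFieldType) (theta : F -> algC) : Prop :=
  [/\ theta 1 = 1,
      forall x y : F, is_root_of_unity x -> is_root_of_unity y ->
        theta (x * y) = theta x * theta y
    & forall x y : F, is_root_of_unity x -> is_root_of_unity y ->
        theta x = theta y -> x = y].

(* The eigenvalues of A, listed with algebraic multiplicity. *)
Definition eigenvalues (F : closedFieldType) (n : nat) (A : 'M[F]_n) : seq F :=
  sval (closed_field_poly_normal (char_poly A)).

Lemma char_poly_repr_conj (F : closedFieldType) (gT : finGroupType)
    (G : {group gT}) (n : nat) (rG : mx_representation F G n) (x y : gT) :
  x \in G -> y \in G -> char_poly (rG (x ^ y)%g) = char_poly (rG x).
Proof.
move=> Gx Gy; rewrite /char_poly conjgE !repr_mxM ?groupM ?groupV //.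
set A := rG x; set B := rG y; set C := rG _^-1%g.
pose f := map_mx (@polyC F).
have fCB : f n n C *m f n n B = 1%:M.
  by rewrite -map_mxM /C /B -repr_mxM ?groupV // mulVg repr_mx1 map_mx1.
have -> : char_poly_mx (C *m (A *m B))
          = f n n C *m (char_poly_mx A *m f n n B).
  rewrite /char_poly_mx mulmxBl mulmxBr -!map_mxM; congr (_ - _).
  by rewrite mulmxA scalar_mxC -mulmxA fCB mulmx1.
by rewrite !det_mulmx mulrCA -det_mulmx fCB det1 mulr1.
Qed.

Section BrauerCharacters.

Variables (p : nat) (F : closedFieldType) (theta : F -> algC).
Variables (gT : finGroupType) (G : {group gT}).

Definition p_regular : {set gT} := [set x in G | p^'.-elt x].

(* Functions on the p-regular classes of G are encoded as class functions on G
   that vanish outside p_regular. *)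
Definition preg_restr (chi : 'CF(G)) : 'CF(G) := chi * '1_p_regular.

Fact brauer_char_subproof (n : nat) (rG : mx_representation F G n) :
  is_class_fun <<G>>%g
    [ffun x => (\sum_(a <- eigenvalues (rG x)) theta a) *+ (x \in p_regular)].
Proof.
rewrite genGid; apply: intro_class_fun => [x y Gx Gy | x /negbTE Gx].
  by rewrite /eigenvalues char_poly_repr_conj // !inE groupJr // p_eltJ.
by rewrite inE Gx.
Qed.

Definition brauer_char (n : nat) (rG : mx_representation F G n) : 'CF(G) :=
  Cfun 0 (brauer_char_subproof rG).

Definition IBr (phi : 'CF(G)) : Prop :=
  exists (n : nat) (rG : mx_representation F G n),
    mx_irreducible rG /\ phi = brauer_char rG.

(* s lists the irreducible Brauer constituents of the restriction of chi, with
   multiplicity; s is unique up to permutation because irreducible Brauer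
   characters are linearly independent. *)
Definition is_decomposition_number (chi phi : 'CF(G)) (d : nat) : Prop :=
  exists s : seq 'CF(G),
    [/\ forall psi, psi \in s -> IBr psi,
        preg_restr chi = \sum_(psi <- s) psi
      & d = count_mem phi s].

(* A vertex is the common restriction to p-regular classes of the irreducible
   characters put at that vertex. *)
Definition brauer_vertex : finType :=
  seq_sub (codom (fun i : Iirr G => preg_restr 'chi_i)).

Definition vertex_of (i : Iirr G) : brauer_vertex :=
  SeqSub (codom_f (fun i : Iirr G => preg_restr 'chi_i) i).

Definition joined (chi psi : 'CF(G)) : Prop :=
  exists2 phi : 'CF(G), IBr phi
    & exists d1 d2 : nat,
        [/\ is_decomposition_number chi phi d1, d1 <> 0%N,
            is_decomposition_number psi phi d2 & d2 <> 0%N].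

Definition brauer_graph : rel brauer_vertex := fun v w =>
  (v != w) &&
  `[< exists i j : Iirr G,
        [/\ vertex_of i = v, vertex_of j = w & joined 'chi_i 'chi_j] >].

Definition principal_block_vertex : finType :=
  {v : brauer_vertex | connect brauer_graph (vertex_of 0) v}.

Definition principal_block_graph : rel principal_block_vertex :=
  fun v w => brauer_graph (val v) (val w).

(* The class X_p, relative to the choice of F and theta. This choice does not
   matter: changing it applies to all Brauer characters of G one and the same
   Galois automorphism fixing the p-power roots of unity, and that permutes the
   irreducible characters and fixes the trivial one. *)
Definition in_Xp : Prop :=
  (exists P : {group gT}, [/\ p.-Sylow(G) P, cyclic P & P :!=: 1%g]) /\
  is_star principal_block_graph.

End BrauerCharacters.

(* Main.v *)
(** Let Gb = G / O_p'(G). By Burnside's transfer theorem a minimal normal subgroup L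
    of Gb is the only one, is simple, and has index prime to p.

    For the blocks, reduction modulo p is done at a maximal pair (R, f) of a subring
    R of algC and a ring morphism f : R -> F (a place); every ordinary representation
    is conjugate to one over R. Call two irreducible characters linked when they
    share an irreducible Brauer constituent. The principal block is a star iff some c
    in it is linked to everything, and any two linked characters have the same
    restriction to p-regular elements unless one of them restricts like c. This
    passes from G to Gb because O_p'(G) is in the kernel of the block.

    From Gb to L, let X be the set of constituents of the restrictions to L of the
    characters at the vertex of c. The projective character 1 + (sum over the vertex
    of c) vanishes on p-singular elements; hence the sum over the vertex of c is -1
    there, and the sum over any other vertex is a constant too. Call a character of L
    exceptional if it is not constant on p-singular elements. Those of the principal
    block agree on p-regular elements, because differences of the characters induced
    from the centraliser of the subgroup of order p have norm at most 2. Below a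
    vertex other than c, a non-exceptional character psi of L is conjugate under Gb to
    all other characters. Counting Brauer constituents of the members of X and of
    the conjugates of psi shows that the number s of those of psi divides the
    number of those of every irreducible character that lie below the same
    vertex. As irreducible characters generate the Brauer characters up to an index
    prime to any given prime, s = 1: psi restricts to an irreducible Brauer
    character, and so linked characters below the vertex agree on p-regular elements. *)

From HB Require Import structures.
From mathcomp Require Import all_boot all_order all_algebra all_fingroup.
From mathcomp Require Import all_solvable all_field all_character.
From mathcomp Require Import boolp.
From mathcomp Require classical_sets.
Require Import Defs.

Set Implicit Arguments.
Unset Strict Implicit.
Unset Printing Implicit Defensive.

Import GroupScope Order.TTheory GRing.Theory Num.Theory.
Local Open Scope ring_scope.

(** * Places *)

(** The lift [theta] is given in advance, so a maximal pair alone is not enough: its embedding into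
    [algC] is composed with a Galois automorphism that makes each relevant root of unity [theta a]
    reduce to [a]. A valuation ring replaces a localised number field; what it offers is that some
    member of any finite family divides all the others. The norm bound 2 comes from the normaliser
    of the subgroup [Z] of order [p]: it controls the fusion of p-singular elements of the
    centraliser [C] of [Z], and inside it only [C] fixes an inflated nontrivial character of the
    cyclic Sylow subgroup. To pair the differences with a block character, its values on p-singular
    elements of [C] must depend on p-parts alone. The sum over all p-singular elements yields this:
    their number is prime to [p], so the sum is invertible on reductions in the principal block,
    while away from the fixed points of the p'-core of [C] it is a trace from the trivial subgroup
    of [Z], which forces traces to vanish. *)

Record subring_graph (K F : fieldType) := SubringGraph {
  graph_pred : {pred (K * F)%type};
  graph1 : graph_pred 1;
  graphB : forall u v, graph_pred u -> graph_pred v -> graph_pred (u - v);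
  graphM : forall u v, graph_pred u -> graph_pred v -> graph_pred (u * v);
  graph_fun : forall b, graph_pred (0, b) -> b = 0 }.

Section GraphRing.
Variables (K F : fieldType) (S : subring_graph K F).

Fact graph_subring_closed : subring_closed (graph_pred S).
Proof. by split; [exact: graph1|exact: graphB|exact: graphM]. Qed.

HB.instance Definition _ :=
  GRing.isSubringClosed.Build (K * F)%type (graph_pred S) graph_subring_closed.

(** The pair of a subring and a morphism is stored as the graph of the morphism, a subring of
    [K * F]; single-valuedness need only be asked at 0. Inclusion of graphs is extension of pairs,
    the order to which Zorn's lemma applies. *)
Definition graph_ring := {u : (K * F)%type | graph_pred S u}.

HB.instance Definition _ := SubType.on graph_ring.
HB.instance Definition _ := Choice.on graph_ring.
HB.instance Definition _ := [SubChoice_isSubComNzRing of graph_ring by <:].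

Definition graph_fst (u : graph_ring) : K := (val u).1.
Definition graph_snd (u : graph_ring) : F := (val u).2.

Fact graph_fst_zmod : zmod_morphism graph_fst. Proof. by []. Qed.
Fact graph_fst_monoid : monoid_morphism graph_fst. Proof. by []. Qed.
Fact graph_snd_zmod : zmod_morphism graph_snd. Proof. by []. Qed.
Fact graph_snd_monoid : monoid_morphism graph_snd. Proof. by []. Qed.

HB.instance Definition _ :=
  GRing.isZmodMorphism.Build graph_ring K graph_fst graph_fst_zmod.
HB.instance Definition _ :=
  GRing.isMonoidMorphism.Build graph_ring K graph_fst graph_fst_monoid.
HB.instance Definition _ :=
  GRing.isZmodMorphism.Build graph_ring F graph_snd graph_snd_zmod.
HB.instance Definition _ :=
  GRing.isMonoidMorphism.Build graph_ring F graph_snd graph_snd_monoid.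

Lemma graph_fst_inj : injective graph_fst.
Proof.
move=> u v uv; apply/eqP; rewrite -subr_eq0; apply/eqP/val_inj.
have: graph_fst (u - v) = 0 by rewrite rmorphB /= uv subrr.
case: (u - v) => [[a b] ab]; rewrite /graph_fst /= => a0; rewrite a0 in ab *.
by rewrite (graph_fun ab).
Qed.

End GraphRing.

Lemma mulrBl_expD (R : comNzRingType) (u v c : R) k l :
  (u - v) * c ^+ (k + l) = u * c ^+ k * c ^+ l - v * c ^+ l * c ^+ k.
Proof. by rewrite mulrBl exprD mulrA (mulrC (c ^+ k)) mulrA. Qed.

Section MaximalGraph.
Variables (K : fieldType) (F : closedFieldType) (S : subring_graph K F).
Hypothesis maxS : forall S' : subring_graph K F,
  {subset graph_pred S <= graph_pred S'} ->
  {subset graph_pred S' <= graph_pred S}.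
Notation G := (graph_pred S).

(** Localisation: the pairs that some power of [(b, c)] multiplies into the graph form a subring,
    single-valued because [c] is not zero. By maximality it adds nothing. *)
Lemma max_graph_inv b c : c != 0 -> G (b, c) -> G (b^-1, c^-1).
Proof.
move=> c0 Gbc.
have b0 : b != 0 by apply: contraNneq c0 => b0; rewrite b0 in Gbc; rewrite (graph_fun Gbc).
have GX k : (b, c) ^+ k \in G by exact: rpredX.
pose P : {pred (K * F)%type} := fun u => `[< exists k, u * (b, c) ^+ k \in G >].
have pE k : (b, c) ^+ k = (b ^+ k, c ^+ k) :> (K * F)%type.
  by elim: k => // k IH; rewrite exprS IH !exprS.
have P1 : P 1 by apply/asboolP; exists 0; rewrite mulr1; exact: graph1.
have PB u v : P u -> P v -> P (u - v).
  move=> /asboolP[k uk] /asboolP[l vl]; apply/asboolP; exists (k + l)%N.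
  by rewrite mulrBl_expD; apply: graphB; apply: graphM => //; exact: GX.
have PM u v : P u -> P v -> P (u * v).
  move=> /asboolP[k uk] /asboolP[l vl]; apply/asboolP; exists (k + l)%N.
  by rewrite exprD mulrACA; apply: graphM.
have Pf d : P (0, d) -> d = 0.
  move=> /asboolP[k]; rewrite pE => dk.
  have {}dk : G (0 * b ^+ k, d * c ^+ k) by exact: dk.
  rewrite mul0r in dk.
  have /eqP := graph_fun dk; rewrite mulf_eq0 => /orP[/eqP //|].
  by rewrite expf_eq0 (negPf c0) andbF.
have := @maxS (SubringGraph P1 PB PM Pf); apply.
  by move=> u Gu; apply/asboolP; exists 0; rewrite mulr1.
apply/asboolP; exists 1%N; rewrite expr1.
have -> : (b^-1, c^-1) * (b, c) = (b^-1 * b, c^-1 * c) :> (K * F)%type by [].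
by rewrite !mulVf //; exact: graph1.
Qed.

Definition unit_relation (x : K) (P : {poly (K * F)%type}) : Prop :=
  [/\ P \is a polyOver G, map_poly snd P = 1 & root (map_poly fst P) x].

(* If no element of the ideal of relations of x reduces to 1, the reductions of
   these relations have a common root, to which x can be mapped. *)
Lemma max_graph_extend x :
  (exists y, G (x, y)) \/ exists P, unit_relation x P.
Proof.
case: (pselect (exists P, unit_relation x P)) => [|noP]; first by right.
left.
pose I (h : {poly F}) := exists H : {poly (K * F)%type},
  [/\ H \is a polyOver G, map_poly snd H = h & root (map_poly fst H) x].
suff [y Iy] : exists y, forall h, I h -> root h y.
  exists y.
  (* Values at [(x, y)] of polynomials over the graph. Single-valuedness holds because [y] is a root
     of the reduction of every relation of [x]. *)
  pose P : {pred (K * F)%type} := fun u =>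
    `[< exists2 Q : {poly (K * F)%type}, Q \is a polyOver G & u = Q.[(x, y)] >].
  have P1 : P 1 by apply/asboolP; exists 1; rewrite ?rpred1 ?hornerC.
  have PB u v : P u -> P v -> P (u - v).
    move=> /asboolP[Q GQ ->] /asboolP[T GT ->]; apply/asboolP; exists (Q - T).
      exact: rpredB.
    by rewrite hornerD hornerN.
  have PM u v : P u -> P v -> P (u * v).
    move=> /asboolP[Q GQ ->] /asboolP[T GT ->]; apply/asboolP; exists (Q * T).
      exact: rpredM.
    by rewrite hornerM.
  have Pf b : P (0, b) -> b = 0.
    move=> /asboolP[Q GQ E].
    have: (map_poly snd Q).[y] = 0.
      apply/rootP/Iy; exists Q; split=> //; apply/rootP.
      by rewrite -[x]/((x, y).1) (horner_map fst Q) -E.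
    by rewrite -[y in LHS]/((x, y).2) (horner_map snd Q) -E.
  have := @maxS (SubringGraph P1 PB PM Pf); apply.
    by move=> u Gu; apply/asboolP; exists u%:P; rewrite ?polyOverC ?hornerC.
  by apply/asboolP; exists 'X; rewrite ?polyOverX ?hornerX.
case: (pselect (exists2 h, I h & h != 0)) => [[h0 Ih0 nh0]|no]; last first.
  by exists 0 => h Ih; case: (eqVneq h 0) => [->|nh]; [exact: root0|case: no; exists h].
(* Division by a nonzero reduced relation of least size: its leading coefficient is invertible in
   the graph, so each division step lifts and every reduced relation vanishes at a root of [h]. *)
have : exists n, `[< exists h, [/\ I h, h != 0 & size h = n] >].
  by exists (size h0); apply/asboolP; exists h0.
move=> exn; case: (ex_minnP exn) => n /asboolP[h [[H [GH hE rH]] nh szh]] minn.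
pose b := (H`_(n.-1)).1.
have bE : H`_(n.-1) = (b, lead_coef h).
  by rewrite lead_coefE szh -hE coef_map /= [LHS]surjective_pairing.
have lh : lead_coef h != 0 by rewrite lead_coef_eq0.
have Gb : G (b^-1, (lead_coef h)^-1).
  by apply: max_graph_inv => //; rewrite -bE; exact: (polyOverP GH).
(* A constant [h] would rescale to a relation reducing to 1. *)
have szh1 : size h != 1%N.
  apply: contra_notN noP => /size_poly1P[c c0 hc].
  exists ((b^-1, (lead_coef h)^-1)%:P * H); split.
  - by rewrite rpredM ?polyOverC.
  - by rewrite rmorphM /= hE map_polyC /= hc lead_coefC -polyCM mulVf.
  - by rewrite rmorphM /= rootM rH orbT.
have /closed_rootP[y ry] := szh1; exists y.
suff: forall m (g : {poly F}), (size g < m)%N -> I g -> root g y by move=> A g; exact: (A _ g (ltnSn _)).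
elim=> // m IHm g szg [Gg [GGg gE rg]].
case: (eqVneq g 0) => [->|ng]; first exact: root0.
have Ig : I g by exists Gg.
have leg : (size h <= size g)%N by rewrite szh; apply: minn; apply/asboolP; exists g.
pose k := (size g - size h)%N.
pose c := ((Gg`_(size g).-1).1 / b, lead_coef g / lead_coef h).
have Gc : G c.
  suff -> : c = Gg`_(size g).-1 * (b^-1, (lead_coef h)^-1).
    by apply: graphM => //; exact: (polyOverP GGg).
  by rewrite /c lead_coefE -gE coef_map /=; case: (Gg`__).
pose g' := g - (lead_coef g / lead_coef h)%:P * 'X^k * h.
have rg' : root g' y.
  apply: IHm.
    apply: (@leq_trans (size g)) => //.
    rewrite -(@prednK (size g)) ?size_poly_gt0 // ltnS.
    apply/leq_sizeP => j; rewrite leq_eqVlt => /orP[/eqP <-|ltj].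
      rewrite coefB -mulrA coefCM coefXnM ltnNge.
      have -> : (k <= (size g).-1)%N.
        rewrite /k leq_subLR; case: (size h) (size_poly_gt0 h) => [|s _]; first by rewrite nh.
        by rewrite addSn (leq_trans (leqSpred _)) // ltnS leq_addl.
      have -> : ((size g).-1 - k = (size h).-1)%N.
        rewrite /k; case: (size h) (size_poly_gt0 h) leg => [|s _]; first by rewrite nh.
        by case: (size g) => // t; rewrite ltnS subSS /= => ?; rewrite subKn.
      by rewrite -!lead_coefE /= divfK // subrr.
    have szgj : (size g <= j)%N by case: (size g) (size_poly_gt0 g) ltj => //; rewrite ng.
    rewrite coefB nth_default // -mulrA coefCM coefXnM ltnNge.
    rewrite (leq_trans _ szgj) ?leq_subr //= [h`__]nth_default ?mulr0 ?subr0 //.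
    by rewrite leq_subRL ?subnK // (leq_trans (leq_subr _ _)).
  exists (Gg - c%:P * 'X^k * H); split.
  - by rewrite rpredB ?rpredM ?polyOverC ?rpredX ?polyOverX.
  - by rewrite rmorphB !rmorphM /= gE hE map_polyC map_polyXn.
  - rewrite rmorphB !rmorphM /= /root hornerD hornerN (rootP rg) add0r oppr_eq0.
    by rewrite -/(root _ x) rootM rH orbT.
move: rg'; rewrite /g' /root hornerD hornerN [X in _ - X]hornerM (rootP ry).
by rewrite mulr0 subr0.
Qed.

(** Chevalley's argument: if neither [x] nor its inverse were in the ring, both would satisfy
    relations reducing to 1, and the longer of the two could always be shortened by the other. *)
Lemma max_graph_valuation x :
  (exists y, G (x, y)) \/ (x != 0 /\ G (x^-1, 0)).
Proof.
case: (max_graph_extend x) => [|[P0 uP0]]; first by left.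
case: (eqVneq x 0) => [->|x0]; first by left; exists 0; exact: (@rpred0 _ (graph_pred S)).
right; split=> //.
suff [y Gy] : exists y, G (x^-1, y).
  case: (eqVneq y 0) Gy => [-> //|y0 Gy]; exfalso.
  have := max_graph_inv y0 Gy; rewrite invrK => Gx.
  have [GP P1 rP] := uP0.
  have : G (P0.[(x, y^-1)]) by exact: rpred_horner.
  rewrite [P0.[_]]surjective_pairing -(horner_map fst) -(horner_map snd) /= P1 hornerC.
  rewrite (rootP rP) => /(@graph_fun _ _ S) /eqP.
  by rewrite oner_eq0.
case: (max_graph_extend x^-1) => [//|[Q0 uQ0]]; exfalso.
have main (z : K) (P Q : {poly (K * F)%type}) : z != 0 ->
    unit_relation z P -> unit_relation z^-1 Q -> (size Q <= size P)%N ->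
  exists2 P', unit_relation z P' & (size P' < size P)%N.
  move=> z0 [GP P1 rP] [GQ Q1 rQ] leQP.
  case szP : (size P) => [|n].
    have P0' : P = 0 by apply/size_poly_leq0P; rewrite szP.
    by move: P1; rewrite P0' map_poly0 => /eqP; rewrite eq_sym oner_eq0.
  case: n => [|n] in szP *.
    have /size_poly1P[c c0 Pc] : size P == 1%N by rewrite szP.
    move: P1 rP; rewrite Pc !map_polyC /= => /polyC_inj c2; rewrite rootC => /eqP c1.
    move: GP; rewrite Pc polyOverC [c]surjective_pairing c1 c2.
    by move=> /(@graph_fun _ _ S) /eqP; rewrite oner_eq0.
  (* [R] is the reversal of [Q] without its top term, so the constant coefficient [q] of [Q]
     satisfies [q * z ^+ n.+1 = - R.[z]]. As [q] reduces to 1 and [R] to 0, multiplying [P] by [q]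
     and substituting removes the top term and keeps the reduction. *)
  pose R : {poly (K * F)%type} := \poly_(i < n.+1) Q`_(n.+1 - i).
  have GR : R \is a polyOver G.
    by apply/polyOverP => i; rewrite coef_poly; case: ifP => _; rewrite ?rpred0 ?(polyOverP GQ).
  have P2 i : (P`_i).2 = (i == 0)%:R.
    by move: (congr1 (fun q : {poly F} => q`_i) P1); rewrite coef_map coef1.
  have Q2 i : (Q`_i).2 = (i == 0)%:R.
    by move: (congr1 (fun q : {poly F} => q`_i) Q1); rewrite coef_map coef1.
  exists ((Q`_0)%:P * (P - (P`_(n.+1))%:P * 'X^(n.+1)) - (P`_(n.+1))%:P * R); last first.
    rewrite ltnS; apply/leq_sizeP => j lej.
    rewrite coefB !coefCM coefB coefCM coefXn coef_poly ltnNge lej /= mulr0 subr0.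
    move: lej; rewrite leq_eqVlt => /orP[/eqP <-|ltj].
      by rewrite eqxx mulr1 subrr mulr0.
    by rewrite [P`_j]nth_default ?szP // gtn_eqF // mulr0 subr0 mulr0.
  split.
  - by rewrite rpredB ?rpredM ?rpredB ?polyOverC ?rpredM ?polyOverC ?rpredX ?polyOverX ?(polyOverP GP) ?(polyOverP GQ).
  - apply/polyP => i; rewrite coef_map coefB !coefCM coefB coefCM coefXn coef_poly coef1 /=.
    rewrite Q2 !P2 /= mul0r subr0 mul1r.
    by rewrite [X in _ - X]mul0r subr0.
  - have Pz : \sum_(i < n.+2) (P`_i).1 * z ^+ i = 0.
      rewrite -[RHS](rootP rP) (horner_coef_wide _ (_ : size _ <= n.+2)%N).
        by apply: eq_bigr => i _; rewrite coef_map.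
      by rewrite (leq_trans (size_poly _ _)) ?szP.
    have Qz : \sum_(i < n.+2) (Q`_i).1 * z^-1 ^+ i = 0.
      rewrite -[RHS](rootP rQ) (horner_coef_wide _ (_ : size _ <= n.+2)%N).
        by apply: eq_bigr => i _; rewrite coef_map.
      by rewrite (leq_trans (size_poly _ _)) // (leq_trans leQP) ?szP.
    rewrite /root rmorphB !rmorphM rmorphB rmorphM /= !map_polyC map_polyXn.
    rewrite !(hornerE, hornerZ) /=.
    have -> : (map_poly fst P).[z] = 0 by exact/rootP.
    have -> : (map_poly fst R).[z] = - (Q`_0).1 * z ^+ n.+1.
      rewrite (horner_coef_wide _ (_ : size _ <= n.+1)%N); last first.
        by rewrite (leq_trans (size_poly _ _)) // size_poly.
      move: Qz; rewrite big_ord_recl /= expr0 mulr1 => /eqP; rewrite addr_eq0 => /eqP ->.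
      rewrite opprK mulr_suml (reindex_inj rev_ord_inj) /=; apply: eq_bigr => i _.
      rewrite coef_map coef_poly /= ltn_subrL /= /bump /= add1n subKn //.
      rewrite -mulrA; congr (_ * _); rewrite exprVn.
      apply: (canRL (mulKf _)); first by rewrite expf_neq0.
      by rewrite -exprD subnKC // ltn_ord.
    by rewrite sub0r mulrN mulNr mulrN opprK mulrCA addrC subrr.
suff: forall m (P Q : {poly (K * F)%type}), (size P + size Q < m)%N -> unit_relation x P -> unit_relation x^-1 Q -> False.
  by move=> A; exact: (A _ P0 Q0 (ltnSn _)).
elim=> // m IHm P Q szm uP uQ.
have [leQP|ltPQ] := leqP (size Q) (size P).
  have [P' uP' ltP'] := main _ _ _ x0 uP uQ leQP.
  by apply: (IHm P' Q) => //; rewrite -ltnS (leq_ltn_trans _ szm) // ltn_add2r.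
have uP2 : unit_relation x^-1^-1 P by rewrite invrK.
have [|Q' uQ' ltQ'] := main x^-1 Q P _ uQ uP2 (ltnW ltPQ); first by rewrite invr_eq0.
by apply: (IHm P Q') => //; rewrite -ltnS (leq_ltn_trans _ szm) // ltn_add2l.
Qed.

End MaximalGraph.

(** * Existence of a maximal pair *)

Section MaximalGraphExists.
Import classical_sets.

Lemma max_graph_exists (F : closedFieldType) :
  exists S : subring_graph algC F, forall S' : subring_graph algC F,
    {subset graph_pred S <= graph_pred S'} ->
    {subset graph_pred S' <= graph_pred S}.
Proof.
pose T := (algC * F)%type.
pose ok (A : set T) := exists S : subring_graph algC F, forall u, A u <-> u \in graph_pred S.
have base : ok [set u : T | exists n : int, u = n%:~R]%classic.
  pose P : {pred T} := fun u => `[< exists n : int, u = n%:~R >].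
  have P1 : P 1 by apply/asboolP; exists 1.
  have PB u v : P u -> P v -> P (u - v).
    by move=> /asboolP[m ->] /asboolP[n ->]; apply/asboolP; exists (m - n); rewrite rmorphB.
  have PM u v : P u -> P v -> P (u * v).
    by move=> /asboolP[m ->] /asboolP[n ->]; apply/asboolP; exists (m * n); rewrite rmorphM.
  have Pf b : P (0, b) -> b = 0.
    move=> /asboolP[n E].
    have f1 : fst (n%:~R : T) = n%:~R :> algC by exact: (rmorph_int (@fst algC F)).
    move/esym/eqP: (congr1 fst E); rewrite f1 intr_eq0 => /eqP n0.
    by move: (congr1 snd E); rewrite n0.
  by exists (SubringGraph P1 PB PM Pf) => u; split=> [?|/asboolP //]; exact/asboolP.
have [|A [PA maxA]] := @Zorn_bigcup T [set A | A = set0 \/ ok A]%classic.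
  move=> C CP Ctot.
  case: (pselect (exists2 A, C A & ok A)) => [[B0 CB0 okB0]|no]; last first.
    left; apply/seteqP; split=> // u [A CA Au].
    by case: (CP _ CA) => [A0|okA]; [rewrite -A0|case: no; exists A].
  right; pose P : {pred T} := fun u => `[< exists2 A, C A & A u >].
  have dir u v : P u -> P v -> exists A, [/\ C A, ok A, A u & A v].
    move=> /asboolP[A CA Au] /asboolP[B CB Bv].
    have okA : ok A by case: (CP _ CA) => // A0; rewrite A0 in Au.
    have okB : ok B by case: (CP _ CB) => // B00; rewrite B00 in Bv.
    by case: (Ctot _ _ CA CB) => sub; [exists B|exists A]; split=> //; exact: sub.
  have P1 : P 1 by apply/asboolP; exists B0 => //; case: okB0 => S ->; exact: graph1.
  have PB u v : P u -> P v -> P (u - v).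
    move=> Pu Pv; have [A [CA [S AE] /AE Au /AE Av]] := dir _ _ Pu Pv.
    by apply/asboolP; exists A => //; apply/AE/graphB.
  have PM u v : P u -> P v -> P (u * v).
    move=> Pu Pv; have [A [CA [S AE] /AE Au /AE Av]] := dir _ _ Pu Pv.
    by apply/asboolP; exists A => //; apply/AE/graphM.
  have Pf b : P (0, b) -> b = 0.
    move=> Pb; have [A [CA [S AE] /AE Au _]] := dir _ _ Pb Pb.
    exact: graph_fun Au.
  exists (SubringGraph P1 PB PM Pf) => u; split=> [[A CA Au]|/asboolP[A CA Au]].
    by apply/asboolP; exists A.
  by exists A.
have [S SE] : ok A.
  case: PA => // A0; exfalso; apply: (maxA [set u : T | exists n : int, u = n%:~R]%classic); last by right.
  rewrite A0; split=> // /(_ 1) []; first by exists 1.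
exists S => S' sub u Su'; apply/SE; apply: contrapT => nAu.
apply: (maxA [set u | u \in graph_pred S']%classic); last by right; exists S'.
by split=> [v /SE /sub //|/(_ u Su')].
Qed.

End MaximalGraphExists.

Section PlaceExists.
Variable (F : closedFieldType).

(** [v] identifies [R] with a valuation ring of [algC], and [f] kills its maximal ideal, which
    consists of 0 and the inverses of the elements outside. *)
Definition is_place (R : comNzRingType) (v : {rmorphism R -> algC}) (f : {rmorphism R -> F}) : Prop :=
  injective v /\ forall x : algC, (exists r, v r = x) \/ (x != 0 /\ exists2 r, v r = x^-1 & f r = 0).

(** Valuation rings are integrally closed: the inverse of a missing [z] would reduce to 0 although
    its power of exponent [n] is 1. *)
Lemma place_root_unity (R : comNzRingType) (v : {rmorphism R -> algC}) (f : {rmorphism R -> F})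
    (n : nat) (z : algC) :
  is_place v f -> (0 < n)%N -> z ^+ n = 1 -> exists r, v r = z.
Proof.
move=> [vinj /(_ z) [//|[_ [r vr fr]]]] n0 zn.
have : v (r ^+ n) = 1 by rewrite rmorphXn vr exprVn zn invr1.
rewrite -(rmorph1 v) => /vinj/(congr1 f); rewrite rmorphXn fr rmorph1 expr0n gtn_eqF // => /eqP.
by rewrite eq_sym oner_eq0.
Qed.

(** A maximal place reduces the roots of unity of order dividing [n] onto those of [F], so [w] is
    the image of some [z ^+ i]. That power is again primitive, hence Galois conjugate to [z], and
    the automorphism is absorbed into the embedding. *)
Lemma place_exists (n : nat) (z : algC) (w : F) :
  n.-primitive_root z -> n.-primitive_root w ->
  exists (R : comNzRingType) (v : {rmorphism R -> algC}) (f : {rmorphism R -> F}),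
    is_place v f /\ exists2 r, v r = z & f r = w.
Proof.
move=> prz prw; have [S maxS] := max_graph_exists F.
pose R : comNzRingType := graph_ring S.
pose v0 : {rmorphism R -> algC} := @graph_fst _ _ S.
pose f : {rmorphism R -> F} := @graph_snd _ _ S.
have n0 := prim_order_gt0 prz.
have v0_inj : injective v0 by exact: graph_fst_inj.
have plf : is_place v0 f.
  split=> // x; case: (max_graph_valuation maxS x) => [[y Gxy]|[x0 Gx]].
    by left; exists (exist _ (x, y) Gxy).
  by right; split=> //; exists (exist _ (x^-1, 0) Gx).
have [r0 r0z] := place_root_unity plf n0 (prim_expr_order prz).
have prodR : \prod_(0 <= i < n) ('X - (r0 ^+ i)%:P) = 'X^n - 1 :> {poly R}.
  apply: (map_inj_poly v0_inj (rmorph0 v0)).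
  rewrite rmorph_prod rmorphB /= map_polyXn rmorph1 -(factor_Xn_sub_1 prz).
  apply: eq_bigr => i _.
  have -> : z ^+ i = v0 (r0 ^+ i) by rewrite rmorphXn r0z.
  exact: (map_polyXsubC v0).
have [i wE] : exists i, w = f (r0 ^+ i).
  have : root (map_poly f (\prod_(0 <= i < n) ('X - (r0 ^+ i)%:P))) w.
    rewrite prodR rmorphB /= map_polyXn rmorph1 /root !hornerE.
    by rewrite (prim_expr_order prw) subrr.
  rewrite rmorph_prod /root horner_prod prodf_seq_eq0 => /hasP[i _ /=].
  by rewrite rmorphB /= map_polyX map_polyC hornerXsubC subr_eq0 => /eqP ->; exists i.
have pri : n.-primitive_root (z ^+ i).
  have zin : (z ^+ i) ^+ n = 1.
    by rewrite exprAC (prim_expr_order prz) expr1n.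
  have [m prm mn] := prim_order_exists n0 zin.
  suff nm : n = m by rewrite {1}nm.
  apply/eqP; rewrite eqn_dvd mn andbT (prim_order_dvd prw) wE -rmorphXn.
  suff -> : (r0 ^+ i) ^+ m = 1 by rewrite rmorph1.
  by apply: v0_inj; rewrite !rmorphXn r0z (prim_expr_order prm) rmorph1.
have [k zk] : exists k, z = (z ^+ i) ^+ k.
  have [k kE] := prim_rootP pri (prim_expr_order prz).
  by exists k.
have cok : coprime k n by rewrite -(prim_root_exp_coprime _ pri) -zk.
have [tau tauE] := Qn_aut_exists cok.
exists R, (tau \o v0), f; split; last first.
  exists (r0 ^+ i) => //=.
  by rewrite rmorphXn r0z /= tauE -?zk // exprAC (prim_expr_order prz) expr1n.
split=> [u u' /= /fmorph_inj/v0_inj //|x].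
case: plf => _ /(_ (algC_invaut tau x)) [[r rE]|[x0 [r rE fr]]].
  by left; exists r; rewrite /= rE algC_invautK.
right; split; first by rewrite -(fmorph_eq0 (algC_invaut tau)).
by exists r => //=; rewrite rE fmorphV algC_invautK.
Qed.
End PlaceExists.

(** * Eigenvalues and Kronecker products *)

Lemma eigenvalues_perm (F : closedFieldType) n (A : 'M[F]_n) (s : seq F) :
  char_poly A = \prod_(a <- s) ('X - a%:P) -> perm_eq (eigenvalues A) s.
Proof.
move=> sE; apply: prod_XsubC_eq; rewrite -sE /eigenvalues.
by case: closed_field_poly_normal => r /= E; rewrite [RHS]E (monicP (char_poly_monic A)) scale1r.
Qed.

Lemma char_poly_eigenvalues (F : closedFieldType) n (A : 'M[F]_n) :
  char_poly A = \prod_(a <- eigenvalues A) ('X - a%:P).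
Proof.
rewrite /eigenvalues.
by case: closed_field_poly_normal => r /= E; rewrite [LHS]E (monicP (char_poly_monic A)) scale1r.
Qed.

Lemma mxtrace_eigenvalues (F : closedFieldType) n (A : 'M[F]_n) :
  \tr A = \sum_(a <- eigenvalues A) a.
Proof.
have := char_poly_eigenvalues A; set s := eigenvalues A => sE.
have szs : size s = n.
  by apply: succn_inj; rewrite -(size_char_poly A) sE size_prod_XsubC.
case: n => [|n] in A s sE szs *.
  by rewrite (size0nil szs) big_nil /mxtrace big_ord0.
apply: oppr_inj; rewrite -char_poly_trace // sE -[n.+1]szs coefPn_prod_XsubC //.
by rewrite szs.
Qed.

Lemma char_poly_lblock (R : comNzRingType) m n (A : 'M[R]_m) (C : 'M[R]_(n, m)) (B : 'M[R]_n) :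
  char_poly (block_mx A 0 C B) = char_poly A * char_poly B.
Proof.
have E : char_poly_mx (block_mx A 0 C B)
    = block_mx (char_poly_mx A) 0 (- map_mx polyC C) (char_poly_mx B).
  rewrite /char_poly_mx map_block_mx scalar_mx_block.
  by rewrite opp_block_mx add_block_mx map_mx0 oppr0 addr0 add0r.
by rewrite /char_poly E det_lblock.
Qed.

Lemma char_poly_conj (R : comUnitRingType) n (Q A : 'M[R]_n) :
  Q \in unitmx -> char_poly (Q *m A *m invmx Q) = char_poly A.
Proof.
move=> uQ; rewrite /char_poly.
have -> : char_poly_mx (Q *m A *m invmx Q)
    = map_mx polyC Q *m char_poly_mx A *m map_mx polyC (invmx Q).
  rewrite /char_poly_mx mulmxBr mulmxBl -!map_mxM; congr (_ - _).
  by rewrite scalar_mxC -mulmxA -map_mxM mulmxV // map_mx1 mulmx1.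
rewrite !det_mulmx mulrAC -det_mulmx -map_mxM mulmxV // map_mx1 det1 mul1r //.
Qed.

Section Kronecker.
Variable R : comUnitRingType.

(** The action [X |-> A^T *m X *m B] on row-vectorised matrices; multiplicativity becomes
    composition of maps. *)
Definition kron m n (A : 'M[R]_m) (B : 'M[R]_n) : 'M[R]_(m * n) :=
  lin_mx (mulmxr B \o mulmx A^T).

Lemma kronM m n (A1 A2 : 'M[R]_m) (B1 B2 : 'M[R]_n) :
  kron (A1 *m A2) (B1 *m B2) = kron A1 B1 *m kron A2 B2.
Proof.
apply/row_matrixP => i; rewrite !rowE mulmxA -(vec_mxK (delta_mx 0 i)).
by rewrite !mul_vec_lin /= trmx_mul !mulmxA.
Qed.

Lemma kron1 m n : kron (1%:M : 'M[R]_m) (1%:M : 'M[R]_n) = 1%:M.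
Proof.
apply/row_matrixP => i; rewrite !rowE -(vec_mxK (delta_mx 0 i)).
by rewrite !mul_vec_lin /= trmx1 mul1mx !mulmx1.
Qed.

Lemma kron_diag m n (d : 'rV[R]_m) (e : 'rV[R]_n) :
  kron (diag_mx d) (diag_mx e) = diag_mx (mxvec (\matrix_(i, j) (d 0 i * e 0 j))).
Proof.
apply/row_matrixP => i; rewrite !rowE -(vec_mxK (delta_mx 0 i)).
rewrite mul_vec_lin /= tr_diag_mx mul_diag_mx mul_mx_diag; apply/rowP => k.
case/mxvec_indexP: k => a b.
rewrite mul_mx_diag [RHS]mxE !mxvecE [LHS]mxE [X in X * _]mxE [in RHS]mxE.
have -> : (delta_mx 0 i : 'rV[R]_(m * n)) 0 (mxvec_index a b) = vec_mx (delta_mx 0 i) a b by rewrite [RHS]mxE.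
by move: (vec_mx _ _ _) => x; rewrite mxE mulrAC mulrC.
Qed.

Lemma char_poly_kron_diag m n (d : 'rV[R]_m) (e : 'rV[R]_n) :
  char_poly (kron (diag_mx d) (diag_mx e)) =
  \prod_(a <- [seq d 0 i * e 0 j | i <- enum 'I_m, j <- enum 'I_n]) ('X - a%:P).
Proof.
rewrite kron_diag char_poly_trig ?diag_mx_is_trig // big_allpairs_dep.
rewrite big_enum /= (eq_bigr (fun i => \prod_(j < n) ('X - (d 0 i * e 0 j)%:P))) => [|i _].
  rewrite pair_bigA (reindex _ (curry_mxvec_bij m n)) /=; apply: eq_bigr => -[i j] _ /=.
  by rewrite mxE eqxx mulr1n mxvecE mxE.
by rewrite big_enum.
Qed.
End Kronecker.

(** * Brauer characters *)

(** The two sizes are only provably equal: in the uses one is a sum of ranks, or the degree of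
    another representation. *)
Lemma char_poly_intertwine (R : comUnitRingType) m n (A : 'M[R]_m) (B : 'M[R]_n)
    (Q : 'M[R]_(m, n)) (Q' : 'M[R]_(n, m)) :
  m = n -> Q' *m Q = 1%:M -> A *m Q = Q *m B -> char_poly A = char_poly B.
Proof.
move=> E; rewrite {}E in A Q Q' *; move=> Q'Q AQ.
have [_ uQ] := mulmx1_unit Q'Q.
have -> : A = Q *m B *m invmx Q by rewrite -AQ mulmxK.
exact: char_poly_conj.
Qed.

Section BrauerCharTheory.
Variables (p : nat) (F : closedFieldType) (theta : F -> algC).
Hypothesis pcharF : p \in [pchar F].
Hypothesis th : brauer_lift theta.

Lemma nat_neq0_p' n : p^'.-nat n -> (n%:R : F) != 0.
Proof.
move=> p'n; rewrite -(dvdn_pcharf pcharF).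
by move: p'n; rewrite p'natE //; exact: pcharf_prime pcharF.
Qed.

Lemma closed_prim_root n : p^'.-nat n -> exists w : F, n.-primitive_root w.
Proof.
move=> p'n; have n_gt0 : (0 < n)%N by case/andP: p'n.
pose r := sval (closed_field_poly_normal ('X^n - 1 : {poly F})).
have rE : 'X^n - 1 = \prod_(z <- r) ('X - z%:P) :> {poly F}.
  by rewrite /r; case: closed_field_poly_normal => s /= E; rewrite [LHS]E lead_coefXnsubC // scale1r.
have szr : size r = n.
  by apply: succn_inj; rewrite -(size_prod_XsubC r id) -rE size_XnsubC.
have ur : uniq r by rewrite -separable_prod_XsubC -rE separable_Xn_sub_1 ?nat_neq0_p'.
have : has n.-primitive_root r.
  apply: has_prim_root => //; last by rewrite szr.
  by apply/allP => z zr; rewrite unity_rootE -subr_eq0; move: zr; rewrite -root_prod_XsubC -rE /root !hornerE.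
by case/hasP=> w _ prw; exists w.
Qed.

Lemma theta1 : theta 1 = 1. Proof. by case: th. Qed.

Lemma root_unityX (R : nzRingType) (x : R) n k : (0 < n)%N -> x ^+ n = 1 -> is_root_of_unity (x ^+ k).
Proof. by move=> n0 xn; exists n => //; rewrite exprAC xn expr1n. Qed.

Lemma thetaX (x : F) n k : (0 < n)%N -> x ^+ n = 1 -> theta (x ^+ k) = theta x ^+ k.
Proof.
move=> n0 xn; case: th => th1 thM _; elim: k => [|k IH]; first by rewrite !expr0.
rewrite !exprS thM ?IH //; [by exists n | exact: root_unityX xn].
Qed.

Lemma theta_unity (x : F) n : (0 < n)%N -> x ^+ n = 1 -> theta x ^+ n = 1.
Proof. by move=> n0 xn; rewrite -(thetaX n n0 xn) xn theta1. Qed.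

Lemma theta_prim n (w : F) : n.-primitive_root w -> n.-primitive_root (theta w).
Proof.
move=> prw; have n0 := prim_order_gt0 prw; have wn := prim_expr_order prw.
have [m prm mn] := prim_order_exists n0 (theta_unity n0 wn).
suff nm : n = m by rewrite {1}nm.
apply/eqP; rewrite eqn_dvd mn andbT (prim_order_dvd prw); apply/eqP.
case: th => _ _ inj; apply: inj; [exact: root_unityX wn|by exists n; rewrite ?expr1n|].
by rewrite (thetaX _ n0 wn) (prim_expr_order prm) theta1.
Qed.

(** For such a place [theta] is a section of the reduction on roots of unity of order dividing [n],
    so that Brauer character values lift traces. *)
Definition adapted_place n (R : comNzRingType) (v : {rmorphism R -> algC}) (f : {rmorphism R -> F}) : Prop :=
  is_place v f /\ forall a : F, a ^+ n = 1 -> exists2 r, v r = theta a & f r = a.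

Lemma adapted_place_exists n : p^'.-nat n ->
  exists (R : comNzRingType) (v : {rmorphism R -> algC}) (f : {rmorphism R -> F}), adapted_place n v f.
Proof.
move=> p'n; have [w prw] := closed_prim_root p'n.
have [R [v [f [pl [r vr fr]]]]] := place_exists (theta_prim prw) prw.
exists R, v, f; split=> // a an.
have n0 := prim_order_gt0 prw; have wn := prim_expr_order prw.
have [k ->] := prim_rootP prw an.
by exists (r ^+ k); rewrite rmorphXn ?vr ?fr // (thetaX _ n0 wn).
Qed.

Section OneGroup.
Variables (gT : finGroupType) (G : {group gT}).
Notation bchar := (brauer_char p theta).

Lemma p_regularE x : (x \in p_regular p G) = (x \in G) && p^'.-elt x.
Proof. by rewrite inE. Qed.

Lemma brauer_charE n (rG : mx_representation F G n) x :
  bchar rG x = (\sum_(a <- eigenvalues (rG x)) theta a) *+ (x \in p_regular p G).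
Proof. exact: cfunE. Qed.

Lemma brauer_char_roots n (rG : mx_representation F G n) x (s : seq F) :
  x \in p_regular p G -> char_poly (rG x) = \prod_(a <- s) ('X - a%:P) ->
  bchar rG x = \sum_(a <- s) theta a.
Proof.
by move=> px sE; rewrite brauer_charE px mulr1n; apply/perm_big/eigenvalues_perm.
Qed.

Lemma p_regular_normal : p_regular p G <| G.
Proof.
apply/andP; split; first by apply/subsetP => y; rewrite inE => /andP[].
apply/normsP => y Gy; apply/setP => z.
by rewrite mem_conjg !inE groupJr ?groupV // p_eltJ.
Qed.

Lemma preg_restrE (chi : 'CF(G)) x : preg_restr p chi x = chi x *+ (x \in p_regular p G).
Proof. by rewrite cfunE cfuniE ?p_regular_normal // mulr_natr. Qed.

Lemma brauer_char_supp n (rG : mx_representation F G n) x :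
  x \notin p_regular p G -> bchar rG x = 0.
Proof. by rewrite brauer_charE => /negbTE->. Qed.

Lemma mx_rsim_brauer_char n1 n2 (r1 : mx_representation F G n1) (r2 : mx_representation F G n2) :
  mx_rsim r1 r2 -> bchar r1 = bchar r2.
Proof.
case=> B E Bf Bc; apply/cfunP => x; rewrite [RHS]brauer_charE.
case: (boolP (x \in p_regular p G)) => px; last by rewrite brauer_char_supp // mulr0n.
rewrite mulr1n; apply: brauer_char_roots => //; rewrite -char_poly_eigenvalues.
have Gx : x \in G by move: px; rewrite inE => /andP[].
have /row_fullP[Q' QB] : row_full B by rewrite /row_full (eqP Bf) E.
exact: char_poly_intertwine E QB (Bc x Gx).
Qed.

Lemma char_poly_sub_fact n (rG : mx_representation F G n) (U : 'M_n) (modU : mxmodule rG U) x :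
  x \in G -> char_poly (rG x) = char_poly (submod_repr modU x) * char_poly (factmod_repr modU x).
Proof.
move=> Gx; pose Q := col_mx (val_submod (1%:M : 'M_(\rank U))) (val_factmod (1%:M : 'M_(\rank (cokermx U)))).
pose Q' := row_mx (in_submod U 1%:M) (in_factmod U 1%:M).
have Q'Q : Q' *m Q = 1%:M.
  by rewrite mul_row_col -val_submodE -val_factmodE add_sub_fact_mod.
pose W := val_factmod (1%:M : 'M_(\rank (cokermx U))) *m rG x.
rewrite -(char_poly_lblock _ (in_submod U W)).
apply/esym/(char_poly_intertwine _ Q'Q); first by rewrite mxrank_coker subnKC // rank_leq_row.
rewrite mul_block_col mul0mx addr0 mul_col_mx; congr col_mx.
  by rewrite -val_submodE -[submod_repr modU x]mul1mx val_submodJ.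
by rewrite -val_submodE -val_factmodE -[factmod_repr modU x]mul1mx val_factmodJ // add_sub_fact_mod.
Qed.

Lemma brauer_char_sub_fact n (rG : mx_representation F G n) (U : 'M_n) (modU : mxmodule rG U) :
  bchar rG = bchar (submod_repr modU) + bchar (factmod_repr modU).
Proof.
apply/cfunP => x; rewrite [RHS]cfunE.
case: (boolP (x \in p_regular p G)) => px; last by rewrite !brauer_char_supp // addr0.
have Gx : x \in G by move: px; rewrite inE => /andP[].
rewrite ![in RHS]brauer_charE px !mulr1n -big_cat; apply: brauer_char_roots => //.
by rewrite (char_poly_sub_fact modU Gx) big_cat /= -!char_poly_eigenvalues.
Qed.

Lemma brauer_char_dim0 (rG : mx_representation F G 0) : bchar rG = 0.
Proof.
apply/cfunP => x; rewrite [RHS]cfunE.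
case: (boolP (x \in p_regular p G)) => px; last by rewrite !brauer_char_supp.
rewrite (brauer_char_roots (s := [::])) ?big_nil //.
by rewrite /char_poly det_mx00.
Qed.

(** [Q] records what passes from a module to its composition factors: later, the scalar action of a
    class sum, or the linear relations between the operators of the whole module. *)
Lemma brauer_char_decomp_in (Q : forall n, mx_representation F G n -> Prop) :
  (forall n (rG : mx_representation F G n) U (modU : mxmodule rG U),
     Q n rG -> Q _ (submod_repr modU) /\ Q _ (factmod_repr modU)) ->
  forall n (rG : mx_representation F G n), Q n rG ->
  exists s : seq 'CF(G), bchar rG = \sum_(psi <- s) psi /\
    forall psi, psi \in s -> exists m (r : mx_representation F G m),
      [/\ mx_irreducible r, Q m r & psi = bchar r].
Proof.
move=> Qsub n rG; have [m] := ubnP n; elim: m n rG => // m IHm n rG ltnm QrG.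
case: (pselect (mx_irreducible rG)) => [irr|nirr].
  exists [:: bchar rG]; rewrite big_seq1; split=> // psi; rewrite inE => /eqP->.
  by exists n, rG.
case: (posnP n) => [n0|n_gt0].
  by subst n; exists [::]; rewrite brauer_char_dim0 big_nil.
have [U [modU nzU nfU]] : exists U : 'M_n, [/\ mxmodule rG U, U != 0 & ~~ row_full U].
  apply: contrapT => no; apply: nirr; apply/mx_irrP; split=> // U modU nzU.
  by apply: contrapT => nf; apply: no; exists U; split=> //; exact/negP.
have rU : (0 < \rank U)%N by rewrite lt0n mxrank_eq0.
have rU2 : (\rank U < n)%N by rewrite ltn_neqAle nfU rank_leq_row.
have [QU QU'] := Qsub _ _ _ modU QrG.
have [||s1 [s1E s1P]] := IHm _ (submod_repr modU) => //; first exact: leq_trans rU2 _.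
have [||s2 [s2E s2P]] := IHm _ (factmod_repr modU) => //.
  by rewrite mxrank_coker (leq_trans _ (_ : n <= m)%N) // ltn_subrL rU.
exists (s1 ++ s2); split; first by rewrite big_cat /= -s1E -s2E (brauer_char_sub_fact modU).
by move=> psi; rewrite mem_cat => /orP[/s1P|/s2P].
Qed.

Lemma brauer_char_decomp n (rG : mx_representation F G n) :
  exists s : seq 'CF(G), (forall psi, psi \in s -> IBr p theta psi) /\ bchar rG = \sum_(psi <- s) psi.
Proof.
have [//|//|s [sE sP]] := @brauer_char_decomp_in (fun _ _ => True) _ n rG.
by exists s; split=> // psi /sP[m [r [irr _ ->]]]; exists m, r.
Qed.

Lemma repr_expr_order n (rG : mx_representation F G n.+1) x : x \in G -> rG x ^+ #[x] = 1.
Proof. by move=> Gx; rewrite -repr_mxX // expg_order repr_mx1. Qed.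

Lemma eigenvalues_unity n (rG : mx_representation F G n) x a :
  x \in G -> a \in eigenvalues (rG x) -> a ^+ #[x] = 1.
Proof.
move=> Gx; rewrite -root_prod_XsubC -char_poly_eigenvalues -eigenvalue_root_char => /eigenvalueP[u uE nzu].
case: n => [|n] in rG u uE nzu *; first by rewrite thinmx0 eqxx in nzu.
have ukE k : u *m rG x ^+ k = a ^+ k *: u.
  elim: k => [|k IH]; first by rewrite !expr0 scale1r mulmx1.
  by rewrite exprS -[_ * _]/(_ *m _) mulmxA uE -scalemxAl IH scalerA exprS.
have := ukE #[x]; rewrite repr_expr_order // mulmx1 => /eqP; rewrite -subr_eq0 -{1}[u]scale1r -scalerBl.
by rewrite scaler_eq0 (negPf nzu) orbF subr_eq0 => /eqP.
Qed.

Lemma repr_preg_diag n (rG : mx_representation F G n) x : x \in p_regular p G ->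
  exists Q d, Q \in unitmx /\ rG x = invmx Q *m diag_mx d *m Q.
Proof.
rewrite inE => /andP[Gx px]; case: n rG => [|n] rG.
  by exists 1%:M, 0; split; [rewrite unitmx1|rewrite !thinmx0].
have p'x : p^'.-nat #[x] := px.
pose r := sval (closed_field_poly_normal ('X^#[x] - 1 : {poly F})).
have rE : 'X^#[x] - 1 = \prod_(z <- r) ('X - z%:P) :> {poly F}.
  by rewrite /r; case: closed_field_poly_normal => s /= E; rewrite [LHS]E lead_coefXnsubC ?order_gt0 // scale1r.
have ur : uniq r by rewrite -separable_prod_XsubC -rE separable_Xn_sub_1 ?nat_neq0_p'.
have : diagonalizable (rG x).
  apply/diagonalizableP; exists r => //; rewrite -rE mxminpoly_min //.
  by rewrite rmorphB rmorph1 rmorphXn /= horner_mx_X repr_expr_order // subrr.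
case=> P uP /similar_diagPex[d /(similarLR uP) E]; exists P, d; split=> //.
by rewrite E conjumx ?unitmx_inv // invmxK.
Qed.

Lemma brauer_char_trace n (rG : mx_representation F G n) x N (R : comNzRingType)
    (v : {rmorphism R -> algC}) (f : {rmorphism R -> F}) :
  adapted_place N v f -> x \in p_regular p G -> (#[x] %| N)%N ->
  exists2 r, v r = bchar rG x & f r = \tr (rG x).
Proof.
move=> [_ ad] px dvx; have Gx : x \in G by move: px; rewrite inE => /andP[].
have : forall a, a \in eigenvalues (rG x) -> exists2 r, v r = theta a & f r = a.
  move=> a /(eigenvalues_unity Gx) ax; apply: ad.
  by rewrite -(divnK dvx) mulnC exprM ax expr1n.
rewrite brauer_charE px mulr1n mxtrace_eigenvalues.
elim: (eigenvalues (rG x)) => [|a s IH] H.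
  by exists 0; rewrite ?big_nil rmorph0.
have [|r vr fr] := IH; first by move=> b bs; apply: H; rewrite inE bs orbT.
have [r' vr' fr'] := H a (mem_head _ _).
by exists (r' + r); rewrite rmorphD big_cons ?vr ?vr' ?fr ?fr'.
Qed.

End OneGroup.
End BrauerCharTheory.

(** * Reduction of ordinary representations *)

Section Lattice.
Variables (F : closedFieldType) (R : comNzRingType).
Variables (v : {rmorphism R -> algC}) (f : {rmorphism R -> F}).
Hypothesis pl : is_place v f.

Lemma place_total (x y : algC) : (exists r, x = v r * y) \/ (exists r, y = v r * x).
Proof.
case: (eqVneq y 0) => [->|y0]; first by right; exists 0; rewrite rmorph0 mul0r.
case: pl => _ /(_ (x / y)) [[r rE]|[xy0 [r rE _]]].
  by left; exists r; rewrite rE divfK.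
have x0 : x != 0 by apply: contraNneq xy0 => ->; rewrite mul0r.
by right; exists r; rewrite rE invf_div divfK.
Qed.

(** Divisibility is total in a valuation ring, so one member of a finite family divides all the
    others. *)
Lemma place_max (T : finType) (d : T -> algC) t0 : d t0 != 0 ->
  exists2 s, d s != 0 & forall t, exists r, d t = v r * d s.
Proof.
move=> dt0.
suff [s ds sP] : exists2 s, d s != 0 & forall t, t \in enum T -> exists r, d t = v r * d s.
  by exists s => // t; apply: sP; rewrite mem_enum.
elim: (enum T) => [|t l [s ds IH]]; first by exists t0.
case: (place_total (d t) (d s)) => [[r rE]|[r rE]].
  by exists s => // u; rewrite inE => /orP[/eqP->|/IH]; first by exists r.
exists t; first by apply: contraNneq ds => dt; rewrite rE dt mulr0.
move=> u; rewrite inE => /orP[/eqP->|/IH [r' ->]]; first by exists 1; rewrite rmorph1 mul1r.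
by exists (r' * r); rewrite rmorphM rE mulrA.
Qed.

Variables (gT : finGroupType) (G : {group gT}).

(* The rows of all matrices [rG g] span a lattice; a basis of it among these
   rows is found by maximising the determinant for the valuation. *)
Lemma place_lattice n (rG : mx_representation algC G n) :
  exists (B : 'M_n) (M : gT -> 'M[R]_n), B \in unitmx /\
    forall g, g \in G -> map_mx v (M g) = B *m rG g *m invmx B.
Proof.
pose rows (s : {ffun 'I_n -> subg_of G * 'I_n}) : 'M[algC]_n :=
  \matrix_(i, j) rG (sgval (s i).1) (s i).2 j.
have rows1 : rows [ffun i => (subg G 1%g, i)] = 1%:M.
  by apply/matrixP => i j; rewrite mxE ffunE /= subgK ?repr_mx1.
have [|s ds sP] := @place_max _ (fun s => \det (rows s)) [ffun i => (subg G 1%g, i)].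
  by rewrite rows1 det1 oner_eq0.
pose B := rows s; have uB : B \in unitmx by rewrite unitmxE unitfE.
suff H g : exists M : 'M[R]_n, g \in G -> map_mx v M = B *m rG g *m invmx B.
  by have [M MP] := choice H; exists B, M.
case: (boolP (g \in G)) => Gg; last by exists 0.
suff H i j : exists r, v r = (B *m rG g *m invmx B) i j.
  have [M0 MP] := choice (fun ij : 'I_n * 'I_n => H ij.1 ij.2).
  by exists (\matrix_(i, j) M0 (i, j)) => _; apply/matrixP => i j; rewrite [LHS]mxE mxE MP.
(* Cramer's rule: the entry at [(i, j)] is a quotient of determinants, where row [j] of [B] has been
   replaced by row [i] of [B *m rG g]. That row is again a row of a representation matrix, so
   maximality of [s] makes the quotient integral. *)
pose t : {ffun 'I_n -> subg_of G * 'I_n} :=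
  [ffun k => if k == j then (((s i).1 * subg G g)%g, (s i).2) else s k].
have [r rE] := sP t; exists r; apply: (mulIf ds); rewrite -rE.
rewrite (expand_det_row _ j) /invmx uB -scalemxAr mxE mulrAC mulVf // mul1r mxE.
apply: eq_bigr => k _; rewrite [LHS]mulrC [RHS]mulrC [in RHS]mxE; congr (_ * _).
  rewrite /cofactor; congr (_ * \det _); apply/matrixP => a b.
  by rewrite !mxE ffunE eq_sym (negPf (neq_lift _ _)).
rewrite mxE ffunE eqxx /= repr_mxM ?subgP // subgK // !mxE.
by apply: eq_bigr => l _; rewrite mxE.
Qed.

Lemma place_reduction n (rG : mx_representation algC G n) :
  exists (M : gT -> 'M[R]_n) (rF : mx_representation F G n),
    [/\ M 1%g = 1%:M, {in G &, {morph M : x y / (x * y)%g >-> x *m y}},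
        forall g, rF g = map_mx f (M g) &
        exists2 B, B \in unitmx & forall g, g \in G -> map_mx v (M g) = B *m rG g *m invmx B].
Proof.
have [B [M [uB MP]]] := place_lattice rG.
have [vinj _] := pl.
have map_inj m k : injective (map_mx v : 'M_(m, k) -> 'M_(m, k)).
  by move=> X Y /matrixP E; apply/matrixP => i j; apply: vinj; have := E i j; rewrite !mxE.
have M1 : M 1%g = 1%:M.
  by apply: map_inj; rewrite MP // repr_mx1 mulmx1 mulmxV // map_mx1.
have MM : {in G &, {morph M : x y / (x * y)%g >-> x *m y}}.
  move=> x y Gx Gy; apply: map_inj; rewrite map_mxM !MP ?groupM // repr_mxM //.
  by rewrite !mulmxA mulmxKV.
have rP : mx_repr G (fun g => map_mx f (M g)).
  by split=> [|x y Gx Gy]; rewrite ?M1 ?map_mx1 // MM // map_mxM.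
by exists M, (MxRepresentation rP); split=> //; exists B.
Qed.

End Lattice.

Section Reduction.
Variables (p : nat) (F : closedFieldType) (theta : F -> algC).
Hypothesis pcharF : p \in [pchar F].
Hypothesis th : brauer_lift theta.
Variables (R : comNzRingType) (v : {rmorphism R -> algC}) (f : {rmorphism R -> F}).
Variables (gT : finGroupType) (G : {group gT}).
Hypothesis ad : adapted_place theta #|G|`_p^' v f.

Lemma p_regular_order x : x \in p_regular p G -> (#[x] %| #|G|`_p^')%N.
Proof.
rewrite inE => /andP[Gx px]; rewrite -(part_pnat_id (px : p^'.-nat #[x])).
by apply: partn_dvd => //; exact: order_dvdG.
Qed.

Lemma adapted_root x (z : algC) : x \in p_regular p G -> z ^+ #[x] = 1 ->
  exists2 r, v r = z & theta (f r) = z.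
Proof.
move=> px zx; have dvx := p_regular_order px.
have [w prw] := closed_prim_root pcharF (part_pnat p^' #|G|).
have zN : z ^+ #|G|`_p^' = 1.
  by rewrite -(divnK dvx) mulnC exprM zx expr1n.
have [k zE] := prim_rootP (theta_prim th prw) zN.
have wk : (w ^+ k) ^+ #|G|`_p^' = 1 by rewrite exprAC (prim_expr_order prw) expr1n.
have [_ /(_ _ wk) [r vr fr]] := ad.
have E : theta (w ^+ k) = z by rewrite (thetaX th k (prim_order_gt0 prw) (prim_expr_order prw)).
by exists r; rewrite ?fr ?vr.
Qed.

(** The eigenvalues of [rG x] are roots of unity of order prime to [p], so they come from elements
    of [R] whose reductions [theta] sends back to them. These elements split the characteristic
    polynomial over [R], and the splitting reduces. *)
Lemma brauer_char_reduction n (rG : mx_representation algC G n) (rF : mx_representation F G n)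
    (M : gT -> 'M[R]_n) (B : 'M_n) :
  (forall g, rF g = map_mx f (M g)) -> B \in unitmx ->
  (forall g, g \in G -> map_mx v (M g) = B *m rG g *m invmx B) ->
  brauer_char p theta rF = preg_restr p (cfRepr rG).
Proof.
move=> rFE uB ME; apply/cfunP => x; rewrite preg_restrE.
case: (boolP (x \in p_regular p G)) => px; last by rewrite brauer_char_supp.
have Gx : x \in G by move: px; rewrite inE => /andP[].
rewrite mulr1n [RHS]cfunE Gx mulr1n mxtrace_eigenvalues.
have [s sE] : exists s : seq R, map v s = eigenvalues (rG x) /\
    map (theta \o f) s = eigenvalues (rG x).
  have : {in eigenvalues (rG x), forall a, a ^+ #[x] = 1}.
    by move=> a; exact: eigenvalues_unity.
  elim: (eigenvalues _) => [_|a l IH H]; first by exists [::].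
  have [|s [s1 s2]] := IH; first by move=> b bl; apply: H; rewrite inE bl orbT.
  have [r vr tr] := adapted_root px (H a (mem_head _ _)).
  by exists (r :: s); split=> /=; rewrite ?s1 ?s2 ?vr ?tr.
case: sE => vs ts.
have cpM : char_poly (M x) = \prod_(a <- s) ('X - a%:P).
  apply: (map_inj_poly (proj1 (proj1 ad)) (rmorph0 v)).
  rewrite map_char_poly ME // char_poly_conj // char_poly_eigenvalues -vs big_map.
  by rewrite map_prod_XsubC.
rewrite (brauer_char_roots theta (s := map f s) px).
  by rewrite -ts !big_map.
by rewrite rFE -map_char_poly cpM map_prod_XsubC big_map.
Qed.

End Reduction.

(** * Linear independence of irreducible Brauer characters *)

Lemma delta_mx_sandwich (R : comNzRingType) m n k l (X : 'M[R]_(m, n)) (i : 'I_k) a b (j : 'I_l) :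
  delta_mx i a *m X *m delta_mx b j = X a b *: delta_mx i j.
Proof.
rewrite -(mul_delta_mx (0 : 'I_1) i a) -(mul_delta_mx (0 : 'I_1) b j).
rewrite mulmxA -(mulmxA _ (delta_mx 0 a)) -rowE -(mulmxA _ _ (delta_mx b 0)) -colE.
have -> : col b (row a X) = (X a b)%:M :> 'M_1.
  by apply/matrixP => u v; rewrite !ord1 !mxE eqxx mulr1n.
by rewrite scalar_mxC -mulmxA mul_delta_mx mul_scalar_mx.
Qed.

Section Separation.
Variables (F : closedFieldType) (gT : finGroupType) (G : {group gT}).
Notation aG := (regular_repr F G).
Notation R_G := (group_ring F G).

Lemma closed_abs_irr n (rG : mx_representation F G n) :
  mx_irreducible rG -> mx_absolutely_irreducible rG.
Proof.
move=> irr; apply: cent_mx_scalar_abs_irr => //; rewrite leqNgt; apply/negP.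
case/(has_non_scalar_mxP (scalar_mx_cent _ _)) => f.
rewrite memmx_cent_envelop => /centgmxP cf nsf.
have n_gt0 : (0 < n)%N by case/mx_irrP: irr.
have /closed_rootP[a ra] : size (char_poly f) != 1%N by rewrite size_char_poly eqSS -lt0n.
have cfa : centgmx rG (f - a%:M).
  by apply/centgmxP => x Gx; rewrite mulmxBl mulmxBr cf // scalar_mxC.
have nz : f - a%:M != 0.
  by apply: contraNneq nsf => /eqP; rewrite subr_eq0 => /eqP->; rewrite scalar_mx_is_scalar.
have ev : eigenvalue f a by rewrite eigenvalue_root_char.
have := mx_Schur irr cfa nz; rewrite -row_free_unit -kermx_eq0 => k0.
by move: ev; rewrite /eigenvalue /eigenspace k0.
Qed.

Lemma gring_surj n (rG : mx_representation F G n) X : mx_irreducible rG ->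
  exists2 A, (A \in R_G)%MS & gring_op rG A = X.
Proof.
move=> irr; have /mx_abs_irrP[_ [a_ aP]] := closed_abs_irr irr.
exists (\sum_(x in G) a_ x X *: aG x).
  by apply/envelop_mxP; exists (a_^~ X).
by rewrite linear_sum [RHS]aP; apply: eq_bigr => x Gx; rewrite linearZ /= gring_opG.
Qed.

Lemma mx_hom_irr_rsim n1 n2 (r1 : mx_representation F G n1) (r2 : mx_representation F G n2)
    (P : 'M_(n1, n2)) : mx_irreducible r1 -> mx_irreducible r2 -> P != 0 ->
  (forall x, x \in G -> r1 x *m P = P *m r2 x) -> mx_rsim r1 r2.
Proof.
move=> /mx_irrP[_ irr1] /mx_irrP[_ irr2] nzP homP.
have freeP : row_free P.
  rewrite -kermx_eq0; apply: contraT => nzk.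
  have mk : mxmodule r1 (kermx P).
    apply/mxmoduleP => x Gx; apply/sub_kermxP.
    by rewrite -mulmxA homP // mulmxA mulmx_ker mul0mx.
  have := irr1 _ mk nzk; rewrite -sub1mx => /sub_kermxP; rewrite mul1mx => P0.
  by rewrite P0 eqxx in nzP.
have fullP : row_full P.
  have mP : mxmodule r2 <<P>>%MS.
    apply/mxmoduleP => x Gx; rewrite (eqmxMr _ (genmxE P)) genmxE -homP //.
    exact: submxMl.
  have := irr2 _ mP; rewrite -!mxrank_eq0 /row_full !genmxE => ->//.
  by rewrite mxrank_eq0.
exists P => //; rewrite -(eqP freeP); exact/eqP.
Qed.

(** Simplicity of the full matrix ring: [P] is a two-sided ideal of the group ring, so its image in
    an irreducible representation is zero or everything. *)
Lemma mx_ideal_full n (rG : mx_representation F G n) (P : 'M[F]_#|G| -> Prop) :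
  mx_irreducible rG ->
  (forall A B, P A -> P B -> P (A + B)) ->
  (forall A B, (B \in R_G)%MS -> P A -> P (A *m B)) ->
  (forall A B, (A \in R_G)%MS -> P B -> P (A *m B)) ->
  (forall A, P A -> (A \in R_G)%MS) -> P 0 ->
  (exists2 A, P A & gring_op rG A != 0) ->
  exists2 A, P A & gring_op rG A = 1%:M.
Proof.
move=> irr PD PMr PMl PR P0 [A0 PA0 nz].
have [a [b ab]] : exists a b, gring_op rG A0 a b != 0.
  apply: contrapT => no; case/eqP: nz; apply/matrixP => a b; rewrite [RHS]mxE.
  by apply: contrapT => /eqP ne; apply: no; exists a, b.
pose c := (gring_op rG A0 a b)^-1.
have RA0 := PR _ PA0.
have H i : exists2 A, P A & gring_op rG A = delta_mx i i.
  have [A1 RA1 A1E] := gring_surj (c *: delta_mx i a) irr.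
  have [A2 RA2 A2E] := gring_surj (delta_mx b i) irr.
  exists (A1 *m A0 *m A2); first by apply: PMr => //; exact: PMl.
  rewrite !gring_opM // A1E A2E -2!scalemxAl delta_mx_sandwich scalerA mulVf //.
  by rewrite scale1r.
have [A PA AE] : exists2 A, P A & gring_op rG A = \sum_i delta_mx i i.
  elim: (index_enum _) => [|i s [A PA AE]]; first by exists 0; rewrite ?big_nil ?linear0.
  have [A' PA' A'E] := H i.
  by exists (A' + A); [exact: PD|rewrite linearD big_cons /= A'E AE].
exists A => //; rewrite AE; apply/matrixP => k l; rewrite summxE !mxE (bigD1 k) //=.
rewrite mxE eqxx /= big1 ?addr0 1?eq_sym // => i ni.
by rewrite mxE eq_sym (negPf ni).
Qed.

(* If every element killed by the second representation were killed by the
   first one, the first module would be a module for the matrix ring which is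
   the image of the second one, whence an intertwining matrix. *)
Lemma gring_separate n1 n2 (r1 : mx_representation F G n1) (r2 : mx_representation F G n2) :
  mx_irreducible r1 -> mx_irreducible r2 -> ~ mx_rsim r1 r2 ->
  exists2 A, (A \in R_G)%MS & gring_op r1 A = 1%:M /\ gring_op r2 A = 0.
Proof.
move=> irr1 irr2 nsim.
case: (pselect (exists2 A, (A \in R_G)%MS /\ gring_op r2 A = 0 & gring_op r1 A != 0)) => [ex|no].
  have [| | | | |A [RA A2] A1] := mx_ideal_full irr1 _ _ _ _ _ ex.
  - by move=> A B [RA A2] [RB B2]; split; [rewrite linearD addmx_sub|rewrite linearD /= A2 B2 addr0]. 
  - move=> A B RB [RA A2]; split; first exact: envelop_mxM.
    by rewrite gring_opM // A2 mul0mx.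
  - move=> A B RA [RB B2]; split; first exact: envelop_mxM.
    by rewrite gring_opM // B2 mulmx0.
  - by move=> A [].
  - by split; rewrite linear0 ?sub0mx.
  - by exists A; [|split].
exfalso; apply: nsim; apply: mx_rsim_sym.
have n20 : (0 < n2)%N by case/mx_irrP: irr2.
have n10 : (0 < n1)%N by case/mx_irrP: irr1.
have /choice[lft lftP] X : exists A, (A \in R_G)%MS /\ gring_op r2 A = X.
  by have [A RA AE] := gring_surj X irr2; exists A.
pose psi X := gring_op r1 (lft X).
have wd A X : (A \in R_G)%MS -> gring_op r2 A = X -> gring_op r1 A = psi X.
  move=> RA AX; have [RL LX] := lftP X.
  apply: contrapT => /eqP; rewrite -subr_eq0 => ne; apply: no.
  exists (A - lft X); last by rewrite linearB.
  by split; [rewrite linearB addmx_sub ?eqmx_opp | rewrite linearB /= AX LX subrr].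
have psiD X Y : psi (X + Y) = psi X + psi Y.
  have [[RX XE] [RY YE]] := (lftP X, lftP Y).
  apply/esym; rewrite -linearD; apply: wd; last by rewrite linearD /= XE YE.
  by rewrite linearD addmx_sub.
have psiZ c X : psi (c *: X) = c *: psi X.
  have [RX XE] := lftP X.
  apply/esym; rewrite -linearZ; apply: wd; last by rewrite linearZ /= XE.
  by rewrite linearZ scalemx_sub.
have psi00 : psi 0 = 0 by rewrite -(scale0r 0) psiZ scale0r.
have psiM X Y : psi (X *m Y) = psi X *m psi Y.
  have [[RX XE] [RY YE]] := (lftP X, lftP Y).
  apply/esym; rewrite -gring_opM //; apply: wd; first exact: envelop_mxM.
  by rewrite gring_opM // XE YE.
have psiG x : x \in G -> psi (r2 x) = r1 x.
  move=> Gx; apply/esym; rewrite -(gring_opG r1) //; apply: wd; last exact: gring_opG.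
  exact: envelop_mx_id.
have psiS (I : Type) (s : seq I) (E : I -> 'M_n2) : psi (\sum_(i <- s) E i) = \sum_(i <- s) psi (E i).
  by elim: s => [|i s IH]; rewrite ?big_nil // !big_cons psiD IH.
pose o : 'I_n2 := Ordinal n20.
have psio : psi (delta_mx o o) != 0.
  apply/eqP => psi0; have : psi 1%:M = 0.
    rewrite mx1_sum_delta psiS big1 // => i _.
    rewrite -(mul_delta_mx o) -(mul_delta_mx o o) !psiM psi0 mul0mx mulmx0 //.
  rewrite -(repr_mx1 r2) psiG // repr_mx1 => /matrixP/(_ (Ordinal n10) (Ordinal n10))/eqP.
  by rewrite !mxE eqxx oner_eq0.
have [k nzk] : exists k, row k (psi (delta_mx o o)) != 0.
  apply: contrapT => no'; case/eqP: psio; apply/row_matrixP => k; rewrite row0.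
  by apply: contrapT => /eqP ne; apply: no'; exists k.
(* By multiplicativity of [psi], row [k] of the image of [delta_mx o i] transforms under [r1] as the
   basis vector of index [i] does under [r2]. *)
pose P : 'M_(n2, n1) := \matrix_(i < n2) row k (psi (delta_mx o i)).
apply: (@mx_hom_irr_rsim _ _ r2 r1 P) => //.
  by apply: contraNneq nzk => P0; rewrite -(rowK (fun i => row k (psi (delta_mx o i))) o) -/P P0 row0.
move=> x Gx; apply/row_matrixP => i.
rewrite !row_mul rowK -(psiG x Gx) -[RHS]row_mul -psiM mulmx_sum_row.
have -> : delta_mx o i *m r2 x = \sum_j r2 x i j *: delta_mx o j.
  rewrite -(mul_delta_mx (0 : 'I_1) o i) -mulmxA -rowE [in LHS](row_sum_delta (row i (r2 x))).
  by rewrite mulmx_sumr; apply: eq_bigr => j _; rewrite -scalemxAr mul_delta_mx mxE.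
rewrite psiS linear_sum; apply: eq_bigr => j _.
by rewrite rowK psiZ linearZ mxE.
Qed.

Section IrreducibleTraces.
Variables (I : finType) (n : I -> nat) (r : forall i, mx_representation F G (n i)).
Hypothesis irr : forall i, mx_irreducible (r i).
Hypothesis nsim : forall i j, i != j -> ~ mx_rsim (r i) (r j).

Lemma gring_trace_dual i :
  exists2 A, (A \in R_G)%MS & forall j, \tr (gring_op (r j) A) = (j == i)%:R.
Proof.
have n_gt0 : (0 < n i)%N by case/mx_irrP: (irr i).
pose o : 'I_(n i) := Ordinal n_gt0.
have [A0 RA0 A0E] := gring_surj (delta_mx o o) (irr i).
have [B [RB B1 B0]] : exists B, [/\ (B \in R_G)%MS, gring_op (r i) B = 1%:M &
    forall j, j \in enum I -> j != i -> gring_op (r j) B = 0].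
  elim: (enum I) => [|j s [B [RB B1 B0]]].
    by exists 1%:M; split; [exact: envelop_mx1|exact: gring_op1|].
  case: (eqVneq j i) => [ji|nji].
    exists B; split=> // k; rewrite inE => /orP[/eqP->|/B0 //].
    by rewrite ji eqxx.
  have nsij : ~ mx_rsim (r i) (r j) by apply: nsim; rewrite eq_sym.
  have [C RC [C1 C0]] := gring_separate (irr i) (irr j) nsij.
  exists (C *m B); split; first exact: envelop_mxM.
    by rewrite gring_opM // C1 B1 mulmx1.
  move=> k; rewrite inE gring_opM // => /orP[/eqP->|ks] nki; first by rewrite C0 mul0mx.
  by rewrite B0 // mulmx0.
exists (A0 *m B); first exact: envelop_mxM.
move=> j; rewrite gring_opM //; case: (eqVneq j i) => [->|nji].
  by rewrite B1 mulmx1 A0E /mxtrace (bigD1 o) //= big1 ?mxE ?eqxx ?addr0 // => k nk; rewrite mxE (negPf nk).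
by rewrite B0 ?mem_enum // mulmx0 mxtrace0.
Qed.

Lemma irr_trace_free (c : I -> F) :
  (forall x, x \in G -> \sum_i c i * \tr (r i x) = 0) -> forall i, c i = 0.
Proof.
move=> c0 i; have [A /envelop_mxP[a AE] trA] := gring_trace_dual i.
have : \sum_j c j * \tr (gring_op (r j) A) = 0.
  transitivity (\sum_(x in G) a x * (\sum_j c j * \tr (r j x))); last first.
    by rewrite big1 // => x Gx; rewrite c0 // mulr0.
  under [RHS]eq_bigr do rewrite mulr_sumr.
  rewrite exchange_big; apply: eq_bigr => j _ /=.
  rewrite AE linear_sum raddf_sum mulr_sumr; apply: eq_bigr => x Gx.
  by rewrite linearZ /= gring_opG // mxtraceZ mulrCA.
rewrite (bigD1 i) //= trA eqxx mulr1 big1 ?addr0 // => j nj.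
by rewrite trA (negPf nj) mulr0.
Qed.
End IrreducibleTraces.
End Separation.

Lemma exprB1_ppow (R : comNzRingType) p (x : R) k :
  p \in [pchar R] -> (x - 1) ^+ (p ^ k) = x ^+ (p ^ k) - 1.
Proof.
move=> pR; elim: k => [|k IH]; first by rewrite expn0 !expr1.
rewrite expnSr !exprM IH -!(pFrobenius_autE pR).
by rewrite rmorphB rmorph1.
Qed.

Lemma horner_mx_nilpotent (F : fieldType) n (U : 'M[F]_n.+1) p k :
  p \in [pchar F] -> U ^+ (p ^ k) = 1 -> (U - 1) ^+ (p ^ k) = 0.
Proof.
move=> pF Uk; have pFX : p \in [pchar {poly F}] by rewrite pchar_poly.
have : horner_mx U (('X - 1) ^+ (p ^ k)) = horner_mx U ('X^(p ^ k) - 1).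
  by rewrite exprB1_ppow.
by rewrite rmorphXn !rmorphB rmorph1 rmorphXn /= horner_mx_X Uk subrr.
Qed.

Lemma mxtrace_nilpotent (F : closedFieldType) n (A : 'M[F]_n.+1) k : A ^+ k = 0 -> \tr A = 0.
Proof.
move=> Ak; rewrite mxtrace_eigenvalues big_seq big1 // => a.
rewrite -root_prod_XsubC -char_poly_eigenvalues -eigenvalue_root_char => /eigenvalueP[u uE nzu].
have ukE : u *m A ^+ k = a ^+ k *: u.
  elim: (k) => [|j IH]; first by rewrite !expr0 scale1r mulmx1.
  by rewrite exprS -[_ * _]/(_ *m _) mulmxA uE -scalemxAl IH scalerA exprS.
move: ukE; rewrite Ak mulmx0 => /esym/eqP; rewrite scaler_eq0 (negPf nzu) orbF.
by rewrite expf_eq0 => /andP[_ /eqP].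
Qed.

(** * Irreducible Brauer characters as a basis *)

Section IBrBasis.
Variables (p : nat) (F : closedFieldType) (theta : F -> algC).
Hypothesis pcharF : p \in [pchar F].
Hypothesis th : brauer_lift theta.
Variables (gT : finGroupType) (G : {group gT}).
Notation pr := (@preg_restr p gT G).

(** The p-part acts as [U] with [U - 1] nilpotent, and [U] commutes with the action [D] of the
    p'-part; so [U * D] and [D] differ by a nilpotent matrix. *)
Lemma mxtrace_p_regular_part n (rG : mx_representation F G n) x : x \in G ->
  \tr (rG x) = \tr (rG x.`_p^').
Proof.
move=> Gx; case: n rG => [|n] rG; first by rewrite /mxtrace !big_ord0.
have Gp pi : x.`_pi \in G by rewrite groupX.
set U := rG x.`_p; set D := rG x.`_p^'.
have xE : rG x = U * D by rewrite -[in LHS](consttC p x) repr_mxM.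
have cUD : GRing.comm (U - 1) D.
  rewrite /GRing.comm mulrBl mulrBr mul1r mulr1 /D /U -!repr_mxMr //.
  by rewrite (commuteX2 _ _ (commute_refl x)).
have [k kE] : exists k, #[x.`_p] = (p ^ k)%N.
  by have /p_natP[k kE] := p_elt_constt p x; exists k.
have Uk : U ^+ (p ^ k) = 1 by rewrite -kE repr_expr_order.
have nil : ((U - 1) * D) ^+ (p ^ k) = 0.
  by rewrite exprMn_comm // (horner_mx_nilpotent pcharF Uk) mul0r.
apply/eqP; rewrite -subr_eq0 xE -raddfB /= -[X in _ - X]mul1r -mulrBl.
by rewrite (mxtrace_nilpotent nil).
Qed.

(** A relation is divided by a coefficient that divides all the others. Its reduction is then a
    nontrivial relation between traces of pairwise non-similar irreducible representations over [F],
    which is impossible. *)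
Lemma IBr_free (s : seq 'CF(G)) : uniq s -> (forall phi, phi \in s -> IBr p theta phi) -> free s.
Proof.
move=> us sI; rewrite -[s]in_tupleE; apply/freeP => c c0.
suff H : forall i, c i = 0 by [].
apply: contrapT => nall; have [i0 ci0] : exists i0, c i0 != 0.
  by apply: contrapT => no; apply: nall => i; apply: contrapT => /eqP ci; apply: no; exists i.
have [R [v [f ad]]] := adapted_place_exists pcharF th (part_pnat p^' #|G|).
have [pl _] := ad; have [vinj _] := pl.
have [j cj cP] := place_max pl ci0.
have [d dE] := choice cP.
have sI' (i : 'I_(size s)) : exists w : {n : nat & mx_representation F G n},
    mx_irreducible (tagged w) /\ s`_i = brauer_char p theta (tagged w).
  by have [n [rG [irr E]]] := sI _ (mem_nth 0 (ltn_ord i)); exists (Tagged _ rG).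
have [w wP] := choice sI'.
have nsim (i k : 'I_(size s)) : i != k -> ~ mx_rsim (tagged (w i)) (tagged (w k)).
  move=> nik /(mx_rsim_brauer_char p theta); rewrite -!(proj2 (wP _)) => /eqP.
  by rewrite nth_uniq // => /eqP/val_inj E; rewrite E eqxx in nik.
have irr i : mx_irreducible (tagged (w i)) by case: (wP i).
suff : forall i, f (d i) = 0.
  move/(_ j); have -> : d j = 1.
    by apply: vinj; apply: (mulIf cj); rewrite -dE rmorph1 mul1r.
  by move/eqP; rewrite rmorph1 oner_eq0.
apply: (irr_trace_free irr nsim) => x Gx.
pose y := x.`_p^'; have py : y \in p_regular p G by rewrite inE groupX ?p_elt_constt.
have dvy := p_regular_order py.
have tE i : exists t, v t = brauer_char p theta (tagged (w i)) y /\ f t = \tr (tagged (w i) x).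
  have [t vt ft] := brauer_char_trace (tagged (w i)) ad py dvy.
  by exists t; rewrite (mxtrace_p_regular_part _ Gx).
have [t tP] := choice tE.
have : \sum_i d i * t i = 0.
  apply: vinj; apply: (mulIf cj); rewrite rmorph0 mul0r rmorph_sum mulr_suml.
  have : (\sum_i c i *: (in_tuple s)`_i) y = 0 by rewrite c0 cfunE.
  rewrite sum_cfunE => Ey; rewrite -[RHS]Ey.
  apply: eq_bigr => i _; rewrite rmorphM /= mulrAC -dE (proj1 (tP i)) -(proj2 (wP i)) [RHS]cfunE; congr (_ * _).
move/(congr1 f); rewrite rmorph_sum rmorph0 => E; rewrite -[RHS]E.
by apply: eq_bigr => i _; rewrite rmorphM /= (proj2 (tP i)).
Qed.

Lemma ibr_exists : exists s : seq 'CF(G), free s /\ forall phi, IBr p theta phi <-> phi \in s.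
Proof.
pose P k := `[< exists s : seq 'CF(G), [/\ uniq s, forall phi, phi \in s -> IBr p theta phi & size s = k] >].
have exP : exists k, P k by exists 0%N; apply/asboolP; exists [::].
have ubP k : P k -> (k <= \dim {: 'CF(G)})%N.
  move=> /asboolP[s [us sI <-]]; have := IBr_free us sI; rewrite /free => /eqP <-.
  by apply/dimvS/subvf.
case: (ex_maxnP exP ubP) => k /asboolP[s [us sI sk]] maxk.
exists s; split; first exact: IBr_free.
move=> phi; split=> [Iphi|/sI //]; apply: contrapT => /negP ns.
suff : P k.+1 by move/maxk; rewrite ltnn.
apply/asboolP; exists (phi :: s); split; rewrite /= ?ns ?sk //.
by move=> psi; rewrite inE => /orP[/eqP->|/sI].
Qed.

Definition ibr : seq 'CF(G) :=
  if pselect (exists s : seq 'CF(G), free s /\ forall phi, IBr p theta phi <-> phi \in s)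
  is left ex then sval (cid ex) else [::].

Lemma ibr_free : free ibr.
Proof. by rewrite /ibr; case: pselect => [ex|[]]; [case: cid => s []|exact: ibr_exists]. Qed.

Lemma mem_ibr phi : IBr p theta phi <-> phi \in ibr.
Proof. by rewrite /ibr; case: pselect => [ex|[]]; [case: cid => s []|exact: ibr_exists]. Qed.

Definition ibr_tuple := in_tuple ibr.
Definition ib (k : 'I_(size ibr)) : 'CF(G) := ibr`_k.
Definition bcoef (k : 'I_(size ibr)) (phi : 'CF(G)) : algC := coord ibr_tuple k phi.

Fact bcoef_linear k : scalar (bcoef k).
Proof. by move=> a u w; rewrite /bcoef linearP. Qed.

HB.instance Definition _ k := GRing.isLinear.Build algC 'CF(G) algC _ (bcoef k) (bcoef_linear k).

Lemma ib_IBr k : IBr p theta (ib k).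
Proof. by apply/mem_ibr/mem_nth. Qed.

Lemma IBr_ib phi : IBr p theta phi -> exists k, phi = ib k.
Proof.
move/mem_ibr => pI; have lt : (index phi ibr < size ibr)%N by rewrite index_mem.
by exists (Ordinal lt); rewrite /ib nth_index.
Qed.

Lemma bcoef_ib k l : bcoef k (ib l) = (l == k)%:R.
Proof. by rewrite /bcoef /ib coord_free //; exact: ibr_free. Qed.

Lemma ib_inj : injective ib.
Proof.
move=> k l E; apply/eqP; have := bcoef_ib l k; rewrite E bcoef_ib eqxx.
by case: eqP => // _ /eqP; rewrite oner_eq0.
Qed.

Lemma bcoef_sum k (s : seq 'CF(G)) : (forall phi, phi \in s -> IBr p theta phi) ->
  bcoef k (\sum_(phi <- s) phi) = (count_mem (ib k) s)%:R.
Proof.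
elim: s => [|phi s IH] sI; first by rewrite big_nil linear0.
rewrite big_cons linearD /= IH => [|psi ps]; last by apply: sI; rewrite inE ps orbT.
have [l ->] := IBr_ib (sI _ (mem_head _ _)).
by rewrite bcoef_ib /= natrD (inj_eq ib_inj).
Qed.

Definition bspan := <<ibr>>%VS.

Lemma bspanE phi : phi \in bspan -> phi = \sum_k bcoef k phi *: ib k.
Proof. exact: (@coord_span _ _ _ ibr_tuple). Qed.

Lemma sum_IBr_bspan (s : seq 'CF(G)) : (forall phi, phi \in s -> IBr p theta phi) ->
  \sum_(phi <- s) phi \in bspan.
Proof.
by move=> sI; rewrite big_seq rpred_sum // => phi /sI/mem_ibr; exact: memv_span.
Qed.

Lemma brauer_char_bcoef n (rG : mx_representation F G n) k :
  bcoef k (brauer_char p theta rG) \in Num.nat.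
Proof. by have [s [sI ->]] := brauer_char_decomp p theta rG; rewrite bcoef_sum // natr_nat. Qed.

Lemma preg_restr_reduction n (rG : mx_representation algC G n) :
  exists rF : mx_representation F G n, brauer_char p theta rF = pr (cfRepr rG).
Proof.
have [R [v [f ad]]] := adapted_place_exists pcharF th (part_pnat p^' #|G|).
have [M [rF [_ _ rFE [B uB ME]]]] := place_reduction (proj1 ad) rG.
by exists rF; exact: (brauer_char_reduction pcharF th ad rFE uB ME).
Qed.

Lemma preg_restr_char_decomp chi : chi \is a character ->
  exists s : seq 'CF(G), (forall psi, psi \in s -> IBr p theta psi) /\ pr chi = \sum_(psi <- s) psi.
Proof.
case/char_reprP => rG ->; have [rF <-] := preg_restr_reduction rG.
exact: brauer_char_decomp.
Qed.

Lemma preg_restr_char_bcoef chi k : chi \is a character -> bcoef k (pr chi) \in Num.nat.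
Proof. by move=> /preg_restr_char_decomp[s [sI ->]]; rewrite bcoef_sum // natr_nat. Qed.

Lemma preg_restr_char_bspan chi : chi \is a character -> pr chi \in bspan.
Proof. by move=> /preg_restr_char_decomp[s [sI ->]]; exact: sum_IBr_bspan. Qed.

Fact preg_restr_linear : linear pr.
Proof. by move=> a u w; rewrite /preg_restr mulrDl scalerAl. Qed.

HB.instance Definition _ := GRing.isLinear.Build algC 'CF(G) 'CF(G) _ pr preg_restr_linear.

Lemma preg_restr_bspan phi : pr phi \in bspan.
Proof.
have [a ->] := cfun_irr_sum phi; rewrite linear_sum rpred_sum // => i _.
by rewrite linearZ rpredZ // preg_restr_char_bspan ?irr_char.
Qed.

(** Decomposition numbers are kept in [algC] as coordinates, so that linear algebra applies
    directly; [dec_nat] recovers that they are natural. *)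
Definition dec (i : Iirr G) k : algC := bcoef k (pr 'chi_i).

Lemma decE i k : dec i k = bcoef k (pr 'chi_i). Proof. by []. Qed.

Lemma dec_nat i k : dec i k \in Num.nat.
Proof. by rewrite preg_restr_char_bcoef ?irr_char. Qed.

Lemma preg_restr_dec i : pr 'chi_i = \sum_k dec i k *: ib k.
Proof. exact/bspanE/preg_restr_bspan. Qed.

End IBrBasis.

(** * Decomposition numbers and blocks *)

Section Blocks.
Variables (p : nat) (F : closedFieldType) (theta : F -> algC).
Hypothesis pcharF : p \in [pchar F].
Hypothesis th : brauer_lift theta.
Variables (gT : finGroupType) (G : {group gT}).
Notation pr := (@preg_restr p gT G).
Notation dec := (@dec p F theta gT G).
Notation bcoef := (@bcoef p F theta gT G).
Notation ib := (@ib p F theta gT G).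

Lemma IBr_trace_eq n1 n2 (r1 : mx_representation F G n1) (r2 : mx_representation F G n2) x :
  brauer_char p theta r1 = brauer_char p theta r2 -> x \in G -> \tr (r1 x) = \tr (r2 x).
Proof.
move=> E Gx; have [R [v [f ad]]] := adapted_place_exists pcharF th (part_pnat p^' #|G|).
rewrite !(mxtrace_p_regular_part pcharF _ Gx).
have py : x.`_p^' \in p_regular p G by rewrite inE groupX ?p_elt_constt.
have [t1 v1 <-] := brauer_char_trace r1 ad py (p_regular_order py).
have [t2 v2 <-] := brauer_char_trace r2 ad py (p_regular_order py).
by congr (f _); apply: (proj1 (proj1 ad)); rewrite v1 v2 E.
Qed.

Lemma IBr_rsim n1 n2 (r1 : mx_representation F G n1) (r2 : mx_representation F G n2) :
  mx_irreducible r1 -> mx_irreducible r2 ->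
  brauer_char p theta r1 = brauer_char p theta r2 -> mx_rsim r1 r2.
Proof.
move=> irr1 irr2 E; apply: contrapT => nsim.
pose n (b : bool) := if b then n1 else n2.
pose r (b : bool) : mx_representation F G (n b) := if b as b0 return mx_representation F G (n b0) then r1 else r2.
have irr b : mx_irreducible (r b) by case: b.
have nsr i j : i != j -> ~ mx_rsim (r i) (r j).
  by case: i; case: j => //= _ // /mx_rsim_sym.
pose c (b : bool) : F := if b then 1 else -1.
have c0 x : x \in G -> \sum_b c b * \tr (r b x) = 0.
  by move=> Gx; rewrite big_bool /= mul1r mulN1r (IBr_trace_eq E Gx) subrr.
by have /eqP := irr_trace_free irr nsr c0 true; rewrite oner_eq0.
Qed.

(** For a normal subset [A] this is the central character at the sum over [A]: the scalar by which
    that sum acts. *)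
Definition class_ratio (i : Iirr G) (A : {set gT}) : algC := (\sum_(g in A) 'chi_i g) / 'chi_i 1%g.

(* A sum over a normal subset acts on an irreducible representation by a scalar,
   and so does its reduction on all composition factors. *)
Lemma class_ratio_reduction (R : comNzRingType) (v : {rmorphism R -> algC}) (f : {rmorphism R -> F})
    (i : Iirr G) (A : {set gT}) n (rG : mx_representation algC G n) (M : gT -> 'M[R]_n) B :
  mx_irreducible rG -> cfRepr rG = 'chi_i ->
  is_place v f -> A \subset G -> G \subset 'N(A) -> B \in unitmx ->
  (forall g, g \in G -> map_mx v (M g) = B *m rG g *m invmx B) ->
  exists2 r, v r = class_ratio i A & \sum_(g in A) M g = r%:M.
Proof.
move=> irr rGE [vinj _] sAG nAG uB ME.
pose Z := \sum_(g in A) rG g.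
have cZ : centgmx rG Z.
  apply/centgmxP => x Gx; rewrite /Z mulmx_suml mulmx_sumr.
  have nAx : A :^ x^-1%g = A by apply: (normsP nAG); rewrite groupV.
  rewrite (reindex_inj (conjg_inj x^-1%g)) /=.
  apply: eq_big => [g|g Ag]; first by rewrite -[in LHS]nAx memJ_conjg.
  have Gg : g \in G by apply: (subsetP sAG); rewrite -nAx memJ_conjg in Ag.
  by rewrite -!repr_mxM ?groupJ ?groupV // conjgE invgK mulgA mulgKV.
have /is_scalar_mxP[a aE] : is_scalar_mx Z := mx_abs_irr_cent_scalar (closed_abs_irr irr) cZ.
have aw : a = class_ratio i A.
  have n0 : 'chi_i 1%g != 0 by exact: irr1_neq0.
  apply: (mulIf n0); rewrite /class_ratio divfK //.
  have := congr1 mxtrace aE; rewrite mxtrace_scalar /Z raddf_sum /=.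
  have c1 : 'chi_i 1%g = n%:R by rewrite -rGE cfRepr1.
  rewrite c1 mulr_natr => <-; apply: eq_bigr => g Ag.
  by rewrite -rGE cfunE (subsetP sAG) // mulr1n.
have vZ : map_mx v (\sum_(g in A) M g) = a%:M.
  rewrite raddf_sum (eq_bigr (fun g => B *m rG g *m invmx B)) => [|g Ag]; last first.
    by rewrite -ME // (subsetP sAG).
  by rewrite -mulmx_suml -mulmx_sumr -/Z aE scalar_mxC -mulmxA mulmxV // mulmx1.
have n_gt0 : (0 < n)%N by case/mx_irrP: irr.
pose o : 'I_n := Ordinal n_gt0.
exists ((\sum_(g in A) M g) o o).
  by move/matrixP/(_ o o): vZ; rewrite !mxE eqxx mulr1n aw.
apply/matrixP => k l; apply: vinj; rewrite [in RHS]mxE rmorphMn /=.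
by move/matrixP: (vZ) => /[dup] /(_ o o) + /(_ k l); rewrite !mxE eqxx mulr1n => -> ->.
Qed.

Lemma class_ratio_constituent (R : comNzRingType) (v : {rmorphism R -> algC}) (f : {rmorphism R -> F})
    (i : Iirr G) k (A : {set gT}) :
  adapted_place theta #|G|`_p^' v f -> A \subset G -> G \subset 'N(A) -> dec i k != 0 ->
  exists2 r, v r = class_ratio i A &
    exists m (rU : mx_representation F G m),
      [/\ mx_irreducible rU, brauer_char p theta rU = ib k & \sum_(g in A) rU g = (f r)%:M].
Proof.
move=> ad sAG nAG dik.
have [M [rF [_ _ rFE [B uB ME]]]] := place_reduction (proj1 ad) 'Chi_i.
have [r vr rE] := class_ratio_reduction (socle_irr _) (irrRepr i) (proj1 ad) sAG nAG uB ME.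
exists r => //.
have bF : brauer_char p theta rF = pr 'chi_i.
  by rewrite (brauer_char_reduction pcharF th ad rFE uB ME) irrRepr.
pose Q n (rG : mx_representation F G n) := \sum_(g in A) rG g = (f r)%:M.
have [||s [sE sP]] := @brauer_char_decomp_in p F theta gT G Q _ _ rF.
- move=> n rG U modU QrG; split.
    rewrite /Q; apply: (@val_submod_inj _ _ U); rewrite val_submodE mulmx_suml.
    transitivity (\sum_(g in A) val_submod (1%:M : 'M_(\rank U)) *m rG g).
      apply: eq_bigr => g Ag; rewrite -val_submodE -[submod_repr modU g]mul1mx.
      by rewrite val_submodJ // (subsetP sAG).
    by rewrite -mulmx_sumr QrG [RHS]val_submodE scalar_mxC.
  transitivity (\sum_(g in A) in_factmod U (val_factmod (1%:M : 'M_(\rank (cokermx U))) *m rG g)).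
    apply: eq_bigr => g Ag; rewrite in_factmodJ ?(subsetP sAG) //.
    by rewrite val_factmodK mul1mx.
  rewrite -linear_sum -mulmx_sumr QrG mul_mx_scalar linearZ /= val_factmodK.
  by rewrite scalemx1.
- rewrite /Q (eq_bigr (fun g => map_mx f (M g))) => [|g _]; last exact: rFE.
  by rewrite -map_scalar_mx -rE map_mx_sum.
have sI phi : phi \in s -> IBr p theta phi by move/sP=> [m [rU [irr _ ->]]]; exists m, rU.
have : ib k \in s.
  apply: contraNT dik => /count_memPn ns.
  by rewrite decE -bF sE bcoef_sum // ns.
by move/sP=> [m [rU [irr QU ->]]]; exists m, rU.
Qed.

Definition linked (i j : Iirr G) : bool := [exists k, (dec i k != 0) && (dec j k != 0)].

Lemma linkedP i j : reflect (exists2 k, dec i k != 0 & dec j k != 0) (linked i j).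
Proof.
by apply: (iffP existsP) => [[k /andP[]]|[k di dj]]; exists k => //; rewrite di.
Qed.

Lemma linked_sym i j : linked i j = linked j i.
Proof. by apply: eq_existsb => k; rewrite andbC. Qed.

(** On a shared composition factor the sum over [A] acts by the reduction of either scalar. *)
Lemma linked_class_ratio (R : comNzRingType) (v : {rmorphism R -> algC}) (f : {rmorphism R -> F}) i j (A : {set gT}) :
  adapted_place theta #|G|`_p^' v f -> A \subset G -> G \subset 'N(A) -> linked i j ->
  exists r s, [/\ v r = class_ratio i A, v s = class_ratio j A & f r = f s].
Proof.
move=> ad sAG nAG /linkedP[k dik djk].
have [r vr [m1 [r1 [irr1 b1 E1]]]] := class_ratio_constituent ad sAG nAG dik.
have [s vs [m2 [r2 [irr2 b2 E2]]]] := class_ratio_constituent ad sAG nAG djk.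
exists r, s; split=> //.
have [|B mE fB hB] := IBr_rsim irr1 irr2 (_ : brauer_char p theta r1 = _); first by rewrite b1 b2.
have : (f r)%:M *m B = B *m (f s)%:M.
  rewrite -E1 -E2 mulmx_suml mulmx_sumr; apply: eq_bigr => g Ag.
  by rewrite hB // (subsetP sAG).
rewrite mul_scalar_mx mul_mx_scalar => /eqP; rewrite -subr_eq0 -scalerBl scaler_eq0 subr_eq0.
case/orP=> [/eqP //|/eqP B0].
have : (0 < m1)%N by case/mx_irrP: irr1.
by move: fB; rewrite B0 /row_free mxrank0 => /eqP <-.
Qed.

Definition in_block (i : Iirr G) : bool := connect linked 0 i.

Lemma in_block0 : in_block 0. Proof. exact: connect0. Qed.

Lemma in_block_linked i j : in_block i -> linked i j -> in_block j.
Proof. by move=> bi lij; apply: connect_trans bi (connect1 lij). Qed.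

Lemma class_ratio0 (A : {set gT}) : A \subset G -> class_ratio 0 A = #|A|%:R.
Proof.
move=> sAG; rewrite /class_ratio irr0 cfun11 divr1 (eq_bigr (fun=> 1)) ?sumr_const // => g Ag.
by rewrite cfun1E (subsetP sAG).
Qed.

Lemma in_block_class_ratio (R : comNzRingType) (v : {rmorphism R -> algC}) (f : {rmorphism R -> F}) i (A : {set gT}) :
  adapted_place theta #|G|`_p^' v f -> A \subset G -> G \subset 'N(A) -> in_block i ->
  exists2 r, v r = class_ratio i A & f r = #|A|%:R.
Proof.
move=> ad sAG nAG /connectP[s ps ->]; have vinj := proj1 (proj1 ad).
have: exists2 r, v r = class_ratio 0 A & f r = #|A|%:R.
  by exists #|A|%:R; rewrite rmorph_nat // class_ratio0.
elim: s 0%R ps => //= j s IH i0 /andP[l0j pj] [r vr fr]; apply: IH pj _.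
have [r' [t [vr' vt ft]]] := linked_class_ratio ad sAG nAG l0j.
exists t => //; rewrite -ft -fr; congr (f _); apply: vinj; by rewrite vr vr'.
Qed.

(** This is the vanishing of projective indecomposable characters. No p-regular element is conjugate
    to [t], so column orthogonality kills the combination of the restricted characters with the
    conjugates of the ['chi_i t] as coefficients; the coordinate at [k] of this relation is the
    conjugate of the claim. *)
Lemma dec_p_singular k t : t \in G -> ~~ p^'.-elt t -> \sum_i dec i k * 'chi_i t = 0.
Proof.
move=> Gt st.
have E : \sum_i ('chi_i t)^* *: pr 'chi_i = 0.
  apply/cfunP => y; rewrite [RHS]cfunE sum_cfunE.
  under eq_bigr do rewrite cfunE preg_restrE.
  case: (boolP (y \in _)) => [|_]; last by rewrite big1 // => i _; rewrite mulr0.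
  rewrite inE => /andP[Gy py].
  have := second_orthogonality_relation y Gt.
  have -> : y \in t ^: G = false.
    by apply: contraNF st => /imsetP[u Gu yE]; move: py; rewrite yE p_eltJ.
  rewrite mulr0n => E; rewrite -[RHS]E; apply: eq_bigr => i _.
  by rewrite mulr1n mulrC.
have : bcoef k (\sum_i ('chi_i t)^* *: pr 'chi_i) = 0 by rewrite E linear0.
rewrite linear_sum => {}E; apply: (can_inj conjCK); rewrite rmorph0 rmorph_sum -[RHS]E.
apply: eq_bigr => i _; rewrite linearZ /= rmorphM /= mulrC; congr (_ * _).
by apply: conj_natr; exact: dec_nat.
Qed.

End Blocks.

(** * Traces on modules with projective reduction *)

Section SpectralProjections.
Variables (R : comNzRingType) (m : nat) (r c : R).
Hypothesis m_gt0 : (0 < m)%N.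
Hypothesis rm : r ^+ m = 1.
Hypothesis cm : c *+ m = 1.
Hypothesis sumr : forall k, (0 < k < m)%N -> \sum_(j < m) r ^+ (j * k) = 0.
Variables (n : nat) (A : 'M[R]_n.+1).
Hypothesis Am : A ^+ m = 1.

(** With [c] inverse to [m], the projection onto the eigenspace of [A] for [r ^- j], available
    already over [R]. *)
Definition sproj j : 'M[R]_n.+1 := c *: \sum_(k < m) r ^+ (j * k) *: A ^+ k.

Lemma sproj_eigen j : r ^+ j *: (A * sproj j) = sproj j.
Proof.
rewrite /sproj -scalerAr scalerA mulrC -scalerA; congr (c *: _).
case: m m_gt0 rm Am => // m' _ rm' Am'.
rewrite mulr_sumr scaler_sumr big_ord_recr /= [RHS]big_ord_recl addrC; congr (_ + _).
  rewrite -scalerAr scalerA -exprD -exprS Am' muln0 !expr0.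
  by rewrite -mulnS mulnC exprM rm' expr1n.
apply: eq_bigr => k _; rewrite -scalerAr scalerA -exprD -exprS /=.
by rewrite -mulnS.
Qed.

Lemma sproj_eigenX j k : r ^+ (j * k) *: (A ^+ k * sproj j) = sproj j.
Proof.
elim: k => [|k IH]; first by rewrite muln0 !expr0 scale1r mul1r.
by rewrite mulnS addnC exprD exprSr -scalerA -mulrA (scalerAr (r ^+ j)) sproj_eigen IH.
Qed.

Lemma sproj_idem j : sproj j * sproj j = sproj j.
Proof.
rewrite {1}/sproj -scalerAl mulr_suml (eq_bigr (fun=> sproj j)) => [|k _].
  by rewrite sumr_const card_ord -scaler_nat scalerA mulr_natr cm scale1r.
by rewrite -scalerAl sproj_eigenX.
Qed.

Lemma sproj_sum : \sum_(j < m) sproj j = 1.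
Proof.
rewrite -scaler_sumr exchange_big /=.
rewrite (bigD1 (Ordinal m_gt0)) //= [X in _ + X]big1 => [|k nk]; last first.
  transitivity ((\sum_(j < m) r ^+ (j * k)) *: A ^+ k); first by rewrite scaler_suml.
  rewrite sumr ?scale0r // ltn_ord andbT lt0n.
  by apply: contraNneq nk => k0; apply/eqP/val_inj.
rewrite (eq_bigr (fun=> 1)) => [|j _]; last by rewrite muln0 !expr0 scale1r.
by rewrite sumr_const card_ord addr0 -scaler_nat scalerA mulr_natr cm scale1r.
Qed.

Lemma sproj_comm j (B : 'M_n.+1) : GRing.comm A B -> GRing.comm (sproj j) B.
Proof.
move=> cAB; rewrite /GRing.comm /sproj -scalerAl -scalerAr mulr_suml mulr_sumr; congr (c *: _).
apply: eq_bigr => k _; rewrite -scalerAl -scalerAr; congr (_ *: _).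
by apply/commr_sym/commrX/commr_sym.
Qed.
End SpectralProjections.

Lemma mxtrace_idem (K : fieldType) n (E : 'M[K]_n) : E *m E = E -> \tr E = (\rank E)%:R.
Proof.
move=> EE.
have cr : row_base E *m col_base E = 1%:M.
  apply: (row_full_inj (col_base_full E)); apply: (row_free_inj (row_base_free E)).
  by rewrite mulmx1 mulmxA -mulmxA mulmx_base.
by rewrite -{1}(mulmx_base E) mxtrace_mulC cr mxtrace1.
Qed.

Lemma mxrank_idemC (K : fieldType) n (E : 'M[K]_n) : E *m E = E -> (\rank E + \rank (1%:M - E)%R = n)%N.
Proof.
move=> EE; apply/eqP; rewrite eqn_leq; apply/andP; split.
  by apply: mulmx0_rank_max; rewrite mulmxBr mulmx1 EE subrr.
have E1 : 1%:M = E + (1%:M - E) by rewrite addrC subrK.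
by rewrite -[X in (X <= _)%N](mxrank1 K) {1}E1 mxrank_add.
Qed.

(** A minor that is nonzero after reduction was nonzero before it. *)
Lemma mxrank_specialize (R : comNzRingType) (K F : fieldType) (v : {rmorphism R -> K})
    (f : {rmorphism R -> F}) m n (B : 'M[R]_(m, n)) : injective v ->
  (\rank (map_mx f B) <= \rank (map_mx v B))%N.
Proof.
move=> vinj; set A := map_mx f B; set r := \rank A.
pose f1 := maxrankfun A; pose B1 := rowsub f1 B.
have A1 : row_free (rowsub f1 A) by exact: maxrowsub_free.
have A1' : row_full (rowsub f1 A)^T by rewrite /row_full mxrank_tr; exact: A1.
pose f2 := fullrankfun A1'.
pose C := rowsub f2 B1^T.
have uC : map_mx f C \in unitmx.
  have -> : map_mx f C = rowsub f2 (rowsub f1 A)^T.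
    by apply/matrixP => i j; rewrite !mxE.
  by rewrite -row_full_unit; exact: fullrowsub_full.
have nzC : \det C != 0.
  move: uC; rewrite unitmxE unitfE det_map_mx; apply: contraNneq => ->.
  by rewrite rmorph0.
have uvC : map_mx v C \in unitmx.
  rewrite unitmxE unitfE det_map_mx; apply: contraNneq nzC => H.
  by apply/eqP/vinj; rewrite H rmorph0.
rewrite -/r -[X in (X <= _)%N](mxrank_unit uvC).
have -> : map_mx v C = rowsub f2 (rowsub f1 (map_mx v B))^T.
  by apply/matrixP => i j; rewrite !mxE.
apply: leq_trans (mxrankS (rowsub_sub _ _)) _; rewrite mxrank_tr.
exact: mxrankS (rowsub_sub _ _).
Qed.

(* On the image of [E], the fixed space of the nilpotent [N] lies in the image
   of [N ^+ (q - 1)]: all Jordan blocks have size at least [q]. *)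
Lemma mxrank_jordan (F : fieldType) n (E N : 'M[F]_n.+1) q :
  E * E = E -> GRing.comm E N ->
  (forall u : 'rV_n.+1, u *m E = u -> u *m N = 0 -> exists2 w, w *m E = w & u = w *m N ^+ q.-1) ->
  (q * \rank (E :&: kermx N)%MS <= \rank E)%N.
Proof.
move=> EE cEN H; set k := \rank _.
case: q H => // q /= H; rewrite mulSn.
have subE (u : 'rV_n.+1) : (u <= E)%MS -> u *m E = u.
  by case/submxP => D ->; rewrite -mulmxA -[E *m E]/(E * E) EE.
have stab j : ((E * N ^+ j)%R <= E)%MS by rewrite (commrX j cEN) submxMl.
have kerE j : (j <= q)%N -> \rank ((E * N ^+ j)%R :&: kermx N)%MS = k.
  move=> leq; apply: eqmx_rank; apply/andP; split.
    by rewrite capmxS ?submx_refl.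
  rewrite sub_capmx capmxSr andbT; apply/row_subP => i.
  set u := row i _.
  have uE : (u <= E)%MS by rewrite (submx_trans (row_sub _ _)) ?capmxSl.
  have uN : u *m N = 0 by apply/sub_kermxP; rewrite (submx_trans (row_sub _ _)) ?capmxSr.
  have [w wE ->] := H u (subE u uE) uN.
  have -> : w *m N ^+ q = w *m N ^+ (q - j) *m (E * N ^+ j).
    rewrite -[in LHS]wE -!mulmxA; congr (_ *m _).
    rewrite -[LHS]/(E * N ^+ q) -[RHS]/(N ^+ (q - j) * (E * N ^+ j)) mulrA -(commrX (q - j) cEN).
    by rewrite -mulrA -exprD subnK.
  exact: submxMl.
have rk j : (j <= q.+1)%N -> (\rank (E * N ^+ j)%R + j * k = \rank E)%N.
  elim: j => [|j IH] lejq; first by rewrite expr0 mulr1 mul0n addn0.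
  rewrite -(IH (ltnW lejq)) exprSr mulrA mulSn addnA; congr (_ + _)%N.
  by rewrite -[in RHS](mxrank_mul_ker _ N) kerE.
by rewrite -(rk q.+1) // mulSn leq_addl.
Qed.

Lemma sum_expr_unity (K : idomainType) (x : K) m : x != 1 -> x ^+ m = 1 -> \sum_(j < m) x ^+ j = 0.
Proof.
move=> x1 xm; have := subrXX 1 x m.
rewrite expr1n xm subrr => /esym/eqP; rewrite mulf_eq0 subr_eq0 eq_sym (negPf x1) /= => /eqP E.
by rewrite -[RHS]E; apply: eq_bigr => j _; rewrite expr1n mul1r.
Qed.

Lemma sum_prim_root (K : idomainType) (x : K) m k : m.-primitive_root x -> (0 < k < m)%N ->
  \sum_(j < m) x ^+ (j * k) = 0.
Proof.
move=> prx km; rewrite (eq_bigr (fun j : 'I_m => (x ^+ k) ^+ j)) => [|j _]; last by rewrite mulnC exprM.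
apply: sum_expr_unity; last by rewrite exprAC (prim_expr_order prx) expr1n.
rewrite -(prim_order_dvd prx); apply/negP => /dvdn_leq; case/andP: km => k0 km /(_ k0).
by rewrite leqNgt km.
Qed.

Section ProjectiveTrace.
Variables (p : nat) (F : closedFieldType).
Hypothesis pcharF : p \in [pchar F].
Variables (R : comNzRingType) (v : {rmorphism R -> algC}) (f : {rmorphism R -> F}).
Hypothesis pl : is_place v f.
Variables (n a : nat) (A E : 'M[R]_n.+1).
Notation q := (p ^ a.+1)%N.
Hypothesis Aq : A ^+ q = 1.
Hypothesis EE : E * E = E.
Hypothesis cAE : GRing.comm A E.
Notation fA := (map_mx f A).
Notation fE := (map_mx f E).
Notation vA := (map_mx v A).
Notation vE := (map_mx v E).

Let p_pr : prime p := pcharf_prime pcharF.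

(** The hypothesis says that the reduced [A] has only Jordan blocks of size at least [q] on the
    image of [E], so a fixed space of dimension [k] forces rank at least [q * k]. Over [algC] each
    of the [q] eigenspaces has dimension at most [k], because its eigenvalue reduces to 1. Hence all
    have dimension [k], and the trace is [k] times the sum of all roots of unity of order dividing
    [q]. *)
Lemma trace_of_long_blocks :
  (forall u : 'rV_n.+1, u *m fE = u -> u *m (fA - 1) = 0 ->
     exists2 w, w *m fE = w & u = w *m (fA - 1) ^+ q.-1) ->
  \tr (A * E) = 0.
Proof.
move=> H; have [vinj _] := pl.
have q_gt0 : (0 < q)%N by rewrite expn_gt0 prime_gt0.
have q_gt1 : (1 < q)%N by rewrite (ltn_exp2l 0) // prime_gt1.
have fEE : fE * fE = fE by rewrite -[LHS]map_mxM -[E *m E]/(E * E) EE.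
have vEE : vE * vE = vE by rewrite -[LHS]map_mxM -[E *m E]/(E * E) EE.
have vcAE : GRing.comm vA vE.
  by rewrite /GRing.comm -[LHS]map_mxM -[RHS]map_mxM -[A *m E]/(A * E) cAE.
have fcEN : GRing.comm fE (fA - 1).
  rewrite /GRing.comm mulrBl mulrBr mul1r mulr1; congr (_ - _).
  by rewrite -[LHS]map_mxM -[RHS]map_mxM -[A *m E]/(A * E) cAE.
have := mxrank_jordan fEE fcEN H; set k := \rank _ => qk.
(* Neither [E] nor its complement gains rank by reduction, and the two ranks have the same sum
   before and after. *)
have rE : \rank fE = \rank vE.
  apply/eqP; rewrite eqn_leq mxrank_specialize //= -(leq_add2r (\rank (1%:M - fE))).
  rewrite (mxrank_idemC fEE) -[X in (_ <= X)%N](mxrank_idemC vEE) leq_add2l.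
  by rewrite -(map_mx1 f) -(map_mx1 v) -!map_mxB mxrank_specialize.
have [z prz] := C_prim_root_exists q_gt0.
have vAq : vA ^+ q = 1 by rewrite -rmorphXn Aq rmorph1.
have cq : (q%:R^-1 : algC) *+ q = 1 by rewrite -[LHS]mulr_natr mulVf // pnatr_eq0 -lt0n.
pose e j : 'M[algC]_n.+1 := sproj q z q%:R^-1 vA j.
have sumz := sum_prim_root prz.
have e_sum : \sum_(j < q) e j = 1 by exact: sproj_sum.
pose T j := e j * vE.
have ceE j : GRing.comm (e j) vE by exact: sproj_comm.
have TT j : T j * T j = T j.
  rewrite /T mulrA -(mulrA (e j)) -(ceE j) mulrA -mulrA vEE.
  by congr (_ * _); apply: sproj_idem => //; exact: prim_expr_order.
have z0 : z != 0 by rewrite (prim_root_eq0 prz) -lt0n.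
have Ae j : vA * e j = z^-1 ^+ j *: e j.
  have := @sproj_eigen algC q z q%:R^-1 q_gt0 (prim_expr_order prz) n vA vAq j; rewrite -/(e j) => {2}<-.
  by rewrite scalerA -exprMn mulVf // expr1n scale1r.
have rT j : (\rank (T j) <= k)%N.
  have zj : (z^-1 ^+ j) ^+ q = 1 by rewrite exprAC exprVn (prim_expr_order prz) invr1 expr1n.
  have [r vr] := place_root_unity pl q_gt0 zj.
  have fr : f r = 1.
    have rq : r ^+ q = 1 by apply: vinj; rewrite rmorphXn vr zj rmorph1.
    have := exprB1_ppow (f r) a.+1 pcharF; rewrite -rmorphXn rq rmorph1 subrr => /eqP.
    by rewrite expf_eq0 subr_eq0 => /andP[_ /eqP].
  pose B := A - r%:M.
  have vB : map_mx v B = vA - (z^-1 ^+ j)%:M by rewrite map_mxB map_scalar_mx vr.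
  have fB : map_mx f B = fA - 1 by rewrite map_mxB map_scalar_mx fr.
  have sT : (T j <= vE :&: kermx (map_mx v B))%MS.
    rewrite sub_capmx submxMl /=; apply/sub_kermxP; rewrite vB mulmxBr mul_mx_scalar.
    rewrite -[T j *m vA]/(T j * vA) /T -mulrA -vcAE mulrA.
    have -> : e j * vA = vA * e j by apply: sproj_comm; exact: commr_refl.
    by rewrite Ae -scalerAl subrr.
  apply: leq_trans (mxrankS sT) _.
  rewrite -(leq_add2l (\rank (vE *m map_mx v B))) mxrank_mul_ker -rE.
  rewrite -(mxrank_mul_ker fE (map_mx f B)) fB leq_add2r.
  by rewrite -fB -!map_mxM mxrank_specialize.
have sT : \sum_(j < q) T j = vE by rewrite -mulr_suml e_sum mul1r.
have srT : (\sum_(j < q) \rank (T j))%N = \rank vE.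
  apply/eqP; rewrite -(eqr_nat algC) natr_sum -(mxtrace_idem vEE) -sT raddf_sum.
  by apply/eqP/eq_bigr => j _; rewrite /= mxtrace_idem //; exact: TT.
have rTk (j : 'I_q) : \rank (T j) = k.
  apply/eqP; rewrite eqn_leq rT /= -subn_eq0.
  have : (\sum_(i < q) (k - \rank (T i)) == 0)%N.
    rewrite sumnB => [|i _]; last exact: rT.
    by rewrite sum_nat_const card_ord srT subn_eq0 -rE.
  by rewrite sum_nat_eq0 => /forall_inP; exact.
have zV1 : z^-1 != 1.
  rewrite -(inj_eq invr_inj) invrK invr1.
  by rewrite -[z]expr1 -(prim_order_dvd prz) gtnNdvd.
apply: vinj; rewrite rmorph0 -trace_map_mx map_mxM -[_ *m _]/(vA * vE) -sT mulr_sumr raddf_sum.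
transitivity (\sum_(j < q) z^-1 ^+ j * k%:R : algC).
  apply: eq_bigr => j _; rewrite /= mulrA Ae -scalerAl mxtraceZ mxtrace_idem ?rTk //.
  exact: TT.
rewrite -mulr_suml sum_expr_unity ?mul0r //.
by rewrite exprVn (prim_expr_order prz) invr1.
Qed.

(* It is enough to control the fixed space of the subgroup of order [p]. *)
Lemma trace_of_fixed_points :
  (forall u : 'rV_n.+1, u *m fE = u -> u *m fA ^+ (p ^ a) = u ->
     exists2 w, w *m fE = w & u = w *m (fA ^+ (p ^ a) - 1) ^+ p.-1) ->
  \tr (A * E) = 0.
Proof.
move=> H; apply: trace_of_long_blocks => u uE uN.
pose N := fA - 1; set s := (p ^ a)%N in H.
have s_gt0 : (0 < s)%N by rewrite expn_gt0 prime_gt0.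
have NsE : N ^+ s = fA ^+ s - 1.
  have pFX : p \in [pchar {poly F}] by rewrite pchar_poly.
  have : horner_mx fA (('X - 1) ^+ s) = horner_mx fA ('X^s - 1) by rewrite exprB1_ppow.
  by rewrite rmorphXn !rmorphB rmorph1 rmorphXn /= horner_mx_X.
have H' (x : 'rV_n.+1) : x *m fE = x -> x *m N ^+ s = 0 ->
    exists2 w, w *m fE = w & x = w *m N ^+ (s * p.-1).
  move=> xE xN; rewrite exprM NsE; apply: H => //.
  by move: xN; rewrite NsE mulmxBr mulmx1 => /eqP; rewrite subr_eq0 => /eqP.
have mulN i j (x : 'rV_n.+1) : x *m N ^+ i *m N ^+ j = x *m N ^+ (i + j).
  by rewrite exprD -mulmxA.
have fcEN : GRing.comm fE N.
  rewrite /GRing.comm mulrBl mulrBr mul1r mulr1; congr (_ - _).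
  by rewrite -[LHS]map_mxM -[RHS]map_mxM -[A *m E]/(A * E) cAE.
have uNs : u *m N ^+ s = 0 by rewrite -(prednK s_gt0) exprS -[_ * _]/(_ *m _) mulmxA uN mul0mx.
have [w wE uw] := H' u uE uNs.
have le : (s.-1 <= s * p.-1)%N.
  rewrite (leq_trans (leq_pred s)) // leq_pmulr // -subn1 subn_gt0 prime_gt1 //.
(* [H'] is applied a second time, to a vector still killed by [N ^+ s]; the exponents add up to
   [s * p.-1 + s.-1], which is [q.-1]. *)
pose u1 := w *m N ^+ (s * p.-1 - s.-1).
have u1u : u1 *m N ^+ s.-1 = u by rewrite mulN subnK.
have [||w1 w1E u1w] := H' u1.
- rewrite /u1 -mulmxA -[_ ^+ _ *m fE]/(N ^+ (s * p.-1 - s.-1) * fE).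
  rewrite -(commrX _ fcEN) -[_ * _]/(_ *m _) mulmxA wE //.
- by rewrite -(prednK s_gt0) exprSr -[_ * _]/(_ *m _) mulmxA u1u uN.
exists w1 => //; rewrite -u1u u1w mulN; congr (_ *m _ ^+ _).
rewrite expnSr -/s -[in RHS](prednK (prime_gt0 p_pr)) mulnS -(prednK s_gt0) addSn /= prednK //.
by rewrite addnC.
Qed.

End ProjectiveTrace.

(** * Values of principal block characters on p-singular elements *)

(** [Z] has prime order and fixes no point of [D], so all its orbits are regular. *)
Lemma conj_orbit_sum (gT : finGroupType) (V : zmodType) (Z : {group gT}) (D : {set gT}) (E : gT -> V) :
  prime #|Z| -> Z \subset 'N(D) -> D :&: 'C(Z) = set0 ->
  \sum_(g in D) E g = \sum_(B in orbit 'J Z @: D) \sum_(w in Z) E (repr B ^ w)%g.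
Proof.
move=> prZ nDZ DCZ.
have acts : [acts Z, on D | 'J] by rewrite /acts_on astabsJ.
rewrite (set_partition_big _ (orbit_partition acts)); apply: eq_bigr => B /imsetP[g Dg BE].
have gB : g \in B by rewrite BE orbit_refl.
have rB : repr B \in B := mem_repr g gB.
have BE' : B = orbit 'J Z (repr B).
  by rewrite {1}BE; apply/esym/orbit_eqP; rewrite -BE.
have rD : repr B \in D.
  by move: rB; rewrite {2}BE => /imsetP[w Zw ->]; rewrite /= memJ_norm // (subsetP nDZ).
have TI : Z :&: 'C[repr B] = 1%g.
  apply: prime_TIg => //; apply/negP => sZC.
  have : repr B \in D :&: 'C(Z) by rewrite inE rD -sub_cent1.
  by rewrite DCZ inE.
rewrite {1}BE' big_imset // => w1 w2 Zw1 Zw2 /= e12.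
have : (w1 * w2^-1)%g \in Z :&: 'C[repr B].
  by rewrite inE groupM ?groupV //=; apply/cent1P/esym/commgP/conjg_fixP; rewrite conjgM e12 -conjgM mulgV conjg1.
by rewrite TI => /set1P/eqP; rewrite -eq_mulgV1 => /eqP.
Qed.

Lemma sum_expr_pchar (F : fieldType) p n (B : 'M[F]_n.+1) : p \in [pchar F] ->
  \sum_(k < p) B ^+ k = (B - 1) ^+ p.-1.
Proof.
move=> pF; have p_gt0 := prime_gt0 (pcharf_prime pF).
have pFX : p \in [pchar {poly F}] by rewrite pchar_poly.
have E : \sum_(k < p) 'X^k = ('X - 1) ^+ p.-1 :> {poly F}.
  have nz : 'X - 1 != 0 :> {poly F} by rewrite -polyC1 polyXsubC_eq0.
  apply: (mulfI nz); rewrite -exprS prednK // -[p in RHS]expn1 exprB1_ppow // expn1.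
  have := subrXX 'X (1 : {poly F}) p; rewrite expr1n => ->; congr (_ * _).
  rewrite (reindex_inj rev_ord_inj) /=; apply: eq_bigr => k _.
  by rewrite expr1n mulr1 subnS -subn1 subnAC subn1.
have := congr1 (horner_mx B) E; rewrite rmorph_sum rmorphXn rmorphB rmorph1 /= horner_mx_X => <-.
by apply: eq_bigr => k _; rewrite rmorphXn /= horner_mx_X.
Qed.

(** * Character values on the centraliser of a subgroup of order [p] *)

Section SecondMain.
Variables (p : nat) (F : closedFieldType) (theta : F -> algC).
Hypothesis pcharF : p \in [pchar F].
Hypothesis th : brauer_lift theta.
Variables (gT : finGroupType) (G Z O : {group gT}).
Hypothesis sZG : Z \subset G.
Hypothesis oZ : #|Z| = p.
Notation C := 'C_G(Z)%g.
Hypothesis nsOC : O <| C.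
Hypothesis p'O : p^'.-group O.
Hypothesis O_p' : forall g, g \in C -> p^'.-elt g -> g \in O.
Hypothesis C_p : forall x, x \in C -> p.-elt x -> x != 1%g -> Z \subset <[x]>.

Let p_pr : prime p := pcharf_prime pcharF.
Definition psing : {set gT} := [set g in G | ~~ p^'.-elt g].
Notation X := psing.

Lemma psing_cent : X :&: C = C :\: O.
Proof.
apply/setP => g; rewrite !inE; case: (boolP (g \in G)) => //= Gg; last by rewrite andbF.
case: (boolP (g \in 'C(Z))) => [Cg|]; last by rewrite !andbF.
rewrite !andbT; congr negb; apply/idP/idP => [pg|Og]; first by rewrite O_p' // inE Gg.
exact: mem_p_elt p'O Og.
Qed.

Lemma psing_norm : G \subset 'N(X).
Proof. by apply/normsP => y Gy; apply/setP => z; rewrite mem_conjg !inE groupJr ?groupV // p_eltJ. Qed.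

(** Counting fixed points of [Z], the number is [#|C| - #|O|] modulo [p], and [p] divides only the
    first term. *)
Lemma card_psing : (#|X|%:R : F) != 0.
Proof.
have pZ : p.-group Z by rewrite /pgroup oZ pnat_id.
have acts : [acts Z, on X | 'J] by rewrite /acts_on astabsJ (subset_trans sZG psing_norm).
rewrite -(dvdn_pcharf pcharF) /dvdn (pgroup_fix_mod pZ acts) afixJ.
have -> : X :&: 'C(Z) = C :\: O.
  rewrite -psing_cent; apply/setP => g; rewrite !inE.
  by case: (g \in G).
rewrite cardsD (setIidPr (normal_sub nsOC)) -/(dvdn _ _).
have abZ : abelian Z by apply/cyclic_abelian/prime_cyclic; rewrite oZ.
have pC : (p %| #|C|)%N by rewrite -[in X in (X %| _)%N]oZ cardSg // subsetI sZG.
rewrite dvdn_subr ?subset_leq_card ?normal_sub //.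
by rewrite -p'natE.
Qed.

Lemma place_inv_nat (R : comNzRingType) (v : {rmorphism R -> algC}) (f : {rmorphism R -> F}) m :
  is_place v f -> p^'.-nat m -> exists c : R, c *+ m = 1.
Proof.
move=> [vinj tot] p'm; have m0 : (m%:R : algC) != 0 by rewrite pnatr_eq0 -lt0n; case/andP: p'm.
case: (tot m%:R^-1) => [[c vc]|[_ [c vc fc]]].
  by exists c; apply: vinj; rewrite rmorphMn vc rmorph1 -[LHS]mulr_natr mulVf.
have cm : c = m%:R by apply: vinj; rewrite vc invrK rmorph_nat.
by have := nat_neq0_p' pcharF p'm; rewrite -(rmorph_nat f) -cm fc eqxx.
Qed.

Section Reduced.
Variables (R : comNzRingType) (v : {rmorphism R -> algC}) (f : {rmorphism R -> F}).
Hypothesis ad : adapted_place theta #|G|`_p^' v f.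
Variables (n : nat) (M : gT -> 'M[R]_n.+1) (rF : mx_representation F G n.+1).
Hypothesis M1 : M 1%g = 1.
Hypothesis MM : {in G &, {morph M : x y / (x * y)%g >-> x * y}}.
Hypothesis rFE : forall g, rF g = map_mx f (M g).
Variable s : F.
Hypothesis s0 : s != 0.
Hypothesis Xs : \sum_(g in X) rF g = s%:M.

Let sOC := normal_sub nsOC.
Let sOG : O \subset G := subset_trans sOC (subsetIl _ _).

Lemma reduced_expr g k : g \in G -> M (g ^+ k)%g = M g ^+ k.
Proof. by move=> Gg; elim: k => [|k IH]; rewrite ?expg0 // expgS MM ?groupX // IH exprS. Qed.

(* [s] times the complementary idempotent is a trace from the trivial subgroup
   of [Z], because the centraliser part of the sum over [X] is a union of cosets
   of [O]. *)
Lemma block_section_trace (o : R) x y : o *+ #|O| = 1 ->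
  x \in C -> p.-elt x -> x != 1%g -> y \in O -> commute x y ->
  \tr (M (x * y)%g * (1 - o *: \sum_(u in O) M u)) = 0.
Proof.
move=> oO Cx px x1 Oy cxy; have [pl _] := ad; have [vinj _] := pl.
have Gx : x \in G by case/setIP: Cx.
have Gy : y \in G by exact: (subsetP sOG).
have GC g : g \in C -> g \in G by case/setIP.
have GO g : g \in O -> g \in G by exact: (subsetP sOG).
set e := o *: _; pose E0 := 1 - e.
have Me u : u \in O -> M u * e = e.
  move=> Ou; rewrite /e -scalerAr mulr_sumr; congr (_ *: _).
  rewrite [RHS](reindex_inj (mulgI u)) /=; apply: eq_big => [w|w Ow]; first by rewrite groupMl.
  by rewrite MM ?GO.
have eM u : u \in O -> e * M u = e.
  move=> Ou; rewrite /e -scalerAl mulr_suml; congr (_ *: _).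
  rewrite [RHS](reindex_inj (mulIg u)) /=; apply: eq_big => [w|w Ow]; first by rewrite groupMr.
  by rewrite MM ?GO.
have ee : e * e = e.
  rewrite {1}/e -scalerAl mulr_suml (eq_bigr (fun=> e)) => [|u Ou]; last exact: Me.
  by rewrite sumr_const -scaler_nat scalerA mulr_natr oO scale1r.
have ce g : g \in C -> GRing.comm e (M g).
  move=> Cg; rewrite /GRing.comm /e -scalerAl -scalerAr mulr_suml mulr_sumr; congr (_ *: _).
  have nOg : g \in 'N(O) by apply: (subsetP (normal_norm nsOC)).
  rewrite (reindex_inj (conjg_inj g^-1%g)) /=; apply: eq_big => [w|w Ow].
    by rewrite memJ_norm ?groupV.
  have Gw : w \in G.
    by apply: GO; move: Ow; rewrite memJ_norm ?groupV.
  have Gg := GC _ Cg.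
  by rewrite -!MM ?groupJ ?groupV // conjgE invgK mulgA mulgKV.
have E00 : E0 * E0 = E0.
  by rewrite /E0 mulrBr mulr1 mulrBl mul1r ee subrr subr0.
have cE0 g : g \in C -> GRing.comm E0 (M g).
  by move=> Cg; rewrite /GRing.comm /E0 mulrBl mulrBr mul1r mulr1 ce.
(* [C :\: O] is a union of cosets of [O], so [e] fixes the sum over it. *)
have E0C : E0 * \sum_(g in C :\: O) M g = 0.
  have sumOe : \sum_(g in O) M g = e *+ #|O|.
    by rewrite /e -scaler_nat scalerA mulrC mulr_natr oO scale1r.
  have eS (S : {set gT}) : S \subset G -> (forall u, u \in O -> (u *: S)%g = S) ->
      e * \sum_(g in S) M g = \sum_(g in S) M g.
    move=> sSG OS; rewrite /e -scalerAl mulr_suml (eq_bigr (fun=> \sum_(g in S) M g)) => [|u Ou].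
      by rewrite sumr_const -scaler_nat scalerA mulr_natr oO scale1r.
    rewrite mulr_sumr [RHS](reindex_inj (mulgI u)) /=; apply: eq_big => [w|w Sw].
      by rewrite -{2}(OS _ Ou) mem_lcoset mulKg.
    have [Gu Gw] := (GO _ Ou, subsetP sSG _ Sw); by rewrite MM.
  rewrite /E0 mulrBl mul1r eS ?subrr //.
    by apply/subsetP => g /setDP[/GC].
  move=> u Ou; apply/setP => g; rewrite mem_lcoset !in_setD groupMl ?groupV //.
  by rewrite groupMl // groupV (subsetP sOC).
pose m := #[y].
have p'm : p^'.-nat m by exact: mem_p_elt p'O Oy.
have m_gt0 : (0 < m)%N by exact: order_gt0.
have [z prz] := C_prim_root_exists m_gt0.
have [r vr] := place_root_unity pl m_gt0 (prim_expr_order prz).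
have rm : r ^+ m = 1 by apply: vinj; rewrite rmorphXn vr (prim_expr_order prz) rmorph1.
have [c cm] := place_inv_nat pl p'm.
have sumr k : (0 < k < m)%N -> \sum_(j < m) r ^+ (j * k) = 0.
  move=> km; apply: vinj; rewrite rmorph_sum rmorph0 -[RHS](sum_prim_root prz km).
  by apply: eq_bigr => j _; rewrite rmorphXn vr.
have Mym : M y ^+ m = 1 by rewrite -reduced_expr // expg_order.
(* The p'-element [y] splits the module into eigenspaces over [R]; on each of them it contributes
   only a scalar, and the trace of [x] remains. *)
pose Y j := sproj m r c (M y) j.
have cxyM : GRing.comm (M y) (M x) by rewrite /GRing.comm -!MM // cxy.
have Cy : y \in C by exact: (subsetP sOC).
have cYE j : GRing.comm (Y j) E0 by apply: sproj_comm; exact/commr_sym/cE0.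
have cYx j : GRing.comm (Y j) (M x) by exact: sproj_comm.
have YY j : Y j * Y j = Y j by exact: sproj_idem.
pose E j := E0 * Y j.
have EE j : E j * E j = E j.
  by rewrite /E mulrA -(mulrA E0) cYE mulrA E00 -mulrA YY.
have cxE j : GRing.comm (M x) (E j).
  by rewrite /GRing.comm /E mulrA -(cE0 _ Cx) -!mulrA cYx.
have EE0 j : E j * E0 = E j by rewrite /E -mulrA cYE mulrA E00.
have [a oa] : exists a, #[x] = (p ^ a.+1)%N.
  have /p_natP[[|a] oa] : p.-nat #[x] := px; last by exists a.
  by move/eqP: oa; rewrite order_eq1 (negPf x1).
pose zz := (x ^+ (p ^ a))%g.
have defZ : Z :=: <[zz]>.
  apply/eqP; rewrite (eq_subG_cyclic (cycle_cyclic x)) ?C_p ?cycleX //.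
  rewrite oZ -orderE /zz orderXdiv oa ?dvdn_exp2l // expnS mulnK // expn_gt0 prime_gt0 //.
have Gzz : zz \in G by rewrite groupX.
have ozz : #[zz] = p by rewrite orderE -defZ.
have sumZ : \sum_(w in Z) rF w = (map_mx f (M x) ^+ (p ^ a) - 1) ^+ p.-1.
  rewrite -sum_expr_pchar //.
  have -> : map_mx f (M x) ^+ (p ^ a) = rF zz by rewrite /zz repr_mxX // rFE.
  rewrite defZ -[in RHS]ozz.
  have -> : <[zz]> = [set (zz ^+ i)%g | i : 'I_#[zz]] :> {set gT}.
    apply/eqP; rewrite eq_sym eqEcard card_imset ?card_ord ?leqnn ?andbT.
      by apply/subsetP => _ /imsetP[i _ ->]; rewrite mem_cycle.
    by move=> i j /eqP; rewrite eq_expg_mod_order !modn_small // => /eqP/val_inj.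
  rewrite big_imset /=; last first.
    by move=> i j _ _ /eqP; rewrite eq_expg_mod_order !modn_small // => /eqP/val_inj.
  by apply: eq_bigr => i _; rewrite repr_mxX.
have trE j : \tr (M x * E j) = 0.
  apply: (@trace_of_fixed_points p F pcharF R v f pl n a (M x) (E j) _ (EE j) (cxE j)).
    by rewrite -reduced_expr // -oa expg_order.
  move=> u uE uz.
  have ufE0 : u *m map_mx f E0 = u by rewrite -{1}uE -mulmxA -map_mxM -[E j *m E0]/(E j * E0) EE0.
  (* The scalar [s] is computed on a vector [u] fixed by [Z]. The part of the sum inside [C] is
     killed by [E0]. The rest runs over regular [Z]-orbits; since [u] absorbs the left factor of
     [w^-1 * g * w], it ends with the sum over [Z], which is the required power of a nilpotent. *)
  pose D := X :\: C.
  have urF w : w \in Z -> u *m rF w = u.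
    rewrite defZ => /cycleP[k ->]; rewrite repr_mxX //.
    have uzz : u *m rF zz = u by rewrite rFE reduced_expr // rmorphXn.
    elim: k => [|k IH]; first by rewrite expr0 mulmx1.
    by rewrite exprS -[_ * _]/(_ *m _) mulmxA uzz.
  have uD : exists w : 'rV_n.+1, u *m \sum_(g in D) rF g = w *m (map_mx f (M x) ^+ (p ^ a) - 1) ^+ p.-1.
    rewrite (conj_orbit_sum (Z := Z)) ?oZ //; last first.
    - by apply/setP => g; rewrite !inE; case: (g \in G); case: (g \in 'C(Z)); rewrite ?andbF.
    - rewrite normsD //; first exact: subset_trans sZG psing_norm.
      by rewrite normsI ?(subset_trans sZG (normG _)) // norms_cent // normG.
    exists (\sum_(B in orbit 'J Z @: D) u *m rF (repr B)).
    rewrite -sumZ mulmx_sumr mulmx_suml; apply: eq_bigr => B BD.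
    rewrite !mulmx_sumr; apply: eq_bigr => w Zw.
    have Gw : w \in G by exact: (subsetP sZG).
    have GB : repr B \in G.
      case/imsetP: BD => g /setDP[Xg _] BE.
      have : repr B \in B by apply: (mem_repr g); rewrite BE orbit_refl.
      rewrite {2}BE => /imsetP[w' Zw' ->]; rewrite /= groupJ ?(subsetP sZG w') //.
      by move: Xg; rewrite inE => /andP[].
    by rewrite conjgE !repr_mxM ?groupM ?groupV // !mulmxA urF ?groupV.
  case: uD => w uD.
  have us : s *: u = w *m (map_mx f (M x) ^+ (p ^ a) - 1) ^+ p.-1.
    rewrite -uD -mul_mx_scalar -Xs (big_setID C) /= mulmxDr psing_cent.
    rewrite -[X in X *m \sum_(g in C :\: O) _]ufE0 (eq_bigr (fun g => map_mx f (M g))) => [|g _]; last exact: rFE.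
    rewrite -(raddf_sum (map_mx f)) -mulmxA -map_mxM.
    by rewrite -[E0 *m _]/(E0 * _) E0C map_mx0 mulmx0 add0r.
  exists (s^-1 *: (w *m map_mx f (E j))).
    by rewrite -scalemxAl -mulmxA -map_mxM -[E j *m E j]/(E j * E j) EE.
  have cN : GRing.comm (map_mx f (E j)) ((map_mx f (M x) ^+ (p ^ a) - 1) ^+ p.-1).
    apply: commrX; rewrite /GRing.comm mulrBl mulrBr mulr1 mul1r; congr (_ - _).
    by apply: commrX; rewrite /GRing.comm -[LHS]map_mxM -[RHS]map_mxM -[M x *m _]/(M x * E j) cxE.
  rewrite -scalemxAl -mulmxA -[_ *m _ ^+ _]/(map_mx f (E j) * _) cN -[_ * map_mx f (E j)]/(_ *m _) mulmxA -us.
  by rewrite -scalemxAl uE scalerA mulVf // scale1r.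
have Yeig j : M y * Y j = r ^+ (j * m.-1) *: Y j.
  have := @sproj_eigen R m r c m_gt0 rm n (M y) Mym j; rewrite -/(Y j) => E1.
  rewrite -[in RHS]E1 scalerA -exprD -mulnSr prednK // mulnC exprM rm expr1n scale1r //.
have Ysum : \sum_(j < m) Y j = 1 by exact: sproj_sum.
rewrite MM // -/e -/E0 -[X in \tr X]mulr1 -Ysum mulr_sumr raddf_sum big1 //= => j _.
have -> : M x * M y * E0 * Y j = r ^+ (j * m.-1) *: (M x * E j).
  rewrite -!mulrA (mulrA (M y)) -(cE0 _ Cy) -mulrA Yeig /E -!scalerAr //.
by rewrite mxtraceZ trE mulr0.
Qed.

End Reduced.

(** On the complement of the part where [O] acts trivially, [x * w] has trace 0 for the p-part [x]
    of [t] and each [w] in [O] commuting with [x]. So the trace of [x * w] is the mean over [u] in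
    [O] of the traces of [x * u], whatever [w] is; compare the p'-part of [t] with 1. Membership in
    the block makes the scalar of the sum over [psing] reduce to the nonzero [#|psing|]. *)
Theorem block_section i t : in_block p theta i -> t \in C -> t \notin O ->
  'chi[G]_i t = 'chi_i t.`_p.
Proof.
move=> bi Ct nOt.
have [R [v [f ad]]] := adapted_place_exists pcharF th (part_pnat p^' #|G|).
have [pl _] := ad.
have [n [rG [irr rGE]]] : exists n (rG : mx_representation algC G n.+1), mx_irreducible rG /\ cfRepr rG = 'chi_i.
  have H n0 (rG0 : mx_representation algC G n0) : mx_irreducible rG0 -> cfRepr rG0 = 'chi_i ->
      exists n (rG : mx_representation algC G n.+1), mx_irreducible rG /\ cfRepr rG = 'chi_i.
    by case: n0 rG0 => [|n] rG0 irr rE; [case/mx_irrP: irr|exists n, rG0].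
  exact: H (socle_irr _) (irrRepr i).
have [M [rF [M1 MM rFE [B uB ME]]]] := place_reduction pl rG.
have sXG : psing \subset G by apply/subsetP => g; rewrite inE => /andP[].
have [r vr rE] := class_ratio_reduction irr rGE pl sXG psing_norm uB ME.
have [r' vr' fr'] := in_block_class_ratio pcharF th ad sXG psing_norm bi.
have fr : f r = #|psing|%:R by rewrite -fr'; congr (f _); apply: (proj1 pl); rewrite vr vr'.
have s0 : f r != 0 by rewrite fr card_psing.
have Xs : \sum_(g in psing) rF g = (f r)%:M.
  rewrite (eq_bigr (fun g => map_mx f (M g))) => [|g _]; last exact: rFE.
  by rewrite -map_scalar_mx -rE map_mx_sum.
have [o oO] := place_inv_nat pl p'O.
have trM g : g \in G -> 'chi_i g = v (\tr (M g)).
  move=> Gg; rewrite -rGE cfunE Gg mulr1n -trace_map_mx ME // mxtrace_mulC mulmxA mulVmx ?mul1mx //.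
pose x := t.`_p; pose y := t.`_p^'.
have Gt : t \in G by case/setIP: Ct.
have Cx : x \in C by rewrite groupX.
have Cy : y \in C by rewrite groupX.
have Oy : y \in O by rewrite O_p' ?p_elt_constt.
have tE : (x * y)%g = t by exact: consttC.
have x1 : x != 1%g by apply: contraNneq nOt => xE; rewrite -tE xE mul1g.
have px : p.-elt x by exact: p_elt_constt.
have cxy : commute x y by exact/commuteX2/commute_refl.
have H w : w \in O -> commute x w -> \tr (M (x * w)%g) = o * (\sum_(u in O) \tr (M (x * u)%g)).
  move=> Ow cxw; have := block_section_trace ad M1 MM rFE s0 Xs oO Cx px x1 Ow cxw.
  have Gx : x \in G by case/setIP: Cx.
  have GO u : u \in O -> u \in G by move/(subsetP (normal_sub nsOC))/setIP=> [].
  rewrite mulrBr mulr1 linearB /= => /eqP; rewrite subr_eq0 => /eqP ->.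
  rewrite -scalerAr mxtraceZ [M _ * _]mulr_sumr raddf_sum /=; congr (_ * _).
  rewrite [RHS](reindex_inj (mulgI w)) /=; apply: eq_big => [u|u Ou]; first by rewrite groupMl.
  by have [Gw Gu] := (GO _ Ow, GO _ Ou); rewrite mulgA (MM (x * w)%g u) ?groupM.
rewrite (trM t) // (trM t.`_p) ?groupX // -/x -{1}tE (H y) //.
by rewrite -[in RHS](mulg1 x) (H 1%g) ?group1 //; exact: commute1.
Qed.

End SecondMain.

(** * Integrality of Brauer characters *)

Section PrimeToP.
Variables (p : nat) (F : closedFieldType) (theta : F -> algC).
Hypothesis pcharF : p \in [pchar F].
Hypothesis th : brauer_lift theta.
Variables (gT : finGroupType) (Q : {group gT}).
Notation dec := (@dec p F theta gT Q).
Notation bcoef := (@bcoef p F theta gT Q).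
Notation ib := (@ib p F theta gT Q).
Notation ibr := (@ibr p F theta gT Q).

Lemma brauer_char1 n (rG : mx_representation F Q n) : brauer_char p theta rG 1%g = n%:R.
Proof.
have p1 : 1%g \in p_regular p Q by rewrite inE group1 /p_elt order1.
rewrite (brauer_char_roots theta (s := nseq n 1) p1).
  by rewrite big_nseq theta1 // iter_addr_0.
rewrite repr_mx1 big_nseq iter_mulr_1 /char_poly /char_poly_mx map_mx1.
have -> : 'X%:M - 1%:M = ('X - 1)%:M :> 'M[{poly F}]_n by rewrite raddfB.
by rewrite det_scalar polyC1.
Qed.

Lemma ib1_gt0 k : 0 < ib k 1%g.
Proof.
have [n [rG [irr ->]]] := ib_IBr pcharF th k.
by rewrite brauer_char1 ltr0n; case/mx_irrP: irr.
Qed.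

Hypothesis p'Q : p^'.-group Q.

Lemma preg_restr_id (chi : 'CF(Q)) : preg_restr p chi = chi.
Proof.
apply/cfun_inP => x Qx; rewrite preg_restrE inE Qx /=.
by rewrite (mem_p_elt p'Q Qx) mulr1n.
Qed.

(** The group algebra of a p'-group over [F] is split semisimple, and non-similar irreducible
    representations have different Brauer characters. *)
Lemma sum_ib1_sqr : #|Q|%:R <= \sum_k (ib k 1%g) ^+ 2.
Proof.
pose sG := DecSocleType (regular_repr F Q).
have F'Q : [pchar F]^'.-group Q.
  by rewrite (eq_p'group _ (pcharf_eq pcharF)).
have split : group_splitting_field F Q by move=> n rG; exact: closed_abs_irr.
have /choice[h hE] (i : sG) : exists k, ib k = brauer_char p theta (irr_repr i).
  have [|k ->] := @IBr_ib p F theta pcharF th gT Q (brauer_char p theta (irr_repr i)); last by exists k.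
  by exists _, (irr_repr i); split=> //; exact: socle_irr.
have h_inj : injective h.
  move=> i j hij; apply/eqP/socle_rsimP; apply: (IBr_rsim pcharF th).
  - exact: socle_irr.
  - exact: socle_irr.
  - by move: (hE i) (hE j); rewrite hij => ->.
have <- := sum_irr_degree_pchar sG F'Q split.
rewrite natr_sum; have -> : \sum_(i : sG) (irr_degree i ^ 2)%:R = \sum_(i : sG) (ib (h i) 1%g) ^+ 2 :> algC.
  by apply: eq_bigr => i _; rewrite hE brauer_char1 natrX.
rewrite -(big_imset (fun k => (ib k 1%g) ^+ 2)) /=; last by move=> i j _ _ /h_inj.
rewrite [X in _ <= X](bigID (mem (h @: predT))) /= lerDl sumr_ge0 // => k _.
by rewrite exprn_ge0 // ltW // ib1_gt0.
Qed.

(** A count of degrees. The projective degree [Phi l] is at least the degree of any ['chi_i]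
    containing [ib l], which is at least the degree of [ib l]. But the products of [Phi l] with the
    degree of [ib l] sum to [#|Q|], at most the sum of the squares of the latter. So equality holds
    throughout, and ['chi_i] is [ib l]. *)
Lemma IBr_p'group phi : IBr p theta phi -> phi \in irr Q.
Proof.
move=> /(IBr_ib pcharF th)[k ->].
have dge0 i l : 0 <= dec i l by apply: natr_ge0; exact: dec_nat.
have dec1 i l : dec i l != 0 -> 1 <= dec i l by have /natrP[m ->] := dec_nat pcharF th i l; rewrite pnatr_eq0 ler1n lt0n.
have chiE i : 'chi_i = \sum_l dec i l *: ib l.
  by rewrite -(preg_restr_dec pcharF th) preg_restr_id.
have chi1E i : 'chi_i 1%g = \sum_l dec i l * ib l 1%g.
  by rewrite {1}chiE sum_cfunE; apply: eq_bigr => l _; rewrite cfunE.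
pose Phi l := \sum_i 'chi_i 1%g * dec i l.
have exi l : exists i, dec i l != 0.
  apply: contrapT => no; have [a aE] := cfun_irr_sum (ib l).
  have := bcoef_ib pcharF th l l; rewrite eqxx aE linear_sum /= big1 => [/esym/eqP|i _].
    by rewrite oner_eq0.
  rewrite linearZ /=; have -> : bcoef l 'chi_i = 0; last by rewrite mulr0.
  apply: contrapT => /eqP ne; apply: no; exists i.
  by rewrite decE preg_restr_id.
have chi_ge i l : dec i l != 0 -> ib l 1%g <= 'chi_i 1%g.
  move=> d0; rewrite chi1E (bigD1 l) //= ler_wpDr ?sumr_ge0 //.
    by move=> m _; rewrite mulr_ge0 // ltW // ib1_gt0.
  by rewrite ler_peMl ?dec1 // ltW // ib1_gt0.
have Phi_ge i l : dec i l != 0 -> 'chi_i 1%g <= Phi l.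
  move=> d0; rewrite /Phi (bigD1 i) //= ler_wpDr ?sumr_ge0 //.
    by move=> m _; rewrite mulr_ge0 // char1_ge0 ?irr_char.
  by rewrite ler_peMr ?dec1 // char1_ge0 ?irr_char.
have PhiE l : Phi l = ib l 1%g.
  have cQ : \sum_l Phi l * ib l 1%g = #|Q|%:R.
    rewrite -(irr_sum_square Q).
    transitivity (\sum_i \sum_l 'chi[Q]_i 1%g * dec i l * ib l 1%g).
      by rewrite exchange_big; apply: eq_bigr => m _; rewrite mulr_suml.
    apply: eq_bigr => i _; rewrite expr2 {3}chi1E mulr_sumr.
    by apply: eq_bigr => m _; rewrite mulrA.
  have : \sum_l (Phi l - ib l 1%g) * ib l 1%g <= 0.
    under eq_bigr do rewrite mulrBl.
    rewrite big_split /= sumrN cQ subr_le0.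
    under [X in _ <= X]eq_bigr do rewrite -expr2.
    exact: sum_ib1_sqr.
  have ge0 m : true -> 0 <= (Phi m - ib m 1%g) * ib m 1%g.
    move=> _; have [i d0] := exi m.
    by rewrite mulr_ge0 ?subr_ge0 ?(le_trans (chi_ge _ _ d0)) ?Phi_ge // ltW // ib1_gt0.
  move=> le0; have : \sum_l (Phi l - ib l 1%g) * ib l 1%g == 0 by rewrite eq_le le0 sumr_ge0.
  rewrite (psumr_eq0 _ ge0) => /allP/(_ l (mem_index_enum _)) /=.
  by rewrite mulf_eq0 (gt_eqF (ib1_gt0 l)) orbF subr_eq0 => /eqP.
have [i d0] := exi k.
have E1 : 'chi_i 1%g = ib k 1%g.
  by apply/eqP; rewrite eq_le chi_ge // andbT -PhiE Phi_ge.
have : \sum_(l | l != k) dec i l * ib l 1%g + (dec i k - 1) * ib k 1%g = 0.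
  move: E1; rewrite chi1E (bigD1 k) //= => E1; rewrite mulrBl mul1r -{2}E1.
  by rewrite addrA [X in X - _]addrC subrr.
have ge1 : 0 <= \sum_(l | l != k) dec i l * ib l 1%g.
  by rewrite sumr_ge0 // => l _; rewrite mulr_ge0 // ltW // ib1_gt0.
have ge2 : 0 <= (dec i k - 1) * ib k 1%g.
  by rewrite mulr_ge0 ?subr_ge0 ?dec1 // ltW // ib1_gt0.
move/eqP; rewrite paddr_eq0 // => /andP[s0].
rewrite mulf_eq0 (gt_eqF (ib1_gt0 k)) orbF subr_eq0 => /eqP dk.
suff -> : ib k = 'chi_i by exact: mem_irr.
rewrite chiE (bigD1 k) //= dk scale1r big1 ?addr0 // => l lk.
move: s0; rewrite psumr_eq0 => [/allP/(_ l (mem_index_enum _))|m _]; last first.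
  by rewrite mulr_ge0 // ltW // ib1_gt0.
by rewrite lk /= mulf_eq0 (gt_eqF (ib1_gt0 l)) orbF => /eqP->; rewrite scale0r.
Qed.

Lemma brauer_char_p'group n (rG : mx_representation F Q n) : brauer_char p theta rG \is a character.
Proof.
have [s [sI ->]] := brauer_char_decomp p theta rG.
rewrite big_seq rpred_sum // => psi /sI/IBr_p'group/irrP[i ->]; exact: irr_char.
Qed.

End PrimeToP.

(** * Local induction over the algebraic integers *)

Section AintSpan.
Implicit Type gT : finGroupType.

(** Algebraic integers instead of integers, because the scaled indicator of an element of a cyclic
    group has roots of unity as coefficients. *)
Definition aint_span gT (G : {group gT}) (f : 'CF(G)) := forall i : Iirr G, '[f, 'chi_i] \in Aint.

Lemma aint_spanD gT (G : {group gT}) (f g : 'CF(G)) : aint_span f -> aint_span g -> aint_span (f + g).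
Proof. by move=> hf hg i; rewrite cfdotDl rpredD. Qed.

Lemma aint_spanZ gT (G : {group gT}) a (f : 'CF(G)) : a \in Aint -> aint_span f -> aint_span (a *: f).
Proof. by move=> ha hf i; rewrite cfdotZl rpredM. Qed.

Lemma aint_span_sum gT (G : {group gT}) (I : Type) (r : seq I) (f : I -> 'CF(G)) :
  (forall i, aint_span (f i)) -> aint_span (\sum_(i <- r) f i).
Proof. by move=> hf j; rewrite cfdot_suml rpred_sum // => i _; apply: hf. Qed.

Lemma aint_span_char gT (G : {group gT}) (f : 'CF(G)) : f \is a character -> aint_span f.
Proof. by move=> Nf i; rewrite Aint_Cnat // Cnat_cfdot_char_irr. Qed.

Lemma aint_spanM gT (G : {group gT}) (f g : 'CF(G)) : aint_span f -> aint_span g -> aint_span (f * g).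
Proof.
move=> hf hg; rewrite (cfun_sum_cfdot f) (cfun_sum_cfdot g) mulr_suml.
apply: aint_span_sum => i; rewrite mulr_sumr; apply: aint_span_sum => j.
rewrite -scalerAl -scalerAr; do 2!apply: aint_spanZ => //.
by apply: aint_span_char; rewrite rpredM ?irr_char.
Qed.

Lemma aint_spanInd gT (H G : {group gT}) (f : 'CF(H)) : aint_span f -> aint_span ('Ind[G] f).
Proof.
move=> hf; rewrite (cfun_sum_cfdot f) linear_sum; apply: aint_span_sum => i.
by rewrite linearZ; apply: aint_spanZ => //; apply: aint_span_char; rewrite cfInd_char ?irr_char.
Qed.

Lemma aint_span_dprodl gT (G K H : {group gT}) (KxH : K \x H = G) (f : 'CF(K)) :
  aint_span f -> aint_span (cfDprodl KxH f).
Proof.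
move=> hf; rewrite (cfun_sum_cfdot f) linear_sum; apply: aint_span_sum => i.
by rewrite linearZ; apply: aint_spanZ => //; apply: aint_span_char; rewrite cfDprodl_char irr_char.
Qed.

End AintSpan.

Lemma card_mul_rcosets (gT : finGroupType) (S : {group gT}) (T : {set gT}) :
  (S * T)%g \subset T -> #|T| = (#|rcosets S T| * #|S|)%N.
Proof.
move=> sST; apply: card_uniform_partition => [X /rcosetsP[h _ ->]|]; first exact: card_rcoset.
apply/and3P; split.
- rewrite /cover eqEsubset; apply/andP; split.
    by apply/bigcupsP => X /rcosetsP[h Th ->]; rewrite (subset_trans _ sST) // mulgS // sub1set.
  by apply/subsetP => h Th; apply/bigcupP; exists (S :* h); rewrite ?rcoset_refl //; apply/rcosetsP; exists h.
- have [_ tri _] := and3P (rcosets_partition (subsetT S)).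
  apply: trivIsetS tri; apply/subsetP => X /rcosetsP[h _ ->].
  by apply/rcosetsP; exists h; rewrite ?inE.
by apply/rcosetsP => -[h _ /setP/(_ h)]; rewrite rcoset_refl inE.
Qed.

Section LocalInduction.
Variables (l : nat) (gT : finGroupType) (G : {group gT}) (y : gT) (S A : {group gT}).
Hypotheses (Gy : y \in G) (sylS : l.-Sylow('C_G[y]) S) (yxS : <[y]> \x S = A).

(** The class function behind Brauer's induction theorem, on an elementary subgroup. The factor
    [#[y]] clears the denominators of its coefficients and cancels against [#|A|] in the induced
    values. *)
Definition local_cfun : 'CF(A) := cfDprodl yxS (#[y]%:R *: '1_[set y]).

Definition transporter_inv x := [set h in G | x ^ h^-1 \in y *: S]%g.

Lemma local_cfun_span : aint_span local_cfun.
Proof.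
apply: aint_span_dprodl => i.
have n1 : [set y] <| <[y]>.
  rewrite /(_ <| _) sub1set cycle_id /= cycle_subG.
  by apply/normP; rewrite conjg_set1 conjgE mulKg.
rewrite cfdotZl (cfdotEl _ (cfun_onG _)) (bigD1 y) ?cycle_id //= big1 => [|z /andP[_ zy]]; last first.
  by rewrite cfuniE // inE (negbTE zy) mul0r.
rewrite cfuniE // set11 mul1r addr0 -orderE mulVKf ?neq0CG //.
by rewrite (Aint_aut Num.conj) Aint_irr.
Qed.

Lemma local_cfunE z : local_cfun z = #[y]%:R *+ (z \in y *: S)%g.
Proof.
have [_ defA _ tiyS] := dprodP yxS.
have [Az|nAz] := boolP (z \in A); last first.
  rewrite cfun0 //; case: (boolP (z \in _)) => // /lcosetP[s Ss zE].
  by case/negP: nAz; rewrite -defA zE mem_mulg ?cycle_id.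
have /mulsgP[a s ya Ss ->] : (z \in <[y]> * S)%g by rewrite defA.
rewrite /local_cfun cfDprodEl // cfunE cfuniE; last first.
  rewrite /(_ <| _) sub1set cycle_id /= cycle_subG.
  by apply/normP; rewrite conjg_set1 conjgE mulKg.
rewrite inE mulr_natr; congr (_ *+ nat_of_bool _); apply/eqP/lcosetP => [->|[s' Ss' E]].
  by exists s.
have : (y^-1 * a)%g \in <[y]> :&: S.
  rewrite inE groupM ?groupV ?cycle_id //=.
  have -> : (y^-1 * a = s' * s^-1)%g by apply: (mulgI y); rewrite !mulgA mulgV mul1g -E mulgK.
  by rewrite groupM ?groupV.
by rewrite tiyS => /set1gP/(canRL (mulKVg _)); rewrite mulg1.
Qed.

Lemma local_induced x : 'Ind[G] local_cfun x = #|rcosets S (transporter_inv x)|%:R.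
Proof.
have sAG : A \subset G.
  by have [_ <- _ _] := dprodP yxS; rewrite mul_subG ?cycle_subG // (subset_trans (pHall_sub sylS)) ?subsetIl.
have [_ defA _ tiyS] := dprodP yxS.
rewrite cfIndE //.
have -> : \sum_(h in G) local_cfun (x ^ h)%g = #[y]%:R * #|transporter_inv x|%:R.
  rewrite (reindex_inj invg_inj) /= -sum1_card natr_sum mulr_sumr big_mkcond [RHS]big_mkcond.
  apply: eq_bigr => h _; rewrite groupV inE local_cfunE; case: (h \in G) => //=.
  by case: (_ \in _); rewrite ?mulr1.
have -> : #|transporter_inv x| = (#|rcosets S (transporter_inv x)| * #|S|)%N.
  apply: card_mul_rcosets.
    apply/subsetP => z /mulsgP[s h Ss]; rewrite inE => /andP[Gh xh] ->.
    have /setIP[Gs cs] := subsetP (pHall_sub sylS) _ Ss.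
    rewrite inE groupM //= invMg conjgM.
    case/lcosetP: xh => s' Ss' ->; apply/lcosetP; exists (s' ^ s^-1)%g; rewrite ?groupJ ?groupV //.
    by rewrite conjMg; congr (_ * _)%g; rewrite conjgE invgK mulgA (cent1P cs) mulgK.
rewrite -(dprod_card yxS) -orderE !natrM invfM mulrACA mulVf ?mul1r ?neq0CG //.
by rewrite mulrCA mulVf ?mulr1 ?neq0CG.
Qed.

(** The cosets counted are the fixed points of the [l]-part of [x] on the right cosets of [S] in
    ['C_G[y]]; modulo [l] their number is the index of a Sylow [l]-subgroup. *)
Lemma local_induced_coprime x : x \in G -> prime l -> x.`_l^' = y -> ~~ (l %| #|rcosets S (transporter_inv x)|)%N.
Proof.
move=> Gx pl xy; pose C := ('C_G[y])%G.
have cx : x.`_l \in C.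
  rewrite inE groupX //= -xy; apply/cent1P; exact: commuteX2.
have xl : l.-group <[x.`_l]> by rewrite /pgroup -orderE -/(p_elt l _) p_elt_constt.
have -> : rcosets S (transporter_inv x) = 'Fix_(rcosets S C | 'Rs)(<[x.`_l]>).
  apply/setP => X; rewrite inE.
  have key h : h \in G -> (h \in transporter_inv x) = (h \in C) && (S :* h \in 'Fix_('Rs)(<[x.`_l]>)).
    move=> Gh; rewrite sub_afixRs_norms cycle_subG mem_conjg [_ \in transporter_inv x]inE in_setI Gh /=.
    apply/lcosetP/andP => [[s Ss xE]|[ch Sx]].
      have cs : s \in 'C[y] by have /setIP[] := subsetP (pHall_sub sylS) _ Ss.
      have sl : l.-elt s by apply: mem_p_elt Ss; case/and3P: sylS.
      have cys : commute y s by apply/cent1P; rewrite cent1C.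
      have yl : l^'.-elt y by rewrite -xy p_elt_constt.
      have E1 : (x.`_l^' ^ h^-1 = y)%g.
        by rewrite -consttJ xE consttM // (constt_p_elt yl) (constt1P _) ?mulg1 // p_eltNK.
      have E2 : (x.`_l ^ h^-1 = s)%g.
        by rewrite -consttJ xE consttM // (constt1P _) ?mul1g ?constt_p_elt.
      split; last by rewrite E2.
      rewrite xy in E1; have /conjg_fixP/commgP/commuteV := E1; rewrite invgK => cyh.
      by rewrite cent1C; apply/cent1P.
    exists (x.`_l ^ h^-1)%g => //; rewrite -{1}(consttC l^' x) conjMg xy consttNK; congr (_ * _)%g.
    by apply/conjg_fixP/commgP/commuteV/commute_sym/cent1P.
  apply/rcosetsP/andP => [[h Th ->]|[/rcosetsP[h Ch ->] fx]].
    have Gh : h \in G by move: Th; rewrite inE => /andP[].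
    by move: Th; rewrite key // => /andP[ch ->]; split=> //; apply/rcosetsP; exists h.
  by exists h => //; rewrite key ?Ch //; case/setIP: Ch.
rewrite /dvdn -(pgroup_fix_mod xl); last first.
  by apply: subset_trans (actsRs_rcosets _ _); rewrite cycle_subG.
by rewrite -/(_ %| _)%N -/(indexg _ _) -prime.p'natE //; case/and3P: sylS.
Qed.

End LocalInduction.

Section BrauerLattice.
Variables (p : nat) (F : closedFieldType) (theta : F -> algC).
Hypothesis pcharF : p \in [pchar F].
Hypothesis th : brauer_lift theta.
Variables (gT : finGroupType).
Implicit Type G : {group gT}.

Fact p'part_fun_subproof G (phi : 'CF(G)) : is_class_fun <<G>>%g [ffun x => phi x.`_p^' *+ (x \in G)].
Proof.
rewrite genGid; apply: intro_class_fun => [x y Gx Gy | x /negbTE-> //].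
by rewrite groupJr // consttJ cfunJ.
Qed.
(** A Brauer character is extended to all of [G] through p'-parts so that its restrictions to
    nilpotent subgroups are true characters, the input that Brauer's induction method needs. *)
Definition p'part_fun G (phi : 'CF(G)) : 'CF(G) := Cfun 0 (p'part_fun_subproof phi).

Lemma p'part_funE G (phi : 'CF(G)) x : x \in G -> p'part_fun phi x = phi x.`_p^'.
Proof. by move=> Gx; rewrite cfunE Gx. Qed.

Lemma preg_restr_p'part_fun G n (rG : mx_representation F G n) :
  preg_restr p (p'part_fun (brauer_char p theta rG)) = brauer_char p theta rG.
Proof.
apply/cfun_inP => x Gx; rewrite preg_restrE.
case: (boolP (x \in p_regular p G)) => px; last by rewrite brauer_char_supp.
move: px; rewrite p_regularE => /andP[_ px].
by rewrite mulr1n p'part_funE // (constt_p_elt px).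
Qed.

(** In the product of ['O_p(A)] and ['O_p^'(A)] the p'-part is the second component, and Brauer
    characters of a p'-group are ordinary. *)
Lemma p'part_fun_nilpotent G (A : {group gT}) n (rG : mx_representation F G n) :
  A \subset G -> nilpotent A -> 'Res[A] (p'part_fun (brauer_char p theta rG)) \is a character.
Proof.
move=> sAG nilA; have AxB := nilpotent_pcoreC p nilA.
have sQG : 'O_p^'(A) \subset G := subset_trans (pcore_sub _ _) sAG.
have p'Q : p^'.-group 'O_p^'(A) := pcore_pgroup _ _.
suff -> : 'Res[A] (p'part_fun (brauer_char p theta rG)) =
          cfDprodr AxB (brauer_char p theta (subg_repr rG sQG)).
  by rewrite cfDprodr_char brauer_char_p'group.
apply/cfun_inP => x; rewrite -{1}(dprodW AxB) => /mulsgP[a b Aa Bb ->].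
have [_ _ cAB _] := dprodP AxB.
have cab : commute a b by apply/cent1P; rewrite cent1C; apply: subsetP Bb; rewrite sub_cent1 (subsetP _ _ Aa) // centsC.
have pa : p.-elt a := mem_p_elt (pcore_pgroup _ _) Aa.
have pb : p^'.-elt b := mem_p_elt p'Q Bb.
have Aab : (a * b)%g \in A by rewrite groupM // (subsetP (pcore_sub _ _) _ Aa, subsetP (pcore_sub _ _) _ Bb).
rewrite cfDprodEr // cfResE // p'part_funE ?(subsetP sAG) // consttM //.
have -> : (a.`_p^' * b.`_p^' = b)%g by rewrite (constt1P _) ?p_eltNK // mul1g constt_p_elt.
by rewrite [LHS]brauer_charE [RHS]brauer_charE !p_regularE Bb (subsetP sQG) ?Bb.
Qed.

(* The class functions induced from local_cfun multiply the extension of a Brauer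
   character to an Aint-combination of characters, and at each x one of them has a
   value prime to l; expanding the product over x of (value at x) - (function), which
   vanishes, yields m. *)
Lemma brauer_lattice G n (rG : mx_representation F G n) l : prime l ->
  exists m (a : Iirr G -> algC), [/\ ~~ (l %| m)%N, forall i, a i \in Aint
    & m%:R *: brauer_char p theta rG = \sum_i a i *: preg_restr p 'chi_i].
Proof.
move=> pl; pose f := p'part_fun (brauer_char p theta rG).
suff [m [lm fm]] : exists m, ~~ (l %| m)%N /\ aint_span (m%:R *: f).
  exists m, (fun i => '[m%:R *: f, 'chi_i]); split=> //.
  rewrite -(preg_restr_p'part_fun rG) -linearZ /= {1}(cfun_sum_cfdot (m%:R *: f)) linear_sum /=.
  by apply: eq_bigr => i _; rewrite linearZ.
pose good (u : 'CF(G)) := aint_span u /\ aint_span (f * u).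
have one_span : aint_span (1 : 'CF(G)) by apply: aint_span_char; rewrite rpred1.
have ex_g x : x \in G -> exists2 g : 'CF(G), good g
    & (forall z, exists k : nat, g z = k%:R) /\ exists2 k, g x = k%:R & ~~ (l %| k)%N.
  move=> Gx; pose y := x.`_l^'; have Gy : y \in G by rewrite groupX.
  have [S sylS] := Sylow_exists l ('C_G[y]).
  have lS : l.-group S by case/and3P: sylS.
  have sSC : S \subset 'C_G[y] := pHall_sub sylS.
  have l'y : l^'.-group <[y]> by rewrite /pgroup -orderE -/(p_elt _ _) p_elt_constt.
  have [A yxS] : exists A : {group gT}, <[y]> \x S = A.
    exists (<[y]> <*> S)%G; rewrite dprodEY //.
      by rewrite cent_cycle (subset_trans sSC) ?subsetIr.
    by rewrite setIC coprime_TIg // (pnat_coprime lS l'y).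
  have sAG : A \subset G.
    by have [_ <- _ _] := dprodP yxS; rewrite mul_subG ?cycle_subG // (subset_trans sSC) ?subsetIl.
  have nilA : nilpotent A.
    by rewrite (dprod_nil yxS) (pgroup_nil lS) abelian_nil ?cycle_abelian.
  exists ('Ind[G] (local_cfun yxS)); split.
  - exact/aint_spanInd/local_cfun_span.
  - rewrite mulrC -cfIndM //; apply: aint_spanInd; apply: aint_spanM; first exact: local_cfun_span.
    exact/aint_span_char/p'part_fun_nilpotent.
  - by move=> z; exists #|rcosets S (transporter_inv G y S z)|; rewrite (local_induced Gy sylS).
  - exists #|rcosets S (transporter_inv G y S x)|; first by rewrite (local_induced Gy sylS).
    exact: local_induced_coprime.
have /choice[g gP] x : exists u : 'CF(G), x \in G -> good u /\
     (forall z, exists k : nat, u z = k%:R) /\ exists2 k, u x = k%:R & ~~ (l %| k)%N.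
  case: (boolP (x \in G)) => [Gx|_]; last by exists 0.
  by have [u ? ?] := ex_g x Gx; exists u.
have goodD u v : good u -> good v -> good (u + v).
  by case=> u1 u2 [v1 v2]; split; rewrite ?mulrDr; apply: aint_spanD.
have goodM u v : good u -> aint_span v -> good (u * v).
  by case=> u1 u2 hv; split; rewrite ?mulrA; apply: aint_spanM.
have natZ u k : aint_span u -> aint_span (k%:R *: u) by apply: aint_spanZ; rewrite Aint_Cnat ?rpred_nat.
have [m [q [lm gq _ q0]]] : exists m (q : 'CF(G)),
    [/\ ~~ (l %| m)%N, good (m%:R *: 1 - q), aint_span q & forall x, x \in enum G -> q x = 0].
  have sub : {subset enum G <= G} by move=> x; rewrite mem_enum.
  elim: (enum G) sub => [|x s IH] sub.
    exists 1%N, 1; split=> //; first by rewrite dvdn1 neq_ltn prime_gt1 ?orbT.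
    by rewrite scale1r subrr; split; rewrite ?mulr0 => i; rewrite cfdot0l rpred0.
  have [|m [q [lm gq qs q0]]] := IH; first by move=> y sy; apply: sub; rewrite inE sy orbT.
  have [gx [_ [k kE lk]]] := gP x (sub x (mem_head _ _)).
  have gx1 : aint_span (- g x).
    by rewrite -scaleN1r; apply: aint_spanZ; [rewrite rpredN rpred1 | case: gx].
  exists (k * m)%N, ((k%:R *: 1 - g x) * q); split.
  - by rewrite Euclid_dvdM // negb_or lk.
  - have -> : (k * m)%:R *: 1 - (k%:R *: 1 - g x) * q = (m%:R *: 1 - q) * (k%:R *: 1) + g x * q.
      rewrite natrM -scalerA -[m%:R *: 1]mul1r scalerAl mul1r; set K := _ *: _; set M := _ *: _.
      by rewrite !mulrBl opprB [q * K]mulrC [M * K]mulrC addrA addrAC.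
    by apply: goodD; apply: goodM => //; apply: natZ.
  - by apply: aint_spanM => //; apply: aint_spanD => //; apply: natZ.
  - move=> y; rewrite inE !cfunE => /predU1P[->|/q0->]; last by rewrite mulr0.
    by rewrite kE cfun1E sub ?mem_head // mulr1 subrr mul0r.
exists m; split=> //; case: gq => _.
have -> : q = 0 by apply/cfun_inP => x Gx; rewrite q0 ?mem_enum // cfunE.
by rewrite subr0 -scalerAr mulr1.
Qed.
End BrauerLattice.

(** * Clifford theory *)

Section Tensor.
Variables (p : nat) (F : closedFieldType) (theta : F -> algC).
Hypothesis pcharF : p \in [pchar F].
Hypothesis th : brauer_lift theta.
Variables (gT : finGroupType) (G : {group gT}).
Notation bchar := (@brauer_char p F theta gT G _).

Fact kron_mx_repr n1 n2 (r1 : mx_representation F G n1) (r2 : mx_representation F G n2) :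
  mx_repr G (fun x => kron (r1 x) (r2 x)).
Proof.
by split=> [|x y Gx Gy]; rewrite ?repr_mx1 ?kron1 // !repr_mxM // kronM.
Qed.
Definition kron_repr n1 n2 (r1 : mx_representation F G n1) (r2 : mx_representation F G n2) :=
  MxRepresentation (kron_mx_repr r1 r2).

Lemma brauer_char_kron n1 n2 (r1 : mx_representation F G n1) (r2 : mx_representation F G n2) :
  bchar (kron_repr r1 r2) = bchar r1 * bchar r2.
Proof.
apply/cfunP => x; rewrite [RHS]cfunE.
case: (boolP (x \in p_regular p G)) => px; last by rewrite !brauer_char_supp // mulr0.
have [Q1 [d1 [u1 E1]]] := repr_preg_diag pcharF r1 px.
have [Q2 [d2 [u2 E2]]] := repr_preg_diag pcharF r2 px.
have diag_eig m (Q : 'M[F]_m) (d : 'rV_m) : Q \in unitmx ->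
    char_poly (invmx Q *m diag_mx d *m Q) = \prod_(a <- [seq d 0 i | i <- enum 'I_m]) ('X - a%:P).
  move=> uQ; have := char_poly_conj (diag_mx d) (Q := invmx Q).
  rewrite unitmx_inv invmxK => ->//; rewrite char_poly_trig ?diag_mx_is_trig // big_map big_enum.
  by apply: eq_bigr => i _; rewrite mxE eqxx mulr1n.
have cK : char_poly (kron_repr r1 r2 x) = char_poly (kron (diag_mx d1) (diag_mx d2)).
  rewrite /= E1 E2 !kronM; have uK : kron Q1 Q2 \in unitmx.
    suff /mulmx1_unit[] : kron Q1 Q2 *m kron (invmx Q1) (invmx Q2) = 1%:M by [].
    by rewrite -kronM !mulmxV // kron1.
  have -> : kron (invmx Q1) (invmx Q2) = invmx (kron Q1 Q2).
    by rewrite -[LHS]mulmx1 -(mulmxV uK) mulmxA -kronM !mulVmx // kron1 mul1mx.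
  have := char_poly_conj (kron (diag_mx d1) (diag_mx d2)) (Q := invmx (kron Q1 Q2)).
  by rewrite unitmx_inv invmxK => ->.
have c1 := etrans (congr1 _ E1) (diag_eig _ _ _ u1).
have c2 := etrans (congr1 _ E2) (diag_eig _ _ _ u2).
rewrite (brauer_char_roots theta px (etrans cK (char_poly_kron_diag d1 d2))).
rewrite (brauer_char_roots theta px c1) (brauer_char_roots theta px c2).
have Gx : x \in G by move: px; rewrite inE => /andP[].
have unity m (r : mx_representation F G m) (d : 'rV_m) i :
    char_poly (r x) = \prod_(a <- [seq d 0 i | i <- enum 'I_m]) ('X - a%:P) -> is_root_of_unity (d 0 i).
  move=> c; exists #[x]; first exact: order_gt0.
  apply: (eigenvalues_unity (rG := r) Gx); rewrite (perm_mem (eigenvalues_perm c)).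
  by apply/mapP; exists i; rewrite ?mem_enum.
have [_ thM _] := th.
have sumE m (d : 'rV[F]_m) : \sum_(a <- [seq d 0 i | i <- enum 'I_m]) theta a = \sum_(i < m) theta (d 0 i).
  by rewrite big_map big_enum.
rewrite !sumE big_allpairs_dep big_enum /= mulr_suml; apply: eq_bigr => i _.
rewrite big_enum mulr_sumr; apply: eq_bigr => j _.
by rewrite thM //; [exact: unity c1 | exact: unity c2].
Qed.
End Tensor.

Section Clifford.
Variables (p : nat) (F : closedFieldType) (theta : F -> algC).
Hypothesis pcharF : p \in [pchar F].
Hypothesis th : brauer_lift theta.
Variables (gT : finGroupType) (G L : {group gT}).
Hypothesis nsLG : L <| G.
Let sLG : L \subset G := normal_sub nsLG.
Let nLG : G \subset 'N(L) := normal_norm nsLG.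

Fact conj_mx_repr x n (r : mx_representation F L n) : x \in G -> mx_repr L (fun h => r (h ^ x^-1)%g).
Proof.
move=> Gx; have nLx : x^-1%g \in 'N(L) by rewrite groupV (subsetP nLG).
by split=> [|h k Lh Lk]; rewrite ?conj1g ?repr_mx1 // conjMg repr_mxM // memJ_norm.
Qed.
Definition conj_repr x n (r : mx_representation F L n) (Gx : x \in G) :=
  MxRepresentation (conj_mx_repr r Gx).

Lemma brauer_char_conj x n (r : mx_representation F L n) (Gx : x \in G) :
  brauer_char p theta (conj_repr r Gx) = (brauer_char p theta r ^ x)%CF.
Proof.
have nLx : x \in 'N(L) by rewrite (subsetP nLG).
apply/cfunP => h; rewrite cfConjgE // [LHS]brauer_charE [RHS]brauer_charE.
by rewrite !p_regularE p_eltJ memJ_norm ?groupV.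
Qed.

Lemma conj_repr_irr x n (r : mx_representation F L n) (Gx : x \in G) :
  mx_irreducible r -> mx_irreducible (conj_repr r Gx).
Proof.
move=> /mx_irrP[n0 irr]; apply/mx_irrP; split=> // U modU nzU; apply: irr => //.
apply/mxmoduleP => h Lh; have := mxmoduleP modU (h ^ x)%g.
by rewrite /= conjgK; apply; rewrite memJ_norm // (subsetP nLG).
Qed.

(* A composition factor of the restriction is conjugate to phi because it is killed
   by every element of the group ring that kills all the conjugates of phi. *)
Lemma brauer_char_clifford n (rG : mx_representation F G n) : mx_irreducible rG ->
  exists2 phi : 'CF(L), IBr p theta phi &
  exists s : seq 'CF(L), 'Res[L] (brauer_char p theta rG) = \sum_(psi <- s) psi /\
    forall psi, psi \in s -> IBr p theta psi /\ exists2 x, x \in G & psi = (phi ^ x)%CF.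
Proof.
move=> irrG; pose rH := subg_repr rG sLG.
have n_gt0 : (0 < n)%N by case/mx_irrP: irrG.
have [M simM _] : {M | mxsimple rH M & (M <= (1%:M : 'M_n))%MS}.
  by apply: dec_mxsimple_exists; rewrite ?mxmodule1 // -mxrank_eq0 mxrank1 -lt0n.
have modM := mxsimple_module simM.
pose rM := submod_repr modM; have irrM : mx_irreducible rM by apply/submod_mx_irr.
have -> : 'Res[L] (brauer_char p theta rG) = brauer_char p theta rH.
  apply/cfun_inP => h Lh; rewrite cfResE // [LHS]brauer_charE [RHS]brauer_charE.
  by rewrite !p_regularE Lh (subsetP sLG).
exists (brauer_char p theta rM); first by exists _, rM.
pose Q m (r : mx_representation F L m) := forall a : gT -> F,
  \sum_(h in L) a h *: rH h = 0 -> \sum_(h in L) a h *: r h = 0.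
have [||s [sE sP]] := @brauer_char_decomp_in p F theta gT L Q _ _ rH.
- move=> m r U modU Qr; split=> a a0.
    apply: (@val_submod_inj _ _ U); rewrite val_submodE mulmx_suml.
    transitivity (\sum_(h in L) val_submod (1%:M : 'M_(\rank U)) *m (a h *: r h)).
      apply: eq_bigr => h Lh; rewrite -val_submodE -[submod_repr modU h]mul1mx.
      by rewrite linearZ /= val_submodJ // scalemxAr.
    by rewrite -mulmx_sumr Qr // mulmx0 linear0.
  transitivity (\sum_(h in L) in_factmod U (val_factmod (1%:M : 'M_(\rank (cokermx U))) *m (a h *: r h))).
    apply: eq_bigr => h Lh; rewrite -scalemxAr linearZ /= in_factmodJ //.
    by rewrite val_factmodK mul1mx.
  by rewrite -linear_sum -mulmx_sumr Qr // mulmx0 linear0.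
- by move=> a.
exists s; split=> // psi /sP[m [r [irr Qr ->]]]; split; first by exists m, r.
apply: contrapT => no.
have nsim x (Gx : x \in G) : ~ mx_rsim r (conj_repr rM Gx).
  by move=> /mx_rsim_brauer_char E; apply: no; exists x => //; rewrite E brauer_char_conj.
have [A RA [rA MA]] : exists2 A, (A \in group_ring F L)%MS & gring_op r A = 1%:M /\
    forall x (Gx : x \in G), gring_op (conj_repr rM Gx) A = 0.
  have [A RA [rA MA]] : exists2 A, (A \in group_ring F L)%MS & gring_op r A = 1%:M /\
    forall x (Gx : x \in G), x \in enum G -> gring_op (conj_repr rM Gx) A = 0.
    have sub : {subset enum G <= G} by move=> x; rewrite mem_enum.
    elim: (enum G) sub => [|x t IH] sub.
      by exists 1%:M; [exact: envelop_mx1 | rewrite gring_op1].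
    have [|A RA [rA MA]] := IH; first by move=> y ty; apply: sub; rewrite inE ty orbT.
    have Gx : x \in G by rewrite sub ?mem_head.
    have [B RB [rB MB]] := gring_separate irr (conj_repr_irr Gx irrM) (@nsim x Gx).
    exists (A *m B); first exact: envelop_mxM.
    split=> [|y Gy]; first by rewrite gring_opM // rA rB mul1mx.
    rewrite inE gring_opM // => /predU1P[yx|ty]; last by rewrite MA // mul0mx.
    by subst y; rewrite (eq_irrelevance Gy Gx) MB mulmx0.
  by exists A => //; split=> // x Gx; rewrite MA // mem_enum.
have [a AE] := envelop_mxP RA.
have opE m' (r' : mx_representation F L m') : gring_op r' A = \sum_(h in L) a h *: r' h.
  rewrite AE linear_sum; apply: eq_bigr => h Lh; rewrite linearZ /=; congr (_ *: _).
  exact: gring_opG.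
have : \sum_(h in L) a h *: r h = 0.
  apply: Qr; pose K := \sum_(h in L) a h *: rH h.
  have [X sXG [X1 _]] := Clifford_basis irrG simM.
  have : (1%:M : 'M_n) *m K = 0.
    apply/sub_kermxP; rewrite -X1; apply/sumsmx_subP => x Xx.
    have Gx := subsetP sXG x Xx.
    apply/sub_kermxP; have <- : val_submod (in_submod M M *m gring_op (conj_repr rM Gx) A) *m rG x = M *m rG x *m K.
      rewrite opE /K mulmx_sumr linear_sum mulmx_suml mulmx_sumr; apply: eq_bigr => h Lh.
      have Lhx : (h ^ x^-1)%g \in L by rewrite memJ_norm // groupV (subsetP nLG).
      rewrite -scalemxAr linearZ /= val_submodJ // in_submodK ?submx_refl // -scalemxAl -scalemxAr.
      congr (_ *: _); rewrite -!mulmxA /= -!repr_mxM // ?(subsetP sLG) //.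
      by rewrite conjgE invgK -!mulgA mulVg mulg1.
    by rewrite (MA x Gx) mulmx0 linear0 mul0mx.
  by rewrite mul1mx.
rewrite -opE rA => /eqP; rewrite -mxrank_eq0 mxrank1; case/mx_irrP: irr => m0 _.
by rewrite -leqn0 leqNgt m0.
Qed.

Notation decG := (@dec p F theta gT G).
Notation decL := (@dec p F theta gT L).
Notation ibG := (@ib p F theta gT G).
Notation ibL := (@ib p F theta gT L).
Notation bcG := (@bcoef p F theta gT G).
Notation bcL := (@bcoef p F theta gT L).

Lemma cfRes_preg_restr (chi : 'CF(G)) : 'Res[L] (preg_restr p chi) = preg_restr p ('Res[L] chi).
Proof.
apply/cfun_inP => h Lh; rewrite cfResE // !preg_restrE cfResE // !p_regularE Lh.
by rewrite (subsetP sLG).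
Qed.

Lemma cfInd_preg_restr (psi : 'CF(L)) : 'Ind[G] (preg_restr p psi) = preg_restr p ('Ind[G] psi).
Proof.
apply/cfun_inP => x Gx; rewrite preg_restrE !cfIndE // p_regularE Gx /=.
rewrite -mulrnAr -sumrMnl; congr (_ * _); apply: eq_bigr => y Gy.
rewrite preg_restrE p_regularE p_eltJ memJ_norm ?(subsetP nLG) //.
by case: (boolP (x \in L)) => // nLx; rewrite cfun0 ?mul0rn // memJ_norm // (subsetP nLG).
Qed.

Lemma bcoef_Res_nat k k' : bcL k ('Res[L] (ibG k')) \in Num.nat.
Proof.
have [n [rG [irr ->]]] := ib_IBr pcharF th k'.
have [phi _ [s [-> sP]]] := brauer_char_clifford irr.
by rewrite bcoef_sum ?rpred_nat // => psi /sP[].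
Qed.

Lemma dec_ge0 (H : {group gT}) i k : 0 <= @dec p F theta gT H i k.
Proof. exact/natr_ge0/dec_nat. Qed.

Lemma dec_Res i k : bcL k (preg_restr p ('Res[L] 'chi[G]_i)) = \sum_k' decG i k' * bcL k ('Res[L] (ibG k')).
Proof.
rewrite -cfRes_preg_restr (preg_restr_dec pcharF th) linear_sum /= linear_sum.
by apply: eq_bigr => k' _; rewrite linearZ /= linearZ.
Qed.

Lemma dec_Res_constt i k : bcL k (preg_restr p ('Res[L] 'chi[G]_i)) = \sum_j '['Res[L] 'chi_i, 'chi_j] * decL j k.
Proof.
rewrite {1}(cfun_sum_cfdot ('Res[L] 'chi_i)) !linear_sum.
by apply: eq_bigr => j _; rewrite !linearZ.
Qed.

(** The terms over the characters of [L] are nonnegative, so the nonzero one at [j] cannot cancel;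
    hence the expansion over the Brauer characters of [G] is nonzero too. *)
Lemma dec_under i j k : '['Res[L] 'chi[G]_i, 'chi_j] != 0 -> decL j k != 0 ->
  exists2 k', decG i k' != 0 & bcL k ('Res[L] (ibG k')) != 0.
Proof.
move=> ij jk; apply: contrapT => no.
have : bcL k (preg_restr p ('Res[L] 'chi[G]_i)) = 0.
  rewrite dec_Res big1 // => k' _; apply: contrapT => /eqP; rewrite mulf_eq0 negb_or => /andP[d b]; apply: no; by exists k'.
rewrite dec_Res_constt; move/eqP; rewrite psumr_eq0 => [/allP/(_ j (mem_index_enum _))|l _].
  by rewrite /= mulf_eq0 (negbTE ij) (negbTE jk).
by rewrite mulr_ge0 ?dec_ge0 // natr_ge0 // Cnat_cfdot_char_irr ?cfRes_char ?irr_char.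
Qed.

Lemma brauer_charM_char n (rG : mx_representation F G n) eta k : eta \is a character ->
  bcG k (brauer_char p theta rG * eta) \in Num.nat.
Proof.
case/char_reprP => rE ->; have [rF rFE] := preg_restr_reduction pcharF th rE.
have -> : brauer_char p theta rG * cfRepr rE = brauer_char p theta (kron_repr rG rF).
  rewrite brauer_char_kron // rFE; apply/cfunP => x; rewrite [LHS]cfunE [RHS]cfunE preg_restrE.
  case: (boolP (x \in p_regular p G)) => px //.
  by rewrite brauer_char_supp // !mul0r.
exact: brauer_char_bcoef.
Qed.

(** This replaces induction of modular representations. By Clifford's theorem all constituents of
    the restriction of [ib k'] induce to the same function, so a positive multiple of the induced
    [ib k] is [ib k'] times the induced trivial character. That product is the Brauer character of a
    tensor product, and it contains [ib k']. *)
Lemma bcoef_Ind k k' : bcL k ('Res[L] (ibG k')) != 0 ->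
  (forall l, 0 <= bcG l ('Ind[G] (ibL k))) /\ bcG k' ('Ind[G] (ibL k)) != 0.
Proof.
have [n [rG [irr kE]]] := ib_IBr pcharF th k'.
have [phi _ [s [sE sP]]] := brauer_char_clifford irr.
rewrite kE sE (bcoef_sum pcharF th) => [|psi /sP[]//]; rewrite pnatr_eq0 -lt0n -has_count has_pred1 => ks.
have IndE psi : psi \in s -> 'Ind[G] psi = 'Ind[G] (ibL k).
  have IndJ x : x \in G -> 'Ind[G] (phi ^ x)%CF = 'Ind[G] phi.
    move=> Gx; apply/cfun_inP => z Gz; rewrite !cfIndE //; congr (_ * _).
    rewrite (reindex_inj (mulIg x)) /=; apply: eq_big => [y|y Gy]; first by rewrite groupMr.
    by rewrite cfConjgE ?(subsetP nLG) // conjgM conjgK.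
  move=> /sP[_ [x Gx ->]]; have [_ [y Gy ->]] := sP _ ks.
  by rewrite !IndJ.
have E : (size s)%:R *: 'Ind[G] (ibL k) = brauer_char p theta rG * 'Ind[G, L] 1.
  rewrite mulrC -cfIndM // mul1r sE linear_sum /= big_seq (eq_bigr _ IndE) -big_seq.
  by rewrite big_const_seq count_predT iter_addr_0 scaler_nat.
have s0 : (size s)%:R != 0 :> algC.
  by rewrite pnatr_eq0; move: ks; case: (s).
have E' l : bcG l ('Ind[G] (ibL k)) = (size s)%:R^-1 * bcG l (brauer_char p theta rG * 'Ind[G, L] 1).
  by rewrite -E linearZ /= mulKf.
have N1 : 'Ind[G, L] 1 \is a character by rewrite cfInd_char ?rpred1.
split=> [l|].
  by rewrite E' mulr_ge0 ?invr_ge0 ?ler0n // natr_ge0 // brauer_charM_char.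
rewrite E' mulf_neq0 ?invr_eq0 //.
have [eta Neta ->] : exists2 eta : 'CF(G), eta \is a character & 'Ind[G, L] 1 = 1 + eta.
  have : '[ 'Ind[G, L] 1, 'chi_0] != 0.
    by rewrite irr0 -Frobenius_reciprocity cfRes_cfun1 // cfnorm1 oner_eq0.
  rewrite -irr_consttE => /(constt_charP _ N1)[eta Neta ->]; exists eta => //.
  by rewrite irr0.
rewrite mulrDr mulr1 linearD /= -kE bcoef_ib // eqxx gt_eqF // kE ltr_pwDl ?ltr01 //.
by rewrite natr_ge0 // brauer_charM_char.
Qed.

(** Inducing ['chi_j] gives a coordinate at [k'] that is a sum of nonnegative terms, nonzero at [k];
    some constituent of the induced character must supply it. Nonnegativity at [l] needs a Brauer
    character of [G] over [ib l], which [dec_under] provides. *)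
Lemma dec_over j k k' : decL j k != 0 -> bcL k ('Res[L] (ibG k')) != 0 ->
  exists2 i, '['Res[L] 'chi[G]_i, 'chi_j] != 0 & decG i k' != 0.
Proof.
move=> jk kk'; apply: contrapT => no.
have : bcG k' (preg_restr p ('Ind[G] 'chi_j)) = 0.
  rewrite (cfun_sum_cfdot ('Ind[G] 'chi_j)) !linear_sum big1 // => i _.
  rewrite !linearZ /=; apply: contrapT => /eqP; rewrite mulf_eq0 negb_or => /andP[d b]; apply: no; exists i => //.
  by rewrite cfdotC conjC_eq0 Frobenius_reciprocity.
rewrite -cfInd_preg_restr (preg_restr_dec pcharF th) !linear_sum /=.
under eq_bigr do rewrite !linearZ /=.
have [i ij] : exists i, '['Res[L] 'chi[G]_i, 'chi_j] != 0.
  have [i] := constt_cfInd_irr j sLG; rewrite irr_consttE => ?; exists i.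
  by rewrite cfdotC conjC_eq0 Frobenius_reciprocity.
move/eqP; rewrite psumr_eq0 => [/allP/(_ k (mem_index_enum _))|l _].
  by rewrite /= mulf_eq0 (negbTE jk) (negbTE (proj2 (bcoef_Ind kk'))).
case: (eqVneq (decL j l) 0) => [->|jl]; first by rewrite mul0r.
have [l' _ ll'] := dec_under ij jl.
by rewrite mulr_ge0 ?dec_ge0 //; case: (bcoef_Ind ll').
Qed.

End Clifford.

(** * Exceptional characters *)

Section SmallDifferences.
Variables (p : nat) (gT : finGroupType) (L : {group gT}).

Definition small_diff (D : 'CF(L)) :=
  [/\ D \in 'Z[irr L, L^#], '[D] <= 2 & preg_restr p D = 0].

Lemma small_diffP D i : small_diff D -> '[D, 'chi_i] != 0 ->
  exists a b, [/\ D = 'chi_a - 'chi_b, a != b, preg_restr p 'chi_a = preg_restr p 'chi_b & i = a \/ i = b].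
Proof.
case=> ZD nD rD Di; have [ZD' D1] : D \in 'Z[irr L] /\ D 1%g = 0.
  by move: ZD; rewrite zcharD1E => /andP[? /eqP].
have N2 : '[D] = 2.
  have /natrP[n nE] : '[D] \in Num.nat by rewrite natrEint cfnorm_ge0 Cint_cfdot_vchar.
  move: nD; rewrite nE ler_nat; case: n nE => [|[|[|//]]] nE //.
    by move/eqP: nE; rewrite cfnorm_eq0 => /eqP D0; rewrite D0 cfdot0l eqxx in Di.
  have [b [k Dk]] := vchar_norm1P ZD' nE.
  move/eqP: D1; rewrite Dk cfunE mulf_eq0 signr_eq0 /=.
  by rewrite (negbTE (irr1_neq0 k)).
have [a [b ba DE]] := vchar_norm2 ZD N2.
exists a, b; split=> //; first by rewrite eq_sym.
  by apply/eqP; rewrite -subr_eq0 -linearB /= -DE rD.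
move: Di; rewrite DE cfdotBl !cfdot_irr.
by case: (eqVneq a i) => [->|_]; [left | case: (eqVneq b i) => [->|_]; [right | rewrite subrr eqxx]].
Qed.

(** Each nonzero difference is ['chi_a - 'chi_b] with both terms at one vertex. If the two vertices
    were different, the four characters would be distinct and [D1 - D2] would have norm 4. *)
Lemma small_diff_connected D1 D2 i j : small_diff D1 -> small_diff D2 -> '[D1 - D2] <= 2 ->
  '[D1, 'chi_i] != 0 -> '[D2, 'chi_j] != 0 -> preg_restr p 'chi_i = preg_restr p 'chi_j.
Proof.
move=> s1 s2 n12 /(small_diffP s1)[a [b [E1 ab rab iab]]] /(small_diffP s2)[c [d [E2 cd rcd jcd]]].
have -> : preg_restr p 'chi_i = preg_restr p 'chi_a by case: iab => ->.
have -> : preg_restr p 'chi_j = preg_restr p 'chi_c by case: jcd => ->.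
apply: contrapT => ne; have nac : a != c by apply/eqP => ac; apply: ne; rewrite ac.
have nad : a != d by apply/eqP => ac; apply: ne; rewrite ac.
have nbc : b != c by apply/eqP => ac; apply: ne; rewrite rab ac.
have nbd : b != d by apply/eqP => ac; apply: ne; rewrite rab ac.
move: n12; rewrite E1 E2 cfnormB !cfdotBl !cfdotBr !cfdot_irr !eqxx.
rewrite (negbTE ab) (negbTE cd) [b == a]eq_sym [d == c]eq_sym (negbTE ab) (negbTE cd).
rewrite (negbTE nac) (negbTE nad) (negbTE nbc) (negbTE nbd).
rewrite !(subr0, sub0r, opprK, oppr0, conjC0, addr0).
by rewrite -!natrD ler_nat.
Qed.

Lemma small_diff_family (I : finType) (Phi : I -> 'CF(L)) :
  (forall a b, small_diff (Phi a - Phi b)) -> forall a b c d i j,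
  '[Phi a - Phi b, 'chi_i] != 0 -> '[Phi c - Phi d, 'chi_j] != 0 ->
  preg_restr p 'chi_i = preg_restr p 'chi_j.
Proof.
move=> sP; have n2 a b : '[Phi a - Phi b] <= 2 by case: (sP a b).
have l3 a b c i j : '[Phi a - Phi b, 'chi_i] != 0 -> '[Phi a - Phi c, 'chi_j] != 0 ->
    preg_restr p 'chi_i = preg_restr p 'chi_j.
  by apply: small_diff_connected => //; rewrite opprB addrC addrA subrK.
have sw a b i : '[Phi a - Phi b, 'chi_i] != 0 -> '[Phi b - Phi a, 'chi_i] != 0.
  by rewrite -[Phi b - _]opprB cfdotNl oppr_eq0.
move=> a b c d i j abi cdj; case: (eqVneq (Phi a) (Phi d)) => [ad|nad].
  by apply: (l3 a b c) => //; rewrite ad; exact: sw.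
(* A constituent of [Phi d - Phi a] serves as a bridge: this difference shares an index with each of
   the two given ones. *)
have [k dak] : exists k, '[Phi d - Phi a, 'chi_k] != 0.
  apply: contrapT => no; case/eqP: nad; apply/esym/eqP; rewrite -subr_eq0; apply/eqP.
  rewrite (cfun_sum_cfdot (Phi d - Phi a)) big1 // => k _.
  case: (eqVneq '[Phi d - Phi a, 'chi_k] 0) => [->|ne]; first by rewrite scale0r.
  by case: no; exists k.
rewrite (l3 a b d i k) //; last exact: sw.
by apply: (l3 d a c) => //; exact: sw.
Qed.
End SmallDifferences.

Section ExceptionalCharacters.
Variables (p : nat) (F : closedFieldType) (theta : F -> algC).
Hypothesis pcharF : p \in [pchar F].
Hypothesis th : brauer_lift theta.
Variables (gT : finGroupType) (L P Z O : {group gT}).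
Hypothesis sylP : p.-Sylow(L) P.
Hypothesis cycP : cyclic P.
Hypothesis sZP : Z \subset P.
Hypothesis oZ : #|Z| = p.
Notation C := 'C_L(Z)%G.
Hypothesis defC : O ><| P = C.
Hypothesis p'O : p^'.-group O.

Let sPL : P \subset L := pHall_sub sylP.
Let sZL : Z \subset L := subset_trans sZP sPL.
Let pP : p.-group P := pHall_pgroup sylP.
Let p_pr : prime p := pcharf_prime pcharF.
Let sCL : C \subset L := subsetIl _ _.
Let nsOC : O <| C. Proof. by case: (sdprod_context defC). Qed.
Let sPC : P \subset C. Proof. by case: (sdprod_context defC). Qed.
Let tiOP : O :&: P = 1%g. Proof. by case: (sdprod_context defC). Qed.
Let nOC : C \subset 'N(O) := normal_norm nsOC.
Let sylPC : p.-Sylow(C) P := pHall_subl sPC sCL sylP.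

Lemma mem_p'core g : g \in C -> p^'.-elt g -> g \in O.
Proof.
move=> Cg pg; rewrite (@mem_normal_Hall _ p^' O C) //.
by rewrite /pHall normal_sub // p'O /= -(index_sdprod defC) pnatNK.
Qed.

Lemma sub_p_elt_cycle x : x \in C -> p.-elt x -> x != 1%g -> Z \subset <[x]>.
Proof.
move=> Cx px x1; have [c Cc sxP] : exists2 c, c \in C & <[x]> :^ c \subset P.
  by apply: Sylow_Jsub sylPC _ px; rewrite cycle_subG.
have : Z \subset <[x]> :^ c.
  rewrite -(cardSg_cyclic cycP) // oZ cardJg.
  by have [] := pgroup_pdiv px (_ : <[x]> != 1%g); first by rewrite cycle_eq1.
rewrite -sub_conjgV; suff -> : Z :^ c^-1 = Z by [].
by apply/normP; rewrite groupV; move: Cc; apply/subsetP; rewrite (subset_trans (subsetIr _ _)) ?cent_sub.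
Qed.

Lemma coset_inj_Sylow x y : x \in P -> y \in P -> coset O x = coset O y -> x = y.
Proof.
move=> Px Py; have NP z : z \in P -> z \in 'N(O) by move=> Pz; rewrite (subsetP nOC) ?(subsetP sPC).
move=> /(rcoset_kercosetP (NP _ Px) (NP _ Py)) /rcosetP[o Oo xE].
have oE : o = (x * y^-1)%g by rewrite xE mulgK.
have : o \in O :&: P by rewrite inE Oo oE groupM ?groupV.
by rewrite tiOP => /set1gP o1; rewrite xE o1 mul1g.
Qed.

Notation infl := (cfSdprod defC).
Notation PhiI := (fun i : Iirr P => 'Ind[L] (infl 'chi_i)).

Lemma linP (i : Iirr P) : 'chi_i \is a linear_char. Proof. exact: irr_cyclic_lin. Qed.

(** Modulo [O], [y] acts on [P] as a power [k]. Invariance gives [w ^+ k = w] for a value [w] whose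
    order is divisible by [p], so [k] is 1 modulo [p] and [y] centralises [Z]. *)
Lemma infl_stab (i : Iirr P) y : i != 0 -> y \in 'N_L(Z) -> (infl 'chi_i ^ y)%CF = infl 'chi_i -> y \in C.
Proof.
move=> i0 /setIP[Ly nZy] stab; rewrite inE Ly /=.
have nCy : y \in 'N(C).
  by apply/normP; rewrite /= conjIg conjGid // -centJ (normP nZy).
have [x Px] := cyclicP cycP; have Pxx : x \in P by rewrite Px cycle_id.
have Cxy : (x ^ y)%g \in C by rewrite memJ_norm // (subsetP sPC).
have [o [u [Oo Pu xyE _]]] := mem_sdprod defC Cxy.
have [k uE] : exists k, u = (x ^+ k)%g by apply/cycleP; rewrite -Px.
set w := 'chi_i x.
have wk : w ^+ k = w.
  have := cfConjgEJ (infl 'chi_i) x nCy.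
  by rewrite stab xyE cfSdprodE // cfSdprodEr // uE lin_charX ?linP.
have w1 : w != 1.
  apply: contraNneq i0 => w1; rewrite -irr_eq1; apply/eqP/cfun_inP => z Pz.
  have [q ->] : exists q, z = (x ^+ q)%g by apply/cycleP; rewrite -Px.
  by rewrite lin_charX ?linP // -/w w1 expr1n cfun1E groupX.
have wx : w ^+ #[x] = 1 by rewrite -lin_charX ?linP // expg_order lin_char1 ?linP.
have [m prm mx] := prim_order_exists (order_gt0 x) wx.
have pm : (p %| m)%N.
  have pmg : p.-nat m by apply: pnat_dvd mx _; rewrite -/(p_elt p x) (mem_p_elt pP).
  case: (p_natP pmg) => -[|e] mE; last by rewrite mE dvdn_exp.
  by move: prm w1; rewrite mE expn0 => /prim_expr_order; rewrite expr1 => ->; rewrite eqxx.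
have kp : k = 1 %[mod p].
  have /eqP : w ^+ k == w ^+ 1 by rewrite wk expr1.
  move/eqP; rewrite (eq_prim_root_expr prm) => /eqP km.
  by rewrite -(modn_dvdm k pm) km modn_dvdm.
apply/centP => z Zz; apply/commute_sym/commgP/conjg_fixP.
have Pz := subsetP sZP z Zz.
have [q zE] : exists q, z = (x ^+ q)%g by apply/cycleP; rewrite -Px.
have NP t : t \in C -> t \in 'N(O) by move/(subsetP nOC).
have -> : (z ^ y)%g = (z ^+ k)%g.
  apply: coset_inj_Sylow; rewrite ?groupX ?(subsetP sZP) ?memJ_norm //.
  have No : o \in 'N(O) by rewrite (subsetP (normG O)).
  have Nx : x \in 'N(O) by rewrite NP // (subsetP sPC).
  have Nu : u \in 'N(O) by rewrite uE groupX.
  rewrite zE conjXg morphX ?NP // xyE morphM //= (coset_id Oo) mul1g.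
  by rewrite uE -!morphX ?groupX //= -!expgM mulnC.
rewrite -[RHS]expg1; apply/eqP; rewrite eq_expg_mod_order.
have zp : (#[z] %| p)%N by rewrite -oZ order_dvdG.
by rewrite -(modn_dvdm k zp) kp modn_dvdm.
Qed.

(** [Z] is the only subgroup of order [p] in the cyclic group generated by the p-part of [c], and
    likewise for the conjugate of [c]. *)
Lemma psing_conj_cent c y : c \in C -> c \notin O -> y \in L -> (c ^ y)%g \in C -> y \in 'N_L(Z).
Proof.
move=> Cc nOc Ly Cy; rewrite inE Ly /=.
have px : p.-elt c.`_p := p_elt_constt _ _.
have x1 : c.`_p != 1%g.
  by apply: contra nOc => /eqP/constt1P; exact: mem_p'core.
have Z1 : Z \subset <[c.`_p]> by apply: sub_p_elt_cycle; rewrite ?groupX.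
have Z2 : Z \subset <[c.`_p ^ y]>.
  apply: sub_p_elt_cycle; rewrite ?p_eltJ ?conjg_eq1 //.
  by rewrite -consttJ groupX.
have Z3 : Z :^ y \subset <[c.`_p ^ y]> by rewrite cycleJ conjSg.
apply/normP/eqP; rewrite (eq_subG_cyclic (cycle_cyclic _) Z3 Z2); exact/eqP/cardJg.
Qed.

Lemma infl_diff0 (i j : Iirr P) u : u \in O -> (infl 'chi_i - infl 'chi_j) u = 0.
Proof.
move=> Ou; rewrite -[u]mulg1 [LHS]cfunE [X in _ + X]cfunE !cfSdprodE //.
by rewrite !lin_char1 ?linP // subrr.
Qed.

(** The difference vanishes on [O], so only conjugations by ['N_L(Z)] contribute to the norm. By
    [infl_stab] each inflated character meets only its conjugates by [C], and contributes at most 1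
    after division by [#|C|]; the mixed terms enter with a minus sign. *)
Lemma cfnorm_infl_diff (i j : Iirr P) : i != 0 -> j != 0 -> '[PhiI i - PhiI j] <= 2.
Proof.
move=> i0 j0; rewrite -linearB /=; set a := infl _ - infl _.
have a0 u : u \in O -> a u = 0 by apply: infl_diff0.
pose N := 'N_L(Z)%G.
have NC y : y \in N -> y \in 'N(C).
  by case/setIP=> Ly nZy; apply/normP; rewrite /= conjIg conjGid // -centJ (normP nZy).
have IndE c : c \in C -> a c * ('Ind[L] a c)^* = a c * (#|C|%:R^-1 * \sum_(y in N) a (c ^ y)%g)^*.
  move=> Cc; case: (boolP (c \in O)) => [Oc|nOc]; first by rewrite a0 // !mul0r.
  congr (_ * (_)^*); rewrite cfIndE //; congr (_ * _).
  rewrite [RHS]big_mkcond [LHS]big_mkcond; apply: eq_bigr => y _.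
  case: (boolP (y \in N)) => [/setIP[-> //]|nN]; case: (boolP (y \in L)) => // Ly.
  apply/cfun0; apply: contra nN; exact: psing_conj_cent.
have nE : '['Ind[L] a] = #|C|%:R^-1 * \sum_(y in N) '[a, (a ^ y)%CF].
  rewrite -Frobenius_reciprocity cfdotE; congr (_ * _).
  rewrite (eq_bigr (fun c => a c * (#|C|%:R^-1 * \sum_(y in N) a (c ^ y)%g)^*)) => [|c Cc]; last first.
    by rewrite cfResE // IndE.
  rewrite [RHS](reindex_inj invg_inj) /= [RHS](eq_bigl (mem N)) => [|y]; last by rewrite /= groupV.
  under [RHS]eq_bigr => y Ny.
    rewrite cfdotE mulr_sumr.
    under eq_bigr => c Cc do rewrite cfConjgE ?groupV ?NC // invgK.
    over.
  rewrite exchange_big /=; apply: eq_bigr => c Cc.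
  rewrite rmorphM /= fmorphV /= rmorph_nat rmorph_sum /= mulrCA !mulr_sumr.
  by apply: eq_bigr => y _.
have stab (k : Iirr P) : k != 0 -> \sum_(y in N) '[infl 'chi_k, (infl 'chi_k ^ y)%CF] <= #|C|%:R.
  move=> k0; have /irrP[m mE] : infl 'chi_k \in irr C by rewrite cfSdprod_irr mem_irr.
  rewrite -sum1_card natr_sum [X in _ <= X]big_mkcond [X in X <= _]big_mkcond /=.
  apply: ler_sum => y _; case: (boolP (y \in N)) => Ny; last by case: ifP.
  rewrite mE -conjg_IirrE cfdot_irr; case: eqVneq => [E|_]; last by case: ifP.
  suff -> : y \in C by [].
  by apply: infl_stab k0 Ny _; rewrite mE -conjg_IirrE -E.
have ge0 (k l : Iirr P) y : 0 <= '[infl 'chi_k, (infl 'chi_l ^ y)%CF].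
  by rewrite natr_ge0 // Cnat_cfdot_char ?cfConjg_char // cfSdprod_char irr_char.
rewrite nE -(ler_pM2l (gt0CG C)) mulrA divff ?neq0CG // mul1r.
rewrite (le_trans (y := \sum_(y in N) '[infl 'chi_i, (infl 'chi_i ^ y)%CF] + \sum_(y in N) '[infl 'chi_j, (infl 'chi_j ^ y)%CF])) //.
  rewrite -big_split /=; apply: ler_sum => y _.
  rewrite linearB /= cfdotBl !cfdotBr opprB addrACA -[X in _ <= X]addr0 lerD2l.
  by rewrite addrC -opprD oppr_le0 addr_ge0.
by rewrite mulrDr mulr1 lerD ?stab.
Qed.

Lemma small_diff_infl (i j : Iirr P) : i != 0 -> j != 0 -> small_diff p (PhiI i - PhiI j).
Proof.
move=> i0 j0; split; last first.
- apply/cfun_inP => g Lg; rewrite preg_restrE p_regularE Lg /= [RHS]cfunE.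
  case: (boolP (p^'.-elt g)) => // pg; rewrite mulr1n -linearB /= cfIndE //.
  rewrite big1 ?mulr0 // => y Ly; case: (boolP ((g ^ y)%g \in C)) => Cgy; last exact: cfun0.
  by rewrite infl_diff0 // mem_p'core // p_eltJ.
- exact: cfnorm_infl_diff.
rewrite zcharD1E rpredB ?cfInd_vchar ?char_vchar ?cfSdprod_char ?irr_char //=.
by rewrite [X in X == _]cfunE [X in _ + X]cfunE !cfInd1 // !cfSdprod1 !lin_char1 ?linP // subrr.
Qed.

Definition exceptional (i : Iirr L) := ~ exists a, forall t, t \in psing p L -> 'chi_i t = a.

(** Off [O] the value of ['chi_l] depends only on the p-part, which is conjugate in [C] to the
    component in [P] because [C / O] is abelian. So ['chi_l] may be replaced by the inflation of its
    restriction to [P], and inflation is isometric. *)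
Lemma cfdot_infl_diff (l : Iirr L) (i j : Iirr P) : in_block p theta l ->
  '[PhiI i - PhiI j, 'chi_l] = '['chi_i - 'chi_j, 'Res[P] 'chi_l].
Proof.
move=> bl; rewrite -linearB /= -Frobenius_reciprocity -[RHS](cfSdprod_iso defC) /=.
rewrite linearB /= !cfdotE; congr (_ * _); apply: eq_bigr => c Cc.
case: (boolP (c \in O)) => [Oc|nOc]; first by rewrite infl_diff0 // !mul0r.
congr (_ * (_)^*); rewrite cfResE //.
have sec := block_section pcharF th sZL oZ nsOC p'O mem_p'core sub_p_elt_cycle bl.
rewrite sec //; have [o [x [Oo Px cE _]]] := mem_sdprod defC Cc.
rewrite [in RHS]cE cfSdprodE // cfResE //.
have Ccp : c.`_p \in C by rewrite groupX.
have [d Cd cdP] : exists2 d, d \in C & <[c.`_p]> :^ d \subset P.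
  by apply: Sylow_Jsub sylPC _ (p_elt_constt _ _); rewrite cycle_subG.
have {}cdP : (c.`_p ^ d)%g \in P by rewrite -cycle_subG cycleJ.
have abCO : abelian (C / O) by rewrite -(isog_abelian (sdprod_isog defC)) cyclic_abelian.
have Nn z : z \in C -> z \in 'N(O) by move/(subsetP nOC).
have -> : x = (c.`_p ^ d)%g; last by rewrite cfunJ // (subsetP sCL).
apply: coset_inj_Sylow => //.
rewrite morphJ ?Nn //= conjgE (centsP abCO (coset O c.`_p) _ (coset O d)) ?mem_quotient // mulKg.
have No : o \in 'N(O) by rewrite (subsetP (normG O)).
have Nx : x \in 'N(O) by rewrite Nn // (subsetP sPC).
rewrite morph_constt ?Nn // cE morphM //= (coset_id Oo) mul1g.
by rewrite -morph_constt // constt_p_elt // (mem_p_elt pP).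
Qed.

(** Otherwise all nontrivial characters of [P] have one multiplicity [b] in ['chi_l], so its
    restriction to [P] is a constant plus [b] times the regular character, constant off 1. Every
    p-singular element is conjugate into [C], where [block_section] reduces its value to one on
    [P]. *)
Lemma exceptional_infl l : in_block p theta l -> exceptional l ->
  exists i j : Iirr P, [/\ i != 0, j != 0 & '[PhiI i - PhiI j, 'chi_l] != 0].
Proof.
move=> bl exc; apply: contrapT => no; apply: exc.
pose r := 'Res[P] 'chi_l.
have eqr (i j : Iirr P) : i != 0 -> j != 0 -> '[r, 'chi_i] = '[r, 'chi_j].
  move=> i0 j0; apply/eqP; rewrite -subr_eq0 -cfdotBr cfdotC conjC_eq0 -cfdot_infl_diff //.
  by apply/negP => /negP ne; apply: no; exists i, j.
have [b bE] : exists b, forall i : Iirr P, i != 0 -> '[r, 'chi_i] = b.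
  case: (pickP (fun i : Iirr P => i != 0)) => [i0 ni0|none].
    by exists '[r, 'chi_i0] => i ni; apply: eqr.
  by exists 0 => i; rewrite none.
have rE x : x \in P -> x != 1%g -> 'chi_l x = '[r, 'chi_0] - b.
  move=> Px x1; rewrite -(cfResE 'chi_l sPL Px) -/r [in LHS](cfun_sum_cfdot r) (bigD1 0) //=.
  rewrite (eq_bigr (fun i => b *: 'chi_i)) => [|i i0]; last by rewrite bE.
  rewrite -scaler_sumr; have -> : \sum_(i : Iirr P | i != 0) 'chi_i = cfReg P - 1.
    rewrite cfReg_sum [X in _ = X - 1](bigD1 0) //= irr0 cfun11 scale1r addrC addrK.
    by apply: eq_bigr => i _; rewrite lin_char1 ?linP // scale1r.
  rewrite irr0 !cfunE cfuniE ?normal1 // inE (negbTE x1) cfun1E Px.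
  by rewrite /= !(mulr1, mulr0, sub0r, mulrN, mulr1n, mulr0n).
exists ('[r, 'chi_0] - b) => t; rewrite inE => /andP[Lt pt].
have t1 : t.`_p != 1%g by apply: contra pt => /eqP/constt1P.
have [g Lg tgP] : exists2 g, g \in L & <[t.`_p]> :^ g \subset P.
  by apply: Sylow_Jsub sylP _ (p_elt_constt _ _); rewrite cycle_subG groupX.
have {}tgP : (t.`_p ^ g)%g \in P by rewrite -cycle_subG cycleJ.
have tg1 : (t.`_p ^ g)%g != 1%g by rewrite conjg_eq1.
have sZt : Z \subset <[t.`_p ^ g]>.
  by apply: sub_p_elt_cycle; rewrite ?(subsetP sPC) ?p_eltJ ?p_elt_constt.
have Ct : (t ^ g)%g \in C.
  rewrite inE groupJ //= -sub_cent1 (subset_trans sZt) // cycle_subG -consttJ.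
  by rewrite groupX ?cent1id.
have nO : (t ^ g)%g \notin O.
  by apply: contra pt => Ot; rewrite -(p_eltJ _ _ g) (mem_p_elt p'O).
have sec := block_section pcharF th sZL oZ nsOC p'O mem_p'core sub_p_elt_cycle bl.
by rewrite -(cfunJ 'chi_l _ Lg) // sec // consttJ rE.
Qed.

Lemma exceptional_preg_restr l m : in_block p theta l -> in_block p theta m ->
  exceptional l -> exceptional m -> preg_restr p 'chi_l = preg_restr p 'chi_m.
Proof.
move=> bl bm /(exceptional_infl bl)[a [b [a0 b0 ab]]] /(exceptional_infl bm)[c [d [c0 d0 cd]]].
pose Phi (i : {i : Iirr P | i != 0}) := PhiI (val i).
have sP i j : small_diff p (Phi i - Phi j) by exact: small_diff_infl (valP i) (valP j).
exact: (small_diff_family sP (a := exist _ a a0) (b := exist _ b b0) (c := exist _ c c0) (d := exist _ d d0)).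
Qed.
End ExceptionalCharacters.

(** * Star blocks *)

Section StarBlock.
Variables (p : nat) (F : closedFieldType) (theta : F -> algC).
Hypothesis pcharF : p \in [pchar F].
Hypothesis th : brauer_lift theta.
Variables (gT : finGroupType) (G : {group gT}).
Notation dec := (@dec p F theta gT G).
Notation ib := (@ib p F theta gT G).
Notation linked := (@linked p F theta gT G).
Notation in_block := (@in_block p F theta gT G).
Notation pr i := (preg_restr p ('chi[G]_i)).

Lemma trivial_ib : exists k, pr 0 = ib k.
Proof.
apply: (IBr_ib pcharF th).
have repr1 : mx_repr G (fun _ : gT => 1%:M : 'M[F]_1) by split=> // x y _ _; rewrite mul1mx.
exists 1%N, (MxRepresentation repr1); split.
  apply/mx_irrP; split=> // U _ nzU; rewrite /row_full eqn_leq rank_leq_row /=.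
  by rewrite lt0n mxrank_eq0.
apply/cfun_inP => x Gx; rewrite preg_restrE irr0 cfun1E Gx.
case: (boolP (x \in p_regular p G)) => px; last by rewrite brauer_char_supp.
rewrite (brauer_char_roots theta (s := [:: 1]) px) ?big_seq1 ?theta1 //.
by rewrite /char_poly /char_poly_mx map_mx1 -raddfB det_scalar polyC1.
Qed.

Lemma dec_pr i j k : pr i = pr j -> dec i k = dec j k.
Proof. by rewrite !decE => ->. Qed.

Lemma preg_restr1 i : pr i 1%g = 'chi_i 1%g.
Proof. by rewrite preg_restrE p_regularE group1 /p_elt order1. Qed.

Lemma linked_refl i : linked i i.
Proof.
apply: contrapT => nl; have /eqP := preg_restr1 i.
rewrite (preg_restr_dec pcharF th) big1 => [|k _]; first by rewrite cfunE eq_sym (negbTE (irr1_neq0 i)).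
case: (eqVneq (dec i k) 0) => [->|ne]; first by rewrite scale0r.
by case: nl; apply/linkedP; exists k.
Qed.

Lemma linked_pr i j : pr i = pr j -> linked i j.
Proof.
move=> E; have /linkedP[k d _] := linked_refl i.
by apply/linkedP; exists k => //; rewrite -(dec_pr k E).
Qed.

Definition star_at c :=
  [/\ in_block c, forall i, in_block i -> linked i c
    & forall i j, in_block i -> in_block j -> linked i j ->
      [\/ pr i = pr j, pr i = pr c | pr j = pr c]].

Definition star_block := exists c, star_at c.

(** [x] is rational and an algebraic integer, so the equation is one between integers. *)
Lemma nat_mul_aint (d x : algC) : d \in Num.nat -> x \in Aint -> d * x = -1 -> d = 1 /\ x = -1.
Proof.
move=> /natrP[n ->] Ax nx; have n0 : n%:R != 0 :> algC.
  by apply: contra_eqN nx => /eqP->; rewrite mul0r eq_sym oppr_eq0 oner_eq0.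
have xE : x = - n%:R^-1 by apply: (mulfI n0); rewrite nx mulrN divff.
have /intrP[m mE] : x \in Num.int.
  by rewrite Cint_rat_Aint // xE rpredN rpredV rpred_nat.
have : (n%:Z * m = -1)%R.
  by apply: (@intr_inj algC); rewrite intrM -mE -pmulrn nx mulrN1z.
move/(congr1 absz); rewrite abszM abszN1 absz_nat => /eqP; rewrite muln_eq1 => /andP[/eqP n1 _].
by move: nx; rewrite n1 mul1r.
Qed.

Variable t0 : gT.
Hypothesis t0P : t0 \in psing p G.
Hypothesis pr_inj0 : forall i, pr i = pr 0 -> i = 0.

Lemma dec_psing k t : t \in psing p G -> \sum_i dec i k * 'chi_i t = 0.
Proof. by rewrite inE => /andP[Gt pt]; exact: dec_p_singular. Qed.

(** If the trivial character is a centre, every member of the block contains the trivial Brauer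
    character, so all are linked and there are at most two vertices. The column relation at [t0]
    yields a second vertex, and this can be the centre as well. *)
Lemma star_center_neq0 : star_block -> exists2 c, star_at c & c != 0.
Proof.
case=> c sc; case: (eqVneq c 0) => [c0|]; last by exists c.
subst c; have [k0 k0E] := trivial_ib.
have dec0 k : dec 0 k = (k0 == k)%:R by rewrite decE k0E (bcoef_ib pcharF th).
have [j j0 dj] : exists2 j, j != 0 & dec j k0 != 0.
  apply: contrapT => no; have := dec_psing k0 t0P.
  rewrite (bigD1 0) //= dec0 eqxx mul1r irr0 [X in _ + X]big1 => [|j j0].
    by move: t0P; rewrite cfun1E inE => /andP[-> _] /eqP; rewrite addr0 oner_eq0.
  case: (eqVneq (dec j k0) 0) => [->|ne]; first by rewrite mul0r.
  by case: no; exists j.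
case: sc => b0 l0 s0; have k0i i : in_block i -> dec i k0 != 0.
  by move=> /l0/linkedP[k di]; rewrite dec0 pnatr_eq0 eqb0 negbK => /eqP->.
have bj : in_block j.
  by apply: (in_block_linked b0); apply/linkedP; exists k0 => //; exact: k0i.
have npj : pr j <> pr 0 by move/pr_inj0/eqP; rewrite (negbTE j0).
exists j => //; split=> // [i bi|i i' bi bi' lii'].
  by apply/linkedP; exists k0; rewrite ?k0i //.
have lkd a b : in_block a -> in_block b -> linked a b.
  by move=> ba bb; apply/linkedP; exists k0; rewrite ?k0i //.
have [|/pr_inj0 i0|/pr_inj0 i0] := s0 i i' bi bi' lii'; first by constructor 1.
  subst i; have [||] := s0 i' j bi' bj (lkd _ _ bi' bj); first by constructor 3.
    by move->; constructor 1.
  by move/npj.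
subst i'; have [||] := s0 i j bi bj (lkd _ _ bi bj); first by constructor 2.
  by move->; constructor 1.
by move/npj.
Qed.

Variable c : Iirr G.
Hypothesis sc : star_at c.
Hypothesis c0 : c != 0.

Definition vertex_sum i := \sum_(j | pr j == pr i) 'chi[G]_j.

Lemma in_block_pr i j : in_block i -> pr i = pr j -> in_block j.
Proof. by move=> bi /linked_pr; exact: in_block_linked. Qed.

Lemma center_neq_trivial : pr c <> pr 0.
Proof. by move/pr_inj0/eqP; rewrite (negbTE c0). Qed.

Lemma trivial_vertex k0 : pr 0 = ib k0 -> forall i, (dec i k0 != 0) = (i == 0) || (pr i == pr c).
Proof.
move=> k0E; have [bc lc st] := sc.
have dec0 k : dec 0 k = (k0 == k)%:R by rewrite decE k0E (bcoef_ib pcharF th).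
have dc : dec c k0 != 0.
  have /linkedP[k d0 dck] := lc 0 (in_block0 p theta G); move: d0.
  by rewrite dec0 pnatr_eq0 eqb0 negbK => /eqP->.
move=> i; apply/idP/orP => [di|[/eqP->|/eqP E]]; last 2 first.
- by rewrite dec0 eqxx oner_eq0.
- by rewrite (dec_pr k0 E).
have l0 : linked 0 i by apply/linkedP; exists k0; rewrite // dec0 eqxx oner_eq0.
have bi := in_block_linked (in_block0 p theta G) l0.
have [E|E|E] := st 0 i (in_block0 _ _ _) bi l0.
- by left; apply/eqP/pr_inj0.
- by case: center_neq_trivial.
- by right; apply/eqP.
Qed.

(** The trivial Brauer character occurs once in ['chi_0] and otherwise only at the vertex of [c].
    Its column relation is [1 + d * x = 0] with [d] natural and [x] an algebraic integer. *)
Lemma center_sum t : t \in psing p G -> vertex_sum c t = -1.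
Proof.
move=> Xt; have [k0 k0E] := trivial_ib; have tv := trivial_vertex k0E.
have := dec_psing k0 Xt; rewrite (bigID (fun i => dec i k0 != 0)) /= [X in _ + X]big1 ?addr0 => [|i]; last first.
  by rewrite negbK => /eqP->; rewrite mul0r.
rewrite (eq_bigl _ _ tv) (bigD1 0) ?eqxx //= decE k0E (bcoef_ib pcharF th) eqxx mul1r irr0.
have Gt : t \in G by move: Xt; rewrite inE => /andP[].
rewrite cfun1E Gt (eq_bigl (fun i => pr i == pr c)) => [|i]; last first.
  case: (eqVneq i 0) => [->|]; rewrite ?andbT //=.
  by apply/esym/negbTE/eqP => E; case: center_neq_trivial.
rewrite (eq_bigr (fun i => dec c k0 * 'chi_i t)) => [|i /eqP E]; last by rewrite (dec_pr k0 E).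
rewrite -mulr_sumr -sum_cfunE => /eqP; rewrite addrC addr_eq0 => /eqP /nat_mul_aint[] //.
  exact: dec_nat.
by rewrite sum_cfunE rpred_sum // => i _; apply: Aint_irr.
Qed.

Lemma leaf_constituent i k : in_block i -> pr i <> pr c -> dec i k != 0 -> forall j, dec j k != 0 -> pr j = pr i \/ pr j = pr c.
Proof.
move=> bi ic dik j djk; have [_ _ st] := sc.
have l : linked i j by apply/linkedP; exists k.
have [->|//|->] := st i j bi (in_block_linked bi l) l; by [left | right].
Qed.

(** Column [k] is supported on the vertices of [i] and [c], and the sum over the latter is -1. *)
Lemma leaf_relation i k t : in_block i -> pr i <> pr c -> dec i k != 0 -> t \in psing p G ->
  dec i k * vertex_sum i t = dec c k.
Proof.
move=> bi ic dik Xt; have := dec_psing k Xt.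
rewrite (bigID (fun j => pr j == pr i)) /= [X in _ + X](bigID (fun j => pr j == pr c)) /=.
rewrite [X in _ + (_ + X)]big1 ?addr0 => [|j /andP[ji jc]]; last first.
  case: (eqVneq (dec j k) 0) => [->|djk]; first by rewrite mul0r.
  by case: (leaf_constituent bi ic dik djk) => E; rewrite E eqxx in ji jc.
rewrite (eq_bigr (fun j => dec i k * 'chi_j t)) => [|j /eqP E]; last by rewrite (dec_pr k E).
rewrite [X in _ + X](eq_bigr (fun j => dec c k * 'chi_j t)) => [|j /andP[_ /eqP E]]; last by rewrite (dec_pr k E).
have E : \sum_(j | (pr j != pr i) && (pr j == pr c)) 'chi_j = vertex_sum c.
  apply: eq_bigl => j; case: (eqVneq (pr j) (pr c)) => [->|]; rewrite ?andbF // andbT.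
  by apply/eqP => E; apply: ic.
rewrite -!mulr_sumr -!sum_cfunE E.
by rewrite (center_sum Xt) mulrN1 => /eqP; rewrite subr_eq0 => /eqP.
Qed.

Lemma leaf_sum i : in_block i -> pr i <> pr c -> exists a, forall t, t \in psing p G -> vertex_sum i t = a.
Proof.
move=> bi ic; have [_ lc _] := sc; have /linkedP[k di dc] := lc i bi.
exists (dec c k / dec i k) => t Xt.
by rewrite -(leaf_relation bi ic di Xt) mulrAC divff ?mul1r.
Qed.

(** One constituent shared with [c] already makes the sum over the leaf nonzero at [t0];
    [leaf_relation] then gives all the others. *)
Lemma leaf_center i k : in_block i -> pr i <> pr c -> dec i k != 0 -> dec c k != 0.
Proof.
move=> bi ic dik; have [_ lc _] := sc; have /linkedP[l dil dcl] := lc i bi.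
rewrite -(leaf_relation bi ic dik t0P) mulf_neq0 //.
by apply: contraNneq dcl => E; rewrite -(leaf_relation bi ic dil t0P) E mulr0.
Qed.

End StarBlock.

Lemma in_block_ind p (F : closedFieldType) (theta : F -> algC) (gT : finGroupType) (G : {group gT})
    (Q : Iirr G -> Prop) : Q 0 ->
  (forall i j, in_block p theta i -> linked p theta i j -> Q i -> Q j) ->
  forall i, in_block p theta i -> Q i.
Proof.
move=> Q0 Qs i /connectP[s]; elim/last_ind: s i => [|s j IH] i; first by move=> _ ->.
rewrite rcons_path last_rcons => /andP[ps lj] ->; have Ql := IH _ ps (erefl _).
by apply: Qs lj Ql; apply/connectP; exists s.
Qed.

Section ClassConstants.
Variables (p : nat) (gT : finGroupType) (L : {group gT}).

Definition psing_const (f : 'CF(L)) := exists a, forall t, t \in psing p L -> f t = a.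

Lemma psing_const_sum (I : Type) (r : seq I) (P : pred I) (f : I -> 'CF(L)) :
  (forall i, P i -> psing_const (f i)) -> psing_const (\sum_(i <- r | P i) f i).
Proof.
move=> cf; apply: (big_ind psing_const) => //; first by exists 0 => t _; rewrite cfunE.
by move=> u v [a ua] [b vb]; exists (a + b) => t Xt; rewrite cfunE ua ?vb.
Qed.

Lemma psing_constZ a f : psing_const f -> psing_const (a *: f).
Proof. by case=> b fb; exists (a * b) => t Xt; rewrite cfunE fb. Qed.

Lemma psing_constB f g : psing_const f -> psing_const g -> psing_const (f - g).
Proof. by move=> [a fa] [b gb]; exists (a - b) => t Xt; rewrite [LHS]cfunE [X in _ + X]cfunE fa ?gb. Qed.

(** [f] is [a] times the indicator of the p-singular elements, and its mean is 0. *)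
Lemma psing_const0 f t0 : t0 \in psing p L ->
  preg_restr p f = 0 -> '[f, 1] = 0 -> psing_const f -> f = 0.
Proof.
move=> Xt0 rf f1 [a fa].
have f0 x : x \in L -> x \notin psing p L -> f x = 0.
  move=> Lx nX; have /cfunP/(_ x) := rf; rewrite [RHS]cfunE preg_restrE p_regularE Lx.
  by move: nX; rewrite inE Lx negbK => ->.
have a0 : a = 0.
  move/eqP: f1; rewrite cfdotE mulf_eq0 invr_eq0 (negbTE (neq0CG _)) /=.
  rewrite (bigID (mem (psing p L))) /= [X in _ + X]big1 ?addr0 => [|x /andP[Lx nX]]; last by rewrite f0 // mul0r.
  rewrite (eq_bigr (fun=> a)) => [|x /andP[Lx Xx]]; last by rewrite fa // cfun1E Lx rmorph1 mulr1.
  rewrite sumr_const -mulr_natr mulf_eq0 => /orP[/eqP//|].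
  have Lt0 : t0 \in L by move: Xt0; rewrite inE => /andP[].
  by rewrite pnatr_eq0 (cardD1 t0) unfold_in /= Lt0 Xt0.
apply/cfun_inP => x Lx; rewrite cfunE; case: (boolP (x \in psing p L)) => [/fa->//|]; exact: f0.
Qed.
End ClassConstants.

(** * Characters trivial on a simple normal subgroup of index prime to [p] *)

Section TrivialVertex.
Variables (p : nat) (gT : finGroupType) (G L : {group gT}).
Hypothesis nsLG : L <| G.
Hypothesis p'ind : p^'.-nat #|G : L|.
Hypothesis simL : simple L.
Hypothesis not_pL : ~~ p.-group L.

Lemma simple_sub_cfker (i : Iirr G) :
  (forall x, x \in p_regular p L -> 'chi_i x = 'chi_i 1%g) -> L \subset cfker 'chi_i.
Proof.
move=> ix; have [x0 [Lx0 x1 px]] : exists x, [/\ x \in L, x != 1%g & p^'.-elt x].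
  apply: contrapT => no; case/negP: not_pL; apply/pgroupP => q q_pr /(Cauchy q_pr)[x Lx xq].
  rewrite inE; apply: contrapT => /negP nqp; apply: no; exists x; split=> //.
    by rewrite -order_gt1 xq prime_gt1.
  by rewrite /p_elt xq pnatE.
have [_ sL] := simpleP _ simL.
have nK : [group of L :&: cfker 'chi_i] <| L := normalGI (normal_sub nsLG) (cfker_normal _).
have [/= K1|/= <-] := sL _ nK; last exact: subsetIr.
have : x0 \in L :&: cfker 'chi_i.
  by rewrite inE Lx0 cfkerEirr inE; apply/eqP/ix; rewrite p_regularE Lx0.
by rewrite K1 inE (negbTE x1).
Qed.

(** The kernel contains the p-regular elements, hence [L] by simplicity, hence all p-parts because
    the index of [L] is prime to [p]. *)
Lemma preg_restr_trivial (i : Iirr G) : preg_restr p 'chi_i = preg_restr p 'chi_0 -> i = 0.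
Proof.
move=> E; have sLG := normal_sub nsLG.
have i1 x : x \in G -> p^'.-elt x -> 'chi_i x = 1.
  move=> Gx px; have /cfunP/(_ x) := E; rewrite !preg_restrE p_regularE Gx px /= !mulr1n => ->.
  by rewrite irr0 cfun1E Gx.
have i11 : 'chi_i 1%g = 1 by rewrite i1 // /p_elt order1.
have sLK : L \subset cfker 'chi_i.
  apply: simple_sub_cfker => x; rewrite p_regularE => /andP[Lx px].
  by rewrite i11 i1 ?(subsetP sLG).
have sGK : G \subset cfker 'chi_i.
  apply/subsetP => g Gg; rewrite -(consttC p g) groupM //; last first.
    by rewrite /= cfkerEirr inE i11 i1 ?groupX ?p_elt_constt.
  apply: (subsetP sLK); have nLg : g.`_p \in 'N(L) by rewrite (subsetP (normal_norm nsLG)) ?groupX.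
  apply: coset_idr => //; apply/eqP; rewrite -order_eq1 -dvdn1.
  have p1 : p.-nat #[coset L g.`_p] by apply: (morph_p_elt (coset_morphism L)); rewrite ?p_elt_constt.
  have p2 : p^'.-nat #[coset L g.`_p].
    have Gc : coset L g.`_p \in (G / L)%G by rewrite mem_quotient ?groupX.
    by rewrite (pnat_dvd (order_dvdG Gc)) // card_quotient ?normal_norm.
  by rewrite (pnat_1 p1 p2).
apply: irr_inj; rewrite irr0; apply/cfun_inP => g Gg; rewrite cfun1E Gg.
by have := subsetP sGK g Gg; rewrite cfkerEirr inE i11 => /eqP.
Qed.

Lemma under_trivial (i i' : Iirr G) : '['Res[L] 'chi_i, 1] != 0 ->
  preg_restr p 'chi_i = preg_restr p 'chi_i' -> L \subset cfker 'chi_i'.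
Proof.
move=> i1 E; have sLG := normal_sub nsLG.
have RE : 'Res[L] 'chi_i = ('['Res[L] 'chi_i, 1])%:A.
  have := @Clifford_Res_sum_cfclass _ G L i 0 nsLG.
  by rewrite irr_consttE irr0 => /(_ i1) {1}->; rewrite cfclass1 // big_seq1.
have ix x : x \in L -> 'chi_i x = 'chi_i 1%g.
  by move=> Lx; rewrite -(cfResE 'chi_i sLG Lx) -(cfResE 'chi_i sLG (group1 L)) RE !cfunE !cfun1E Lx group1.
apply: simple_sub_cfker => x; rewrite p_regularE => /andP[Lx px].
have e z : z \in L -> p^'.-elt z -> 'chi_i' z = 'chi_i z.
  move=> Lz pz; have /cfunP/(_ z) := E.
  by rewrite !preg_restrE p_regularE (subsetP sLG) // pz !mulr1n.
by rewrite !e ?group1 // ?ix // /p_elt order1.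
Qed.
End TrivialVertex.

(** * Descent of the star to a normal subgroup *)

Section StarNormal.
Variables (p : nat) (F : closedFieldType) (theta : F -> algC).
Hypothesis pcharF : p \in [pchar F].
Hypothesis th : brauer_lift theta.
Variables (gT : finGroupType) (G L : {group gT}).
Hypothesis nsLG : L <| G.
Hypothesis p'ind : p^'.-nat #|G : L|.
Hypothesis simL : simple L.
Hypothesis not_pL : ~~ p.-group L.
Variable t0 : gT.
Hypothesis Xt0 : t0 \in psing p L.
Hypothesis exc_eq : forall l m : Iirr L, in_block p theta l -> in_block p theta m ->
  exceptional p l -> exceptional p m -> preg_restr p 'chi_l = preg_restr p 'chi_m.

Let sLG : L \subset G := normal_sub nsLG.
Notation decG := (@dec p F theta gT G).
Notation decL := (@dec p F theta gT L).
Notation ibG := (@ib p F theta gT G).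
Notation ibL := (@ib p F theta gT L).
Notation bcG := (@bcoef p F theta gT G).
Notation bcL := (@bcoef p F theta gT L).
Notation prG i := (preg_restr p ('chi[G]_i)).
Notation prL j := (preg_restr p ('chi[L]_j)).
Notation under i j := ('['Res[L] 'chi[G]_i, 'chi[L]_j] != 0).

Let XLG t : t \in psing p L -> t \in psing p G.
Proof. by rewrite !inE => /andP[/(subsetP sLG)-> ->]. Qed.

Lemma under_class i j : under i j ->
  'Res[L] 'chi[G]_i = '['Res[L] 'chi_i, 'chi_j] *: (\sum_(xi <- ('chi_j ^: G)%CF) xi).
Proof. by move=> ij; apply: Clifford_Res_sum_cfclass. Qed.

Lemma under_conj i j j' : under i j -> under i j' -> exists2 y, y \in G & 'chi_j' = ('chi_j ^ y)%CF.
Proof.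
move=> ij ij'; apply/cfclassP; apply: contraNT ij' => nc.
rewrite (under_class ij) cfdotZl cfdot_suml big_seq big1 ?mulr0 // => xi /cfclassP[y Gy xiE].
rewrite xiE -conjg_IirrE cfdot_irr; case: eqP => // E; case/negP: nc.
by apply/cfclassP; exists y => //; rewrite -conjg_IirrE E.
Qed.

Lemma conj_under i j j' y : under i j -> y \in G -> 'chi_j' = ('chi_j ^ y)%CF -> under i j'.
Proof. by move=> ij Gy ->; rewrite cfdot_Res_conjg. Qed.

Lemma conj_psing (j j' : Iirr L) y a : y \in G -> 'chi_j' = ('chi_j ^ y)%CF ->
  (forall t, t \in psing p L -> 'chi_j t = a) -> forall t, t \in psing p L -> 'chi_j' t = a.
Proof.
move=> Gy -> ja t; rewrite inE => /andP[Lt pt].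
have nLy : y \in 'N(L) by rewrite (subsetP (normal_norm nsLG)).
rewrite cfConjgE // ja // inE p_eltJ pt andbT memJ_norm ?groupV //.
Qed.

Lemma under_ge0 i j : 0 <= '['Res[L] 'chi[G]_i, 'chi_j].
Proof. by rewrite natr_ge0 // Cnat_cfdot_char_irr ?cfRes_char ?irr_char. Qed.

Lemma under_const i : (forall j, under i j -> psing_const p ('chi[L]_j)) -> psing_const p ('Res[L] 'chi[G]_i).
Proof.
move=> ci; rewrite (cfun_sum_cfdot ('Res[L] 'chi_i)); apply: psing_const_sum => j _.
case: (eqVneq '['Res[L] 'chi_i, 'chi_j] 0) => [->|ne]; last exact/psing_constZ/ci.
by exists 0 => t _; rewrite scale0r cfunE.
Qed.

Lemma under_const_conj i j j' : under i j -> psing_const p ('chi[L]_j) -> under i j' -> psing_const p ('chi[L]_j').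
Proof. by move=> ij [a ja] ij'; have [y Gy E] := under_conj ij ij'; exists a; exact: conj_psing Gy E ja. Qed.

(* The restrictions that are not constant on p-singular elements would otherwise sum
   to a multiple of a constant one, hence have its constituents. *)
Lemma vertex_res i0 i1 j : psing_const p ('Res[L] (vertex_sum p i0)) ->
  (forall i, prG i = prG i0 -> '['Res[L] 'chi_i, 1] = 0) ->
  prG i1 = prG i0 -> under i1 j -> psing_const p ('chi[L]_j) ->
  forall i, prG i = prG i0 -> 'Res[L] 'chi_i = 'Res[L] 'chi_i1.
Proof.
move=> cW no1 E1 ij cj.
have c1 : psing_const p ('Res[L] 'chi_i1) by apply: under_const => l; apply: under_const_conj ij cj.
have prE i : prG i = prG i0 -> preg_restr p ('Res[L] 'chi_i) = preg_restr p ('Res[L] 'chi_i1).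
  by move=> E; rewrite -!(cfRes_preg_restr p nsLG) E E1.
have cE i : prG i = prG i0 -> psing_const p ('Res[L] 'chi_i) -> 'Res[L] 'chi_i = 'Res[L] 'chi_i1.
  move=> E ci; apply/eqP; rewrite -subr_eq0; apply/eqP; apply: (psing_const0 Xt0).
  - by rewrite linearB /= prE // subrr.
  - by rewrite cfdotBl !no1 // subrr.
  - exact: psing_constB.
move=> i E; apply: cE => //; apply: contrapT => nci.
pose isB k := (prG k == prG i0) && ~~ `[< psing_const p ('Res[L] 'chi_k) >].
have iB : isB i by rewrite /isB E eqxx; apply/asboolPn.
have BE : \sum_(k | isB k) 'Res[L] 'chi_k = \sum_(k | isB k) 'Res[L] 'chi_i1.
  apply/eqP; rewrite -subr_eq0 -sumrB; apply/eqP; apply: (psing_const0 Xt0).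
  - by rewrite linear_sum big1 // => k /andP[/eqP Ek _]; rewrite linearB /= prE // subrr.
  - by rewrite cfdot_suml big1 // => k /andP[/eqP Ek _]; rewrite cfdotBl !no1 // subrr.
  rewrite sumrB; apply: psing_constB; last by apply: psing_const_sum.
  move: cW; rewrite linear_sum (bigID (fun k => `[< psing_const p ('Res[L] 'chi_k) >])) /= => cW.
  rewrite -[X in psing_const p X](addKr (\sum_(k | (prG k == prG i0) && `[< psing_const p ('Res[L] 'chi_k) >]) 'Res[L] 'chi_k)).
  rewrite addrC; apply: psing_constB cW _.
  by apply: psing_const_sum => k /andP[_ /asboolP].
apply: nci; apply: under_const => l il; apply: (under_const_conj ij cj).
have : '[\sum_(k | isB k) 'Res[L] 'chi_k, 'chi_l] != 0.
  rewrite (bigD1 i) //= cfdotDl gt_eqF // ltr_pwDl //; first by rewrite lt_def il under_ge0.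
  by rewrite cfdot_suml sumr_ge0 // => k _; exact: under_ge0.
by rewrite BE; apply: contraNneq => l0; rewrite cfdot_suml big1.
Qed.

Lemma preg_restr_conj y (j j' : Iirr L) : y \in G -> 'chi_j' = ('chi_j ^ y)%CF -> prL j' = (prL j ^ y)%CF.
Proof.
move=> Gy ->; have nLy : y \in 'N(L) by rewrite (subsetP (normal_norm nsLG)).
apply/cfun_inP => x Lx; rewrite [RHS]cfConjgE // !preg_restrE cfConjgE // !p_regularE p_eltJ.
by rewrite memJ_norm ?groupV.
Qed.

Lemma conj_ib y : y \in G -> exists h : 'I_(size (ibr p theta L)) -> 'I_(size (ibr p theta L)),
  injective h /\ forall j j' : Iirr L, 'chi_j' = ('chi_j ^ y)%CF -> forall k, decL j' (h k) = decL j k.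
Proof.
move=> Gy; have /choice[h hE] k : exists k', ibL k' = (ibL k ^ y)%CF.
  have [n [r [irr ->]]] := ib_IBr pcharF th k.
  have [|k' E] := @IBr_ib p F theta pcharF th gT L (brauer_char p theta r ^ y)%CF; last by exists k'.
  by exists n, (conj_repr nsLG r Gy); rewrite brauer_char_conj; split=> //; exact: conj_repr_irr.
have hinj : injective h.
  move=> k l hkl; apply: (ib_inj pcharF th (G := L)).
  by apply: (can_inj (cfConjgK y)); rewrite -!hE hkl.
exists h; split=> // j j' E k.
rewrite decE (preg_restr_conj Gy E) (preg_restr_dec pcharF th) !linear_sum /= (bigD1 k) //= big1 ?addr0.
  by rewrite !linearZ /= -hE (bcoef_ib pcharF th) eqxx mulr1.
move=> l lk; rewrite !linearZ /= -hE (bcoef_ib pcharF th) (inj_eq hinj) (negbTE lk) mulr0.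
by [].
Qed.

Lemma block_conj y (j j' : Iirr L) : y \in G -> in_block p theta j -> 'chi_j' = ('chi_j ^ y)%CF -> in_block p theta j'.
Proof.
move=> Gy bj E; have -> : j' = conjg_Iirr j y by apply: irr_inj; rewrite conjg_IirrE.
move: j bj {E}; apply: in_block_ind => [|i j _ /linkedP[k di dj]]; first by rewrite conjg_Iirr0 in_block0.
move/in_block_linked; apply; have [h [_ hE]] := conj_ib Gy.
by apply/linkedP; exists (h k); rewrite (hE _ _ (conjg_IirrE _ _)).
Qed.

(** Induction along links: [dec_under] lifts the shared constituent to [G], and [dec_over] finds a
    character of [G] that contains the lift and lies over the next character. *)
Lemma block_over j : in_block p theta j -> exists2 i, in_block p theta i & under i j.
Proof.
move: j; apply: in_block_ind => [|j j' _ /linkedP[k dj dj'] [i bi ij]].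
  by exists 0; rewrite ?in_block0 // !irr0 rmorph1 cfnorm1 oner_eq0.
have [k' dk' rk'] := dec_under pcharF th nsLG ij dj.
have [i' ij' di'] := dec_over pcharF th nsLG dj' rk'.
by exists i' => //; apply: in_block_linked bi _; apply/linkedP; exists k'.
Qed.

Lemma under_value i j a t : under i j -> (forall t, t \in psing p L -> 'chi[L]_j t = a) ->
  t \in psing p L -> 'Res[L] 'chi[G]_i t = '['Res[L] 'chi_i, 'chi_j] * ((size ('chi_j ^: G)%CF)%:R * a).
Proof.
move=> ij ja Xt; rewrite {1}(under_class ij) cfunE; congr (_ * _).
rewrite sum_cfunE big_seq (eq_bigr (fun=> a)) => [|xi /cfclassP[y Gy xiE]]; last first.
  by rewrite xiE -conjg_IirrE (conj_psing Gy (conjg_IirrE j y) ja).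
by rewrite -big_seq big_const_seq count_predT iter_addr_0 mulr_natl.
Qed.

Lemma star_normal : star_block p theta G -> star_block p theta L.
Proof.
have XG0 := XLG Xt0; have inj0 := preg_restr_trivial nsLG p'ind simL not_pL.
case/(star_center_neq0 pcharF th XG0 inj0) => c sc c0; have [bc lc st] := sc.
have csum := center_sum pcharF th inj0 sc c0.
have [kG kGE] := trivial_ib pcharF th G; have [kL kLE] := trivial_ib pcharF th L.
have tv := trivial_vertex pcharF th inj0 sc c0 kGE.
have resk : bcL kL ('Res[L] (ibG kG)) = 1.
  by rewrite -kGE (cfRes_preg_restr p nsLG) irr0 rmorph1 -irr0 kLE (bcoef_ib pcharF th) eqxx.
pose inX j := [exists i, (prG i == prG c) && under i j].
have inXP j : reflect (exists2 i, prG i = prG c & under i j) (inX j).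
  by apply: (iffP existsP) => [[i /andP[/eqP]]|[i E ij]]; exists i => //; rewrite E eqxx.
(* A trivial constituent would put [L] into the kernel of every character at the vertex of [c], and
   the sum at [t0] would be a sum of degrees instead of -1. *)
have no1 i : prG i = prG c -> '['Res[L] 'chi_i, 1] = 0.
  move=> E; apply: contrapT => /eqP i1; have := csum t0 XG0.
  rewrite sum_cfunE (eq_bigr (fun j => 'chi_j 1%g)) => [|j /eqP Ej]; last first.
    have := subsetP (under_trivial nsLG simL not_pL i1 (etrans E (esym Ej))) t0.
    by rewrite cfkerEirr inE => /(_ _)/eqP->//; move: Xt0; rewrite inE => /andP[].
  move=> S; have : 0 <= -1 :> algC by rewrite -S sumr_ge0 // => j _; rewrite char1_ge0 ?irr_char.
  by rewrite oppr_ge0 ler10.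
have resW (i1 : Iirr G) : (forall i, prG i = prG c -> 'Res[L] 'chi_i = 'Res[L] 'chi_i1) ->
    'Res[L] (vertex_sum p c) = #|[pred i | prG i == prG c]|%:R *: 'Res[L] 'chi_i1.
  move=> h; rewrite linear_sum (eq_bigr (fun=> 'Res[L] 'chi_i1)) => [|i /eqP/h //].
  by rewrite sumr_const scaler_nat.
have Lt t : t \in psing p L -> t \in L by rewrite inE => /andP[].
(* A character at the vertex of [c] contains the trivial Brauer character, so one of its
   constituents on [L] does and is linked to 1; the other constituents are conjugate to that one. *)
have Xblock j : inX j -> in_block p theta j.
  case/inXP=> i E ij; have di : decG i kG != 0 by rewrite tv E eqxx orbT.
  have [x ix dx] : exists2 x, under i x & decL x kL != 0.
    apply: contrapT => no; have := @dec_Res_constt p F theta gT G L i kL.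
    rewrite big1 => [|x _]; last first.
      by apply: contrapT => /eqP; rewrite mulf_eq0 negb_or => /andP[u d]; apply: no; exists x.
    rewrite (dec_Res pcharF th nsLG) => /eqP; rewrite psumr_eq0 => [/allP/(_ kG (mem_index_enum _))|k _].
      by rewrite /= resk mulr1 (negbTE di).
    by rewrite mulr_ge0 ?(dec_ge0 pcharF th) // natr_ge0 ?(bcoef_Res_nat pcharF th).
  have [y Gy yE] := under_conj ix ij; apply: (block_conj Gy _ yE).
  apply: in_block_linked (in_block0 p theta L) _; apply/linkedP; exists kL => //.
  by rewrite decE kLE (bcoef_ib pcharF th) eqxx oner_eq0.
(* If no member of [inX] is constant on p-singular elements, all are exceptional. If one is, all
   restrictions from the vertex of [c] coincide and [inX] is one conjugacy class under [G]; the
   value -1 of their sum forces its size to be 1. *)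
have X1 j j' : inX j -> inX j' -> prL j = prL j'.
  move=> Xj Xj'; have [[x Xx cx]|nc] := pselect (exists2 x, inX x & psing_const p ('chi[L]_x)); last first.
    by apply: exc_eq; rewrite ?Xblock // => cx; apply: nc; [exists j | exists j'].
  case/inXP: Xx => i1 E1 i1x.
  have cW : psing_const p ('Res[L] (vertex_sum p c)).
    by exists (-1) => t Xt; rewrite cfResE ?Lt // csum // XLG.
  have rE := vertex_res cW no1 E1 i1x cx.
  case: cx => a xa; have := csum t0 XG0; rewrite -(cfResE (vertex_sum p c) sLG) ?Lt //.
  rewrite (resW i1 rE) cfunE (under_value i1x xa Xt0) => S.
  have NS : (size ('chi_x ^: G)%CF)%:R * (#|[pred i | prG i == prG c]|%:R * ('['Res[L] 'chi_i1, 'chi_x] * a)) = -1.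
    by rewrite -S mulrCA; congr (_ * _); rewrite mulrCA.
  have [||/eqP] := nat_mul_aint _ _ NS.
  - exact: rpred_nat.
  - have Aa : a \in Aint by rewrite -(xa t0) ?Aint_irr.
    apply: rpredM; first by rewrite Aint_Cnat ?rpred_nat.
    by apply: rpredM Aa; rewrite Aint_Cnat ?Cnat_cfdot_char_irr ?cfRes_char ?irr_char.
  rewrite pnatr_eq1 => /eqP sz1 _.
  have cl : ('chi_x ^: G)%CF = [:: 'chi_x].
    by move: sz1 (cfclass_refl G 'chi_x); case: cfclass => [//|z [|//]] _; rewrite inE => /eqP->.
  have isx l : inX l -> l = x.
    case/inXP=> i E il; rewrite (rE i E) in il.
    have [y Gy yE] := under_conj i1x il.
    have : 'chi_l \in ('chi_x ^: G)%CF by apply/cfclassP; exists y.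
    by rewrite cl inE => /eqP/irr_inj.
  by rewrite (isx j Xj) (isx j' Xj').
have [x0 Xx0] : exists x0, inX x0.
  have : 'Res[L] 'chi_c != 0.
    apply: contraNneq (irr1_neq0 c) => /cfunP/(_ 1%g).
    by rewrite cfResE ?group1 // cfunE => ->.
  by move/neq0_has_constt=> [j cj]; exists j; apply/inXP; exists c => //; rewrite -irr_consttE.
have nX0 : ~~ inX 0 by apply/inXP => -[i E]; rewrite irr0 no1 ?eqxx.
have dkL j : decL j kL != 0 -> j = 0 \/ inX j.
  move=> dj; have [|i ij di] := dec_over pcharF th nsLG (k' := kG) dj; first by rewrite resk oner_eq0.
  move: di; rewrite tv => /orP[/eqP i0|/eqP E]; last by right; apply/inXP; exists i.
  left; move: ij; rewrite i0 irr0 rmorph1 -irr0 cfdot_irr.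
  by rewrite pnatr_eq0 eqb0 negbK eq_sym => /eqP.
have Xsum t : t \in psing p L -> \sum_(j | inX j) 'chi_j t = -1.
  move=> Xt; have := dec_psing pcharF th kL Xt.
  rewrite (bigD1 0) //= [X in _ + X](bigID inX) /= [X in _ + (_ + X)]big1 ?addr0; last first.
    move=> j /andP[j0 nX]; case: (eqVneq (decL j kL) 0) => [->|/dkL[E|]]; first by rewrite mul0r.
      by rewrite E eqxx in j0.
    by rewrite (negbTE nX).
  rewrite decE kLE (bcoef_ib pcharF th) eqxx mul1r irr0 cfun1E Lt //=.
  rewrite (eq_bigl inX) => [|j]; last by case: eqP => [->|//]; rewrite (negbTE nX0).
  rewrite (eq_bigr (fun j => decL x0 kL * 'chi_j t)) => [|j Xj]; last by rewrite (dec_pr kL (X1 j x0 Xj Xx0)).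
  rewrite -mulr_sumr => /eqP; rewrite addrC addr_eq0 => /eqP/nat_mul_aint[] //.
    exact: dec_nat.
  by rewrite rpred_sum // => j _; apply: Aint_irr.
(* Both characters turn out to lie below one vertex of [G], that of [u], which is a leaf. *)
have B6 j1 j2 : in_block p theta j1 -> in_block p theta j2 -> linked p theta j1 j2 ->
    ~~ inX j1 -> ~~ inX j2 -> prL j1 = prL j2.
  move=> b1 b2 /linkedP[k d1 d2] nX1 nX2.
  have [u bu u1] := block_over b1.
  have uc : prG u <> prG c by move=> E; case/inXP: nX1; exists u.
  have [k' du rk] := dec_under pcharF th nsLG u1 d1.
  have [u2 u22 du2] := dec_over pcharF th nsLG d2 rk.
  have leaf := leaf_constituent sc bu uc.
  have Eu2 : prG u2 = prG u.
    by case: (leaf _ du _ du2) => // E; case/inXP: nX2; exists u2.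
  have [[i Ei i1]|no1u] := pselect (exists2 i, prG i = prG u & '['Res[L] 'chi_i, 1] != 0).
    have triv v l : prG v = prG u -> under v l -> l = 0.
      move=> Ev vl; have sK := under_trivial nsLG simL not_pL i1 (etrans Ei (esym Ev)).
      apply/eqP; apply: contraNT vl => l0.
      have -> : 'Res[L] 'chi_v = 'chi_v 1%g *: 'chi_0.
        apply/cfun_inP => z Lz; rewrite cfResE // irr0 cfunE cfun1E Lz mulr1.
        by have := subsetP sK z Lz; rewrite cfkerEirr inE => /eqP.
      by rewrite cfdotZl cfdot_irr [0 == l]eq_sym (negbTE l0) mulr0.
    by rewrite (triv u j1 erefl u1) (triv u2 j2 Eu2 u22).
  have {}no1u i : prG i = prG u -> '['Res[L] 'chi_i, 1] = 0.
    by move=> E; apply: contrapT => /eqP ne; apply: no1u; exists i.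
  have [cc|nc] := pselect (psing_const p ('chi_j1) \/ psing_const p ('chi_j2)); last first.
    by apply: exc_eq => // cj; apply: nc; [left | right].
  have [i0 [j0 [Ei0 i0j0 cj0]]] : exists i0 j0, [/\ prG i0 = prG u, under i0 j0 & psing_const p ('chi[L]_j0)].
    by case: cc => cj; [exists u, j1 | exists u2, j2].
  have cW : psing_const p ('Res[L] (vertex_sum p u)).
    have [a ua] := leaf_sum pcharF th inj0 sc c0 bu uc.
    by exists a => t Xt; rewrite cfResE ?Lt // ua // XLG.
  (* One constant constituent makes all restrictions from the vertex equal, so below it there is a
     single conjugacy class, with a common value [a] on p-singular elements. *)
  have rE0 := vertex_res cW no1u Ei0 i0j0 cj0.
  have rE i : prG i = prG u -> 'Res[L] 'chi_i = 'Res[L] 'chi_u by move=> E; rewrite !rE0.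
  have u0 : under u j0 by rewrite -(rE i0).
  have u2' : under u j2 by rewrite -(rE u2).
  have [a ja] := under_const_conj u0 cj0 u1.
  have Ya y : under u y -> forall t, t \in psing p L -> 'chi_y t = a.
    by move=> uy; have [z Gz zE] := under_conj u1 uy; exact: conj_psing Gz zE ja.
  (* Below, s is the number of Brauer constituents of a conjugate of j1; the relation
     [rel] makes s divide the number of constituents in Th of every character. *)
  pose Th k := [exists k', (decG u k' != 0) && (bcL k ('Res[L] (ibG k')) != 0)].
  have ThY y l : under u y -> decL y l != 0 -> Th l.
    by move=> uy /(dec_under pcharF th nsLG uy)[l' dl rl]; apply/existsP; exists l'; rewrite dl.
  have Thsplit l j : Th l -> decL j l != 0 -> under u j \/ inX j.
    case/existsP=> l' /andP[dl rl] dj; have [i ij di] := dec_over pcharF th nsLG dj rl.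
    case: (leaf _ dl _ di) => E; first by left; rewrite -(rE i).
    by right; apply/inXP; exists i.
  have YX y : under u y -> ~~ inX y.
    move=> uy; apply: contra nX1 => /inXP[i E iy]; apply/inXP; exists i => //.
    by have [z Gz zE] := under_conj uy u1; exact: conj_under iy Gz zE.
  (* Among the characters meeting [Th] are only those below [u], with value [a] at [t0], and those
     of [inX], with sum -1. *)
  have rel l : Th l -> decL x0 l = a * \sum_(y | under u y) decL y l.
    move=> Tl; have := dec_psing pcharF th l Xt0.
    rewrite (bigID (fun y => under u y)) /= [X in _ + X](bigID inX) /= [X in _ + (_ + X)]big1 ?addr0; last first.
      move=> j /andP[nuj nXj]; case: (eqVneq (decL j l) 0) => [->|/(Thsplit _ _ Tl)[uj|Xj]]; first by rewrite mul0r.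
        by rewrite uj in nuj.
      by rewrite Xj in nXj.
    rewrite (eq_bigr (fun y => a * decL y l)) => [|y uy]; last by rewrite (Ya y uy) // mulrC.
    rewrite [X in _ + X](eq_bigl inX) => [|j]; last first.
      by case: (boolP (inX j)) => Xj; rewrite ?andbF // andbT; apply: contraTT Xj => /negPn/YX.
    rewrite [X in _ + X](eq_bigr (fun j => decL x0 l * 'chi_j t0)) => [|j Xj]; last first.
      by rewrite (dec_pr l (X1 j x0 Xj Xx0)).
    by rewrite -!mulr_sumr Xsum // mulrN1 => /eqP; rewrite subr_eq0 => /eqP.
  pose s := \sum_l decL j1 l.
  have sY y : under u y -> \sum_l decL y l = s.
    move=> uy; have [z Gz zE] := under_conj u1 uy; have [h [hinj hE]] := conj_ib Gz.
    by rewrite (reindex_inj hinj); apply: eq_bigr => l _; exact: hE.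
  have sTh y : under u y -> \sum_(l | Th l) decL y l = s.
    move=> uy; rewrite -(sY y uy) [RHS](bigID Th) /= [X in _ + X]big1 ?addr0 // => l nTl.
    by apply: contrapT => /eqP/(ThY _ _ uy); rewrite (negbTE nTl).
  (* The quotient is only an algebraic integer, as [a] is one; it becomes an integer once it is
     known to be rational. *)
  have Sdiv j : exists2 b, b \in Aint & \sum_(l | Th l) decL j l = b * s.
    case: (boolP (under u j)) => [uj|nuj]; first by exists 1; rewrite ?rpred1 // mul1r sTh.
    case: (boolP (inX j)) => [Xj|nXj]; last first.
      exists 0; rewrite ?rpred0 // mul0r big1 // => l Tl.
      by apply: contrapT => /eqP/(Thsplit _ _ Tl)[]; apply/negP.
    exists (a * #|[pred y | under u y]|%:R).
      by apply: rpredM; [rewrite -(ja t0) ?Aint_irr | rewrite Aint_Cnat ?rpred_nat].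
    rewrite (eq_bigr (fun l => a * \sum_(y | under u y) decL y l)) => [|l Tl]; last first.
      by rewrite (dec_pr l (X1 j x0 Xj Xx0)) rel.
    rewrite -mulr_sumr exchange_big /= (eq_bigr (fun=> s)) => [|y uy]; last exact: sTh.
    by rewrite sumr_const -[s *+ _]mulr_natl mulrA.
  have /natrP[n nE] : s \in Num.nat by rewrite rpred_sum // => l _; exact: dec_nat.
  have s0 : n != 0%N.
    apply: contraNneq d1 => n0; move: nE; rewrite n0 => /eqP; rewrite psumr_eq0 => [/allP/(_ k (mem_index_enum _)) //|l _].
    exact: dec_ge0.
  (* For a prime divisor of [n], [brauer_lattice] expresses [m] times [ib k], with [m] prime to that
     divisor, through ordinary characters. Counting constituents in [Th] turns this into [m] being
     an algebraic integer times [n], so [n] divides [m]. *)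
  have n1 : n = 1%N.
    apply/eqP; rewrite eqn_leq lt0n s0 andbT leqNgt; apply/negP => n_gt1.
    have [m0 [r [irr rE']]] := ib_IBr pcharF th (k : 'I_(size (ibr p theta L))).
    have [m [b [lm Ab bE]]] := brauer_lattice pcharF th r (pdiv_prime n_gt1).
    case/negP: lm; apply: dvdn_trans (pdiv_dvd n) _.
    pose S f := \sum_(l | Th l) bcL l f.
    have Sk : S (ibL k) = 1.
      rewrite /S (bigD1 k) /=; last exact: ThY u1 d1.
      rewrite (bcoef_ib pcharF th) eqxx big1 ?addr0 // => l /andP[_ lk].
      by rewrite (bcoef_ib pcharF th) eq_sym (negbTE lk).
    have /choice[b' b'P] j : exists b', b' \in Aint /\ \sum_(l | Th l) decL j l = b' * s.
      by have [b' ? ?] := Sdiv j; exists b'.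
    have mE : m%:R = (\sum_i b i * b' i) * n%:R.
      transitivity (m%:R * S (ibL k)); first by rewrite Sk mulr1.
      transitivity (S (m%:R *: ibL k)).
        by rewrite /S mulr_sumr; apply: eq_bigr => l _; rewrite linearZ.
      rewrite rE' bE /S mulr_suml.
      rewrite (eq_bigr (fun l => \sum_i b i * decL i l)) => [|l _]; last first.
        by rewrite linear_sum /=; apply: eq_bigr => i _; rewrite linearZ /= decE.
      rewrite exchange_big /=; apply: eq_bigr => i _.
      by rewrite -mulr_sumr -mulrA -nE (proj2 (b'P i)).
    rewrite -dvdC_nat; apply/dvdCP; exists (\sum_i b i * b' i) => //.
    have n0 : n%:R != 0 :> algC by rewrite pnatr_eq0.
    rewrite Cint_rat_Aint //.
      by rewrite -[X in X \in _](mulfK n0) -mE rpred_div ?rpred_nat.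
    by rewrite rpred_sum // => i _; rewrite rpredM // (proj1 (b'P i)).
  have irred y : under u y -> decL y k != 0 -> prL y = ibL k.
    move=> uy dy; have := sY y uy; rewrite nE n1 (bigD1 k) //= => S1.
    have ge1 : 1 <= decL y k.
      have /natrP[q qE] := dec_nat pcharF th y k.
      by move: dy; rewrite qE pnatr_eq0 ler1n lt0n.
    have ge0 l : l != k -> 0 <= decL y l by move=> _; exact: dec_ge0.
    have sle : \sum_(l < size (ibr p theta L) | l != k) decL y l = 0.
      apply/eqP; rewrite eq_le sumr_ge0 // andbT.
      by rewrite -(lerD2l (decL y k)) addr0 S1.
    have dk1 : decL y k = 1 by move: S1; rewrite sle addr0.
    rewrite (preg_restr_dec pcharF th) (bigD1 k) //= dk1 scale1r big1 ?addr0 // => l lk.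
    move/eqP: sle; rewrite psumr_eq0 // => /allP/(_ l (mem_index_enum _)).
    by rewrite lk /= => /eqP->; rewrite scale0r.
  by rewrite (irred j1 u1 d1) (irred j2 u2' d2).
exists x0; split; first exact: Xblock.
  move=> j bj; case: (boolP (inX j)) => [Xj|nXj]; first exact/linked_pr/X1.
  have [u bu uj] := block_over bj.
  have uc : prG u <> prG c by move=> E; case/inXP: nXj; exists u.
  have /linkedP[k dk _] := linked_refl pcharF th j.
  have [k' du rk] := dec_under pcharF th nsLG uj dk.
  (* The constituent above [k] occurs in ['chi_c] too, so some member of [inX] contains [ib k]. *)
  have dc := leaf_center pcharF th XG0 inj0 sc c0 bu uc du.
  have [x cx dx] : exists2 x, under c x & decL x k != 0.
    apply: contrapT => no; have := @dec_Res_constt p F theta gT G L c k.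
    rewrite big1 => [|x _]; last first.
      by apply: contrapT => /eqP; rewrite mulf_eq0 negb_or => /andP[cx d]; apply: no; exists x.
    rewrite (dec_Res pcharF th nsLG) => /eqP; rewrite psumr_eq0 => [/allP/(_ k' (mem_index_enum _))|l _].
      by rewrite /= mulf_eq0 (negbTE dc) (negbTE rk).
    by rewrite mulr_ge0 ?(dec_ge0 pcharF th) // natr_ge0 ?(bcoef_Res_nat pcharF th).
  have Xx : inX x by apply/inXP; exists c.
  by apply/linkedP; exists k => //; rewrite -(dec_pr k (X1 x x0 Xx Xx0)).
move=> i j bi bj lij; case: (boolP (inX i)) => [Xi|nXi]; first by constructor 2; exact: X1.
case: (boolP (inX j)) => [Xj|nXj]; first by constructor 3; exact: X1.
by constructor 1; exact: B6.
Qed.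
End StarNormal.

(** * Stars *)

Section StarGraph.
Variables (T : finType) (e : rel T).
Hypothesis e_sym : symmetric e.
Hypothesis e_irr : irreflexive e.

(** The bound on [size s] matches the finite range that [gdist] searches. *)
Lemma gdist_le (x y : T) (s : seq T) : (size s < #|T|)%N -> path e x s -> last x s = y ->
  (gdist e x y <= size s)%N.
Proof.
move=> sT ps ls; rewrite /gdist leqNgt; apply/negP => /(before_find 0%N).
rewrite nth_iota // add0n => /existsP; apply; exists (in_tuple s).
by rewrite ps ls eqxx.
Qed.

Lemma gdist_path (x y : T) : connect e x y -> exists s, [/\ path e x s, last x s = y & size s = gdist e x y].
Proof.
move=> /connectP[p0 pp0 ly]; pose a n := [exists s : n.-tuple T, path e x s && (last x s == y)].
have hasa : has a (iota 0 #|T|).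
  case/shortenP: pp0 ly => p pp up _ ly; apply/hasP; exists (size p).
    rewrite mem_iota add0n leq0n /=.
    by rewrite -[X in (X <= _)%N]/(size (x :: p)) -(card_uniqP up) max_card.
  by apply/existsP; exists (in_tuple p); rewrite pp ly eqxx.
have := nth_find 0%N hasa; rewrite nth_iota ?add0n; last by rewrite has_find size_iota in hasa.
by case/existsP=> s /andP[ps /eqP ls]; exists s; rewrite size_tuple.
Qed.

Definition star_center (c : T) :=
  (forall v, v = c \/ e c v) /\ forall v w, e v w -> v = c \/ w = c.

(** In a tree of diameter at most 2, either [v0] is adjacent to everything or some [w] is reached
    from it only through an [x]. A vertex not adjacent to [x] would then have paths of length at
    most two to [v0] and [w], closing a cycle of length four to six. *)
Lemma star_centerP : is_star e <-> exists c, star_center c.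
Proof.
split=> [[[T0 con acyc] diam]|[c [cv ce]]]; last first.
  split; last first.
    apply/bigmax_leqP => v _; apply/bigmax_leqP => w _.
    case: (eqVneq v w) => [<-|vw].
      apply: leq_trans (@gdist_le v v [::] _ _ _) _ => //=; apply/card_gt0P; by exists v.
    have T2 : (1 < #|T|)%N by apply/card_gt1P; exists v, w.
    have [vc|cv'] := cv v; first subst v.
      have [wc|cw] := cv w; first by rewrite wc eqxx in vw.
      by apply: leq_trans (@gdist_le c w [:: w] _ _ _) _ => //=; rewrite cw.
    have [wc|cw] := cv w.
      by apply: leq_trans (@gdist_le v w [:: w] _ _ _) _ => //=; rewrite wc e_sym cv'.
    have T3 : (2 < #|T|)%N.
      apply/card_gt2P; exists v, w, c; split=> //; split=> //.
        by apply: contraTneq cw => ->; rewrite e_irr.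
      by apply: contraTneq cv' => <-; rewrite e_irr.
    by apply: leq_trans (@gdist_le v w [:: c; w] _ _ _) _ => //=; rewrite e_sym cv' cw.
  split; first by apply/card_gt0P; exists c.
    have cc v : connect e c v by have [->|/connect1//] := cv v.
    by move=> v w; apply: connect_trans (cc w); rewrite (sym_connect_sym e_sym).
  case=> [|x [|y [|z s]]] // _; apply/negP => /andP[cyc un].
  move: cyc un; rewrite /= !inE !negb_or => /and3P[exy eyz pz] /and4P[/and3P[xy xz xs] /andP[yz ys] zs us].
  (* Two consecutive edges with distinct ends meet at the centre; the edge that leaves [z] away from
     [y] then misses it. *)
  have yc : y = c.
    have [xc|//] := ce _ _ exy; have [//|zc] := ce _ _ eyz.
    by rewrite xc zc eqxx in xz.
  have [w ezw wy] : exists2 w, e z w & w != y.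
    case: s pz xs ys {zs us} => [|w s] /= /andP[ezw _].
      by exists x.
    by rewrite !inE !negb_or => _ /andP[yw _]; exists w; rewrite // eq_sym.
  have [zc|wc] := ce _ _ ezw; first by rewrite yc zc eqxx in yz.
  by rewrite wc yc eqxx in wy.
have ne a b : e a b -> a != b by apply: contraTneq => ->; rewrite e_irr.
have nc s : (2 < size s)%N -> path.cycle e s -> uniq s -> False.
  by move=> s2 cs us; have := acyc s s2; rewrite /ucycleb cs us.
have D a b : [\/ a = b, e a b | exists y, e a y /\ e y b].
  have gd : (gdist e a b <= 2)%N.
    apply: leq_trans diam; apply: leq_trans (leq_bigmax a).
    exact: (@leq_bigmax _ (fun y => gdist e a y) b).
  have [s [ps ls ss]] := gdist_path (con a b); rewrite -ss in gd.
  case: s ps ls gd {ss} => [|y [|z [|//]]] /=; first by constructor 1.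
    by rewrite andbT => ey <- _; constructor 2.
  by rewrite andbT => /andP[ay yz] <- _; constructor 3; exists y.
have tri a b d : e a b -> e b d -> e d a -> False.
  move=> ab bd da; apply: (nc [:: a; b; d]) => //=; first by rewrite ab bd da.
  by rewrite !inE !negb_or ne // [a == d]eq_sym (ne d a) // (ne b d).
have edge_c c : (forall v, v = c \/ e c v) -> star_center c.
  move=> cv; split=> // v w vw; have [->|cv'] := cv v; first by left.
  have [->|cw] := cv w; first by right.
  by case: (tri c v w) => //; rewrite e_sym.
have [v0 _] := card_gt0P T0.
have [all0|[w wv0]] : (forall v, v = v0 \/ e v0 v) \/ exists w, ~ (w = v0 \/ e v0 w).
  case: (pselect (forall v, v = v0 \/ e v0 v)) => [|n]; first by left.
  by right; apply: contrapT => no; apply: n => v; apply: contrapT => nv; apply: no; exists v.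
  by exists v0; exact: edge_c.
have [/esym E|E|[x [e0x exw]]] := D v0 w; [by case: wv0; left | by case: wv0; right |].
exists x; apply: edge_c => v; case: (eqVneq v x) => [|vx]; first by left.
right; apply: contrapT => /negP nxv.
have n0w : ~~ e v0 w by apply/negP => E; apply: wv0; right.
have v00 : v != v0 by apply: contraNneq nxv => ->; rewrite e_sym.
have vw : v != w by apply: contraNneq nxv => ->.
have w0 : w != v0 by apply/eqP => E; apply: wv0; left.
have neE a b d : e a d -> ~~ e b d -> a != b by move=> ad; apply: contraNneq => <-.
have ny y : e v y -> y != x by move=> vy; apply: contraNneq nxv => <-; rewrite e_sym.
have [E|vw1|[y' [vy' y'w]]] := D v w; first by rewrite E eqxx in vw.
  have [E|v01|[y [vy y0]]] := D v v0; first by rewrite E eqxx in v00.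
    apply: (nc [:: v0; x; w; v]) => //=; first by rewrite e0x exw e_sym vw1 v01.
    by rewrite !inE !negb_or (ne v0 x) // [v0 == w]eq_sym w0 [v0 == v]eq_sym v00 (ne x w) // [x == v]eq_sym vx [w == v]eq_sym vw.
  have yw : y != w by apply: contraNneq n0w => <-; rewrite e_sym.
  apply: (nc [:: v0; x; w; v; y]) => //=; first by rewrite e0x exw [e w v]e_sym vw1 vy y0.
  rewrite !inE !negb_or (ne v0 x) // [v0 == w]eq_sym w0 [v0 == v]eq_sym v00 [v0 == y]eq_sym (ne y v0) //.
  by rewrite (ne x w) // [x == v]eq_sym vx [x == y]eq_sym ny // [w == v]eq_sym vw [w == y]eq_sym yw (ne v y).
have y'0 : y' != v0 by apply: contraNneq n0w => <-.
have [E|v01|[y [vy y0]]] := D v v0; first by rewrite E eqxx in v00.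
  apply: (nc [:: v0; x; w; y'; v]) => //=; first by rewrite e0x exw [e w y']e_sym y'w [e y' v]e_sym vy' v01.
  rewrite !inE !negb_or (ne v0 x) // [v0 == w]eq_sym w0 [v0 == y']eq_sym y'0 [v0 == v]eq_sym v00.
  by rewrite (ne x w) // [x == y']eq_sym ny // [x == v]eq_sym vx [w == y']eq_sym (ne y' w) // [w == v]eq_sym vw [y' == v]eq_sym (ne v y').
have yw : y != w by apply: contraNneq n0w => <-; rewrite e_sym.
case: (eqVneq y y') => [yy'|yy'].
  apply: (nc [:: v0; x; w; y]) => //=; first by rewrite e0x exw yy' [e w y']e_sym y'w -yy' y0.
  by rewrite !inE !negb_or (ne v0 x) // [v0 == w]eq_sym w0 [v0 == y]eq_sym (ne y v0) // (ne x w) // [x == y]eq_sym ny // [w == y]eq_sym yw.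
apply: (nc [:: v0; x; w; y'; v; y]) => //=; first by rewrite e0x exw [e w y']e_sym y'w [e y' v]e_sym vy' vy y0.
rewrite !inE !negb_or (ne v0 x) // [v0 == w]eq_sym w0 [v0 == y']eq_sym y'0 [v0 == v]eq_sym v00 [v0 == y]eq_sym (ne y v0) //.
rewrite (ne x w) // [x == y']eq_sym ny // [x == v]eq_sym vx [x == y]eq_sym ny // [w == y']eq_sym (ne y' w) //.
by rewrite [w == v]eq_sym vw [w == y]eq_sym yw [y' == v]eq_sym (ne v y') // [y' == y]eq_sym yy' (ne v y).
Qed.
End StarGraph.

(** * The Brauer graph of the principal block in terms of linked characters *)

Section BlockGraph.
Variables (p : nat) (F : closedFieldType) (theta : F -> algC).
Hypothesis pcharF : p \in [pchar F].
Hypothesis th : brauer_lift theta.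
Variables (gT : finGroupType) (G : {group gT}).
Notation pr i := (preg_restr p ('chi[G]_i)).
Notation dec := (@dec p F theta gT G).
Notation linked := (@linked p F theta gT G).
Notation in_block := (@in_block p F theta gT G).
Notation bg := (@brauer_graph p F theta gT G).
Notation vx := (@vertex_of p gT G).
Notation V := (@principal_block_vertex p F theta gT G).
Notation e := (@principal_block_graph p F theta gT G).

Lemma joinedP i j : joined p theta 'chi[G]_i 'chi_j <-> linked i j.
Proof.
have decP l k d : is_decomposition_number p theta 'chi[G]_l (ib k) d -> dec l k = d%:R.
  by case=> s [sI sE ->]; rewrite decE sE (bcoef_sum pcharF th).
have ex l (k : 'I_(size (ibr p theta G))) : exists d, is_decomposition_number p theta 'chi[G]_l (ib k) d.
  have [s [sI sE]] := preg_restr_char_decomp pcharF th (irr_char l).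
  by exists (count_mem (ib k) s), s.
split=> [[phi /(IBr_ib pcharF th)[k ->] [d1 [d2 [D1 n1 D2 n2]]]]|/linkedP[k di dj]].
  by apply/linkedP; exists k; rewrite ?(decP _ _ _ D1) ?(decP _ _ _ D2) pnatr_eq0; apply/eqP.
exists (ib k); first exact: ib_IBr.
have [[d1 D1] [d2 D2]] := (ex i k, ex j k); exists d1, d2.
move: di dj; rewrite (decP _ _ _ D1) (decP _ _ _ D2) !pnatr_eq0 => /eqP ? /eqP ?.
by split.
Qed.

Lemma vertex_eq i j : (vx i == vx j) = (pr i == pr j).
Proof. by []. Qed.

Lemma linked_eq i j i' j' : pr i = pr i' -> pr j = pr j' -> linked i j -> linked i' j'.
Proof.
move=> Ei Ej /linkedP[k di dj]; apply/linkedP; exists k.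
  by rewrite -(dec_pr k Ei).
by rewrite -(dec_pr k Ej).
Qed.

Lemma brauer_graphE i j : bg (vx i) (vx j) = (pr i != pr j) && linked i j.
Proof.
rewrite /brauer_graph vertex_eq; congr (_ && _); apply/asboolP/idP => [[i' [j' []]]|l].
  move=> /eqP; rewrite vertex_eq => /eqP Ei /eqP; rewrite vertex_eq => /eqP Ej /joinedP.
  exact: linked_eq.
by exists i, j; split=> //; apply/joinedP.
Qed.

Lemma vertexP (v : @brauer_vertex p gT G) : exists i, v = vx i.
Proof. by have /codomP[i iE] := valP v; exists i; apply: val_inj. Qed.

Lemma connect_brauer_graph i : connect bg (vx 0) (vx i) = in_block i.
Proof.
apply/idP/idP => [/connectP[s]|]; last first.
  move: i; apply: in_block_ind => // i j _ lij /connect_trans; apply.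
  case: (eqVneq (vx i) (vx j)) => [->//|ne]; apply: connect1.
  by rewrite brauer_graphE lij andbT -vertex_eq.
elim/last_ind: s i => [|s v IH] i /=.
  by move=> _ /eqP; rewrite eq_sym vertex_eq => /eqP /in_block_pr; apply; rewrite ?in_block0.
rewrite rcons_path last_rcons => /andP[ps]; have [k lE] := vertexP (last (vx 0) s).
have bk := IH k ps (esym lE); rewrite lE => lv vE; move: lv.
by rewrite -vE brauer_graphE => /andP[_]; exact: in_block_linked.
Qed.

Lemma block_graph_sym : symmetric e.
Proof.
move=> v w; rewrite /principal_block_graph.
have [[i ->] [j ->]] := (vertexP (val v), vertexP (val w)).
by rewrite !brauer_graphE eq_sym linked_sym.
Qed.

Lemma block_graph_irr : irreflexive e.
Proof. by move=> v; rewrite /principal_block_graph /brauer_graph eqxx. Qed.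

Lemma is_star_block : is_star e <-> star_block p theta G.
Proof.
have vP (v : V) : exists2 i, val v = vx i & in_block i.
  by have [i vE] := vertexP (val v); exists i => //; rewrite -connect_brauer_graph -vE (valP v).
pose bv i (bi : in_block i) : V := Sub (vx i) (etrans (connect_brauer_graph i) bi).
apply: iff_trans (star_centerP block_graph_sym block_graph_irr) _.
split=> [[v [vc ve]]|[c [bc lc st]]].
  have [c vE bc] := vP v; exists c; split=> // [i bi|i j bi bj lij].
    have [/(congr1 val)/eqP|] := vc (bv i bi).
      by rewrite /= vE vertex_eq => /eqP/(linked_pr pcharF th).
    by rewrite /principal_block_graph vE /= brauer_graphE linked_sym => /andP[].
  case: (eqVneq (pr i) (pr j)) => [|ne]; first by constructor 1.
  have : e (bv i bi) (bv j bj) by rewrite /principal_block_graph /= brauer_graphE ne.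
  case/ve=> /(congr1 val)/eqP; rewrite /= vE vertex_eq => /eqP; first by constructor 2.
  by constructor 3.
exists (bv c bc); split=> [v|v w].
  have [i vE bi] := vP v; case: (eqVneq (pr i) (pr c)) => [E|ne].
    by left; apply: val_inj; rewrite /= vE; apply/eqP; rewrite vertex_eq E.
  by right; rewrite /principal_block_graph vE /= brauer_graphE eq_sym ne linked_sym lc.
have [[i vE bi] [j wE bj]] := (vP v, vP w).
rewrite /principal_block_graph vE wE brauer_graphE => /andP[ne lij].
have [E|E|E] := st i j bi bj lij; first by rewrite E eqxx in ne.
  by left; apply: val_inj; rewrite /= vE; apply/eqP; rewrite vertex_eq E.
by right; apply: val_inj; rewrite /= wE; apply/eqP; rewrite vertex_eq E.
Qed.
End BlockGraph.

(** * Groups with a cyclic Sylow subgroup *)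

Section CyclicSylow.
Close Scope ring_scope.
Variable p : nat.
Implicit Type gT : finGroupType.

(** Burnside's argument: [S] and [S :^ z] are Sylow subgroups of the centraliser of [h ^ z], and an
    element conjugating one to the other there corrects [z] into the normaliser of [S]. *)
Lemma abelian_Sylow_fusion gT (G S : {group gT}) h z : p.-Sylow(G) S -> abelian S -> 'N_G(S) \subset 'C(S) ->
  h \in S -> z \in G -> h ^ z \in S -> h ^ z = h.
Proof.
move=> sylS abS cNS Sh Gz Shz.
have sSG := pHall_sub sylS.
pose D := ('C_G[h ^ z])%G; have sDG : D \subset G by apply: subsetIl.
have sSD : S \subset D by rewrite subsetI sSG sub_cent1 (subsetP abS).
have sSzD : S :^ z \subset D.
  rewrite subsetI conj_subG //=; apply/subsetP => _ /imsetP[s Ss ->].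
  by apply/cent1P; rewrite /commute -!conjMg; congr (_ ^ z); exact: (centsP abS).
have sylD : p.-Sylow(D) S := pHall_subl sSD sDG sylS.
have sylDz : p.-Sylow(D) (S :^ z)%G.
  by apply: pHall_subl sSzD sDG _; rewrite /= pHallJ.
have [c Dc Ec] := Sylow_trans sylDz sylD.
have /setIP[Gc chz] := Dc.
have Nzc : z * c \in 'N_G(S) by rewrite inE groupM //=; apply/normP; rewrite conjsgM -Ec.
have cm : commute (z * c) h := centP (subsetP cNS _ Nzc) h Sh.
have cc : commute c (h ^ z) := cent1P chz.
transitivity ((h ^ z) ^ c); first by rewrite (conjgE (h ^ z)) -cc mulKg.
by rewrite -conjgM conjgE -cm mulKg.
Qed.

(** Burnside's transfer theorem: on [S] the transfer is the power map of exponent [#|G : S|], prime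
    to [p], so its kernel, which contains the derived subgroup, meets [S] trivially. *)
Lemma normal_complement gT (G S : {group gT}) : p.-Sylow(G) S -> abelian S -> 'N_G(S) \subset 'C(S) ->
  'O_p^'(G) ><| S = G.
Proof.
move=> sylS abS cNS; set K := 'O_p^'(G).
have [sSG pS _] := and3P sylS.
have p'K : p^'.-group K := pcore_pgroup _ _.
have nsKG : K <| G := pcore_normal _ _.
have [sKG nKG] := andP nsKG.
have nKS := subset_trans sSG nKG.
have tiKS : K :&: S = 1 by rewrite setIC coprime_TIg ?(pnat_coprime pS).
suffices hallK : p^'.-Hall(G) K.
  rewrite sdprodE //=; apply/eqP; rewrite eqEcard mul_subG //=.
  by rewrite TI_cardMg //= (card_Hall sylS) (card_Hall hallK) mulnC partnC.
pose G' := G^`(1)%G.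
suffices p'G' : p^'.-group G'.
  have sG'K : G' \subset K by rewrite pcore_max ?der_normal.
  have nsG'K : G' <| 'O_p^'(G)%G by apply: normalS sG'K sKG (der_normal _ _).
  rewrite -(pquotient_pHall p'G') ?der_normal //= -pquotient_pcore ?der_normal //=.
  by rewrite nilpotent_pcore_Hall ?abelian_nil ?der_abelian.
have abS' : abelian (idm S @* S) by rewrite morphim_idm.
pose V := transfer G abS'.
pose Vm := transfer_morphism G abS'.
have sG'V : G' \subset 'ker Vm.
  rewrite /= gen_subG; apply/subsetP => _ /imset2P[x y Gx Gy ->].
  apply/kerP; first exact: groupR.
  have : commute (Vm x) (Vm y) by apply: GRing.addrC.
  by rewrite morphR // => /commgP/eqP.
apply: pgroupS sG'V _.
have sylK : p.-Sylow('ker Vm) ('ker Vm :&: S) by apply: Sylow_setI_normal sylS; exact: ker_normal.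
suffices tiVS : 'ker Vm :&: S = 1.
  have c1 : 1%N = (#|'ker Vm|`_p)%N.
    by transitivity #|'ker Vm :&: S|; [rewrite tiVS cards1 | exact: card_Hall sylK].
  by rewrite /pgroup -[#|_|](partnC p) ?cardG_gt0 // -c1 mul1n part_pnat.
apply/trivgP/subsetP => g /setIP[Kg Sg]; rewrite inE.
have Gg := subsetP sSG g Sg.
have trX := transversalP (rcosets_cycle_partition sSG Gg).
have := transfer_cycle_expansion sSG abS' Gg trX.
rewrite -/V; have -> : V g = 0%R by apply: (mker Kg).
set X := transversal _ _ in trX *; have sXG := transversal_sub trX.
pose n x := #|<[g]> : S :* x|.
rewrite (eq_bigr (fun x => FiniteModule.fmod abS' (g ^+ n x))) => [|x Xx]; last first.
  have Gx := subsetP sXG x Xx; have Sgn : g ^+ n x \in S by rewrite groupX.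
  have Sgx : (g ^+ n x) ^ x^-1 \in S.
    have := mulg_exp_card_rcosets S g x; rewrite mem_rcoset -/(n x).
    by rewrite conjgE invgK mulgA.
  rewrite /restrm /=.
  by congr (FiniteModule.fmod _ _); apply: (abelian_Sylow_fusion sylS) => //; rewrite groupV.
have gS : g \in idm S @* S by rewrite morphim_idm.
have fX k : FiniteModule.fmod abS' (g ^+ k) = (FiniteModule.fmod abS' g *+ k)%R by apply: FiniteModule.fmodX; exact: gS.
rewrite (eq_bigr _ (fun x _ => fX (n x))) GRing.sumrMnr (sum_index_rcosets_cycle sSG Gg trX) -fX.
move/(congr1 FiniteModule.fmval); rewrite FiniteModule.fmodK ?groupX // => /esym/eqP; rewrite -order_dvdn => gm.
have pg : p.-nat #[g] := mem_p_elt pS Sg.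
have p'g : p^'.-nat #[g] by apply: pnat_dvd gm _; case/and3P: sylS.
by rewrite -order_eq1 (pnat_1 pg p'g).
Qed.

Lemma dvdn_predX_prime j k : prime p -> (0 < k)%N -> (p ^ j.+1 %| k.-1)%N -> (p ^ j.+2 %| (k ^ p).-1)%N.
Proof.
move=> p_pr k0 pk; rewrite predn_exp expnSr dvdn_mul // /dvdn -modn_summ.
have kp : (k %% p = 1)%N.
  rewrite -(prednK k0) -addn1 -modnDml (eqP (dvdn_trans _ pk)) ?expnS ?dvdn_mulr //.
  by rewrite modn_small ?prime_gt1.
rewrite (eq_bigr (fun=> 1%N)) => [|i _]; last by rewrite -modnXm kp exp1n modn_small ?prime_gt1.
by rewrite sum_nat_const card_ord muln1 modnn.
Qed.

Lemma dvdn_predX k n : prime p -> (k %% p = 1)%N -> (p ^ n.+1 %| (k ^ (p ^ n)).-1)%N.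
Proof.
move=> p_pr kp; have k0 : (0 < k)%N by case: k kp => //; rewrite mod0n.
elim: n => [|n IH]; last by rewrite (expnSr p n) expnM dvdn_predX_prime ?expn_gt0 ?k0.
by rewrite expn1 -subn1 -eqn_mod_dvd // kp modn_small ?prime_gt1.
Qed.

(** A p'-element [w] of the normaliser acts on [P] as a power [k], which is 1 modulo [p] since [Z]
    is centralised. For [P] of order [p ^ n], raising [k] to the power [p ^ n] makes it 1 modulo
    [#|P|], so [w ^+ (p ^ n)] centralises [P]; it generates the same group as [w]. *)
Lemma cyclic_norm_cent gT (C P Z : {group gT}) : p.-Sylow(C) P -> cyclic P -> Z \subset P -> #|Z| = p -> prime p ->
  C \subset 'C(Z) -> 'N_C(P) \subset 'C(P).
Proof.
move=> sylP cycP sZP oZ p_pr cZ; have [sPC pP _] := and3P sylP.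
have abP := cyclic_abelian cycP.
have sPN : P \subset 'N_C(P) by rewrite subsetI sPC normG.
have sylPN : p.-Sylow('N_C(P)) P := pHall_subl sPN (subsetIl _ _) sylP.
have nsPN : P <| 'N_C(P) by rewrite /normal sPN subsetIr.
apply/subsetP => y Ny; rewrite -(consttC p y) groupM //.
  by apply: (subsetP abP); rewrite (mem_normal_Hall sylPN nsPN) ?groupX ?p_elt_constt.
set w := y.`_p^'; have /setIP[Cw nPw] : w \in 'N_C(P) by rewrite groupX.
have p'w : p^'.-group <[w]> by rewrite /pgroup -orderE -/(p_elt _ _) p_elt_constt.
have [x Px] := cyclicP cycP; have Pxx : x \in P by rewrite Px cycle_id.
have [k xk] : exists k, x ^ w = x ^+ k by apply/cycleP; rewrite -Px memJ_norm.
have zk z : z \in P -> z ^ w = z ^+ k.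
  by rewrite Px => /cycleP[q ->]; rewrite conjXg xk -!expgM mulnC.
have cycZ : cyclic Z by rewrite prime_cyclic ?oZ.
have [z Zz] := cyclicP cycZ.
have ordz : #[z] = p by rewrite orderE -Zz.
have kp : (k %% p = 1)%N.
  rewrite -[RHS](modn_small (prime_gt1 p_pr)); apply/eqP; rewrite -{1 2}ordz -eq_expg_mod_order.
  rewrite -zk ?(subsetP sZP) ?Zz ?cycle_id // expg1; apply/eqP/conjg_fixP/commgP/commute_sym.
  by apply: (centP (subsetP cZ _ Cw)); rewrite Zz cycle_id.
have xm m : x ^ (w ^+ m) = x ^+ (k ^ m).
  elim: m => [|m IH]; first by rewrite expg0 conjg1.
  by rewrite expgSr conjgM IH conjXg xk -expgM expnS.
have [n xn] := p_natP (mem_p_elt pP Pxx : p.-nat #[x]).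
have E : x ^ (w ^+ (p ^ n)) = x.
  rewrite xm; apply/eqP; rewrite -[X in _ == X]expg1 eq_expg_mod_order xn eqn_mod_dvd.
    by rewrite subn1 (dvdn_trans _ (dvdn_predX n p_pr kp)) // dvdn_exp2l.
  by rewrite expn_gt0; case: k kp {xk zk xm} => //; rewrite mod0n.
have gen : generator <[w]> (w ^+ (p ^ n)).
  rewrite generator_coprime -xn coprime_sym.
  exact: pnat_coprime (mem_p_elt pP Pxx : p.-nat #[x]) p'w.
suff : <[w]> \subset 'C(P) by rewrite cycle_subG.
rewrite (eqP gen) Px cent_cycle cycle_subG; apply/cent1P.
by apply/commute_sym/commgP/conjg_fixP.
Qed.

Lemma central_complement gT (C P Z : {group gT}) : p.-Sylow(C) P -> cyclic P -> Z \subset P -> #|Z| = p -> prime p ->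
  C \subset 'C(Z) -> 'O_p^'(C) ><| P = C.
Proof.
move=> sylP cycP sZP oZ p_pr cZ; apply: normal_complement => //; first exact: cyclic_abelian.
exact: cyclic_norm_cent oZ p_pr cZ.
Qed.

Lemma commuting_order_p_cycle gT (H P : {group gT}) a b : prime p -> p.-Sylow(H) P -> cyclic P ->
  a \in H -> b \in H -> #[a] = p -> #[b] = p -> commute a b -> <[a]> = <[b]>.
Proof.
move=> p_pr sylP cycP Ha Hb oa ob cab.
have cAB : <[b]> \subset 'C(<[a]>) by rewrite cent_cycle cycle_subG; apply/cent1P.
have pQ : p.-group (<[a]> <*> <[b]>).
  by rewrite /= cent_joinEr // pgroupM /pgroup -!orderE oa ob pnat_id.
have sQH : <[a]> <*> <[b]> \subset H by rewrite join_subG !cycle_subG Ha.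
have [h Hh sQP] := Sylow_Jsub sylP sQH pQ.
have sA : <[a]> :^ h \subset P by apply: subset_trans sQP; rewrite conjSg joing_subl.
have sB : <[b]> :^ h \subset P by apply: subset_trans sQP; rewrite conjSg joing_subr.
have /eqP E : <[a]> :^ h == <[b]> :^ h.
  by rewrite (eq_subG_cyclic cycP sA sB) !cardJg -!orderE oa ob.
by rewrite -[LHS](conjsgK h) E conjsgK.
Qed.

Lemma minnormal_cyclic_Sylow gT (H P : {group gT}) : prime p -> p.-Sylow(H) P -> cyclic P -> P :!=: 1 ->
  'O_p^'(H) = 1 -> ~~ (P <| H) ->
  exists M : {group gT}, [/\ M <| H, simple M, ~~ abelian M, P \subset M
    & forall N : {group gT}, N <| H -> N :!=: 1 -> M \subset N].
Proof.
move=> p_pr sylP cycP ntP O1 nPH; have [sPH pP _] := and3P sylP.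
have abP := cyclic_abelian cycP.
have p'normal (N : {group gT}) : N <| H -> p^'.-group N -> N :=: 1.
  by move=> nsN p'N; apply/trivgP; rewrite -O1 pcore_max.
have ntH : H :!=: 1 by apply: contraNneq ntP => H1; rewrite -subG1 -H1.
have pdiv (N : {group gT}) : N <| H -> N :!=: 1 -> p %| #|N|.
  by move=> nsN; apply: contraR; rewrite -p'natE // => /(p'normal _ nsN)->.
have [M minM sMH] := minnormal_exists ntH (normG H).
have [/andP[ntM nMH] minMP] := mingroupP minM.
have nsMH : M <| H by rewrite /normal sMH.
have pM := pdiv M nsMH ntM.
have OM1 : 'O_p^'(M) = 1.
  by apply: p'normal; [exact: char_normal_trans (pcore_char _ _) nsMH | exact: pcore_pgroup].
have simM : simple M.
  have [N minN sNM] := minnormal_exists ntM (normG M).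
  have [/andP[ntN nNM] minNP] := mingroupP minN.
  have nsNM : N <| M by rewrite /normal sNM.
  have pN : p %| #|N|.
    apply: contraR ntN; rewrite -p'natE // => p'N.
    by rewrite -subG1 -OM1 pcore_max.
  have [a Na oa] := Cauchy p_pr pN.
  (* If a conjugate of [N] were different, the two would commute and meet trivially; but commuting
     elements of order [p] generate the same subgroup. *)
  have nNH : H \subset 'N(N).
    apply/subsetP => g Hg; apply/normP; apply: contrapT => /eqP neN.
    have nsNg : N :^ g <| M by rewrite -(normP (subsetP nMH g Hg)) /normal conjSg normJ conjSg sNM.
    have ti : N :&: N :^ g = 1.
      apply: contraNeq neN => nt1.
      have E := minNP [group of N :&: N :^ g] _ (subsetIl _ _).
      have EN : N :&: N :^ g = N.
        by apply: E; rewrite nt1 /= normsI // (normal_norm nsNg).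
        by rewrite eq_sym eqEcard cardJg leqnn andbT; apply/setIidPl.
    have cc : [~: N, N :^ g] = 1.
      apply/trivgP; rewrite -ti subsetI commg_subl commg_subr.
      by rewrite (subset_trans (normal_sub nsNg) nNM) (subset_trans sNM (normal_norm nsNg)).
    have Nga : a ^ g \in N :^ g by rewrite memJ_conjg.
    have Ha : a \in H by rewrite (subsetP sMH) ?(subsetP sNM).
    have cab : commute a (a ^ g).
      by apply/commgP/eqP/set1gP; rewrite -cc mem_commg.
    have E : <[a]> = <[a ^ g]>.
      by apply: (commuting_order_p_cycle p_pr sylP cycP); rewrite ?groupJ ?orderJ.
    have : a \in N :&: N :^ g by rewrite inE Na -cycle_subG E cycle_subG.
    by rewrite ti => /set1gP a1; move: p_pr; rewrite -oa a1 order1.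
  by move: minN; rewrite (minMP N) ?ntN // => ->.
have sylS : p.-Sylow(M) (M :&: P) := Sylow_setI_normal nsMH sylP.
set S := (M :&: P)%G in sylS *; have pS : p.-group S := pHall_pgroup sylS.
have cycS : cyclic S by apply: cyclicS (subsetIr _ _) cycP.
pose Z := 'Ohm_1(P)%G; have sZP : Z \subset P := Ohm_sub 1 P.
have oZ : #|Z| = p := Ohm1_cyclic_pgroup_prime cycP pP ntP.
have sZS : Z \subset S.
  rewrite -(cardSg_cyclic cycP sZP (subsetIr _ _)) oZ /= (card_Hall sylS).
  by rewrite -{1}(expn1 p) p_part dvdn_exp2l // logn_gt0 mem_primes p_pr pM cardG_gt0.
have sZM : Z \subset M := subset_trans sZS (subsetIl _ _).
have naM : ~~ abelian M.
  apply: contra nPH => abM.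
  have prM := simple_sol_prime (abelian_sol abM) simM.
  have oM : #|M| = p by apply/esym/eqP; rewrite -dvdn_prime2.
  have EM : M :=: Z by apply/esym/eqP; rewrite eqEcard sZM oM oZ leqnn.
  (* An abelian [M] has order [p]. Its centraliser is a semidirect product of its p'-core, which is
     trivial, with [P], so [P] would be normal. *)
  pose C := 'C_H(M)%G; have nsCH : C <| H by have := subcent_normal H M; rewrite (setIidPl nMH).
  have sPC : P \subset C by rewrite subsetI sPH centsC EM (subset_trans sZP).
  have sylPC : p.-Sylow(C) P := pHall_subl sPC (subsetIl _ _) sylP.
  have sMP : M \subset P by rewrite EM.
  have := central_complement sylPC cycP sMP oM p_pr (subsetIr _ _).
  have -> : 'O_p^'(C) = 1.
    by apply: p'normal; [exact: char_normal_trans (pcore_char _ _) nsCH | exact: pcore_pgroup].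
  by rewrite sdprod1g => ->.
have sPM : P \subset M.
  (* If the normaliser of [S] in [M] centralised [Z], a normal p-complement would exist; it is
     trivial, so [M] would be the abelian group [S]. *)
  have [y Ny nCy] : exists2 y, y \in 'N_M(S) & y \notin 'C(Z).
    apply: contrapT => no; case/negP: naM.
    have cN : 'N_M(S) \subset 'C(Z).
      by apply/subsetP => y Ny; apply: contrapT => /negP nC; apply: no; exists y.
    have sSN : S \subset 'N_M(S) by rewrite subsetI subsetIl normG.
    have sylSN : p.-Sylow('N_M(S)) S := pHall_subl sSN (subsetIl _ _) sylS.
    have := cyclic_norm_cent sylSN cycS sZS oZ p_pr cN.
    rewrite /= -setIA setIid => /(normal_complement sylS (cyclic_abelian cycS)).
    by rewrite OM1 sdprod1g => <-; exact: cyclic_abelian.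
  have /setIP[My nSy] := Ny; have Hy := subsetP sMH y My.
  have nZy : y \in 'N(Z).
    have chZ : Z \char S by rewrite sub_cyclic_char.
    by rewrite -cycle_subG (char_norm_trans chZ) // cycle_subG.
  pose C := 'C_H(Z)%G; pose T := 'N_H(Z)%G.
  have nsCT : C <| T by rewrite /= subcent_normal.
  have sPC : P \subset C by rewrite subsetI sPH centsC (subset_trans sZP).
  have sylPC : p.-Sylow(C) P := pHall_subl sPC (subsetIl _ _) sylP.
  have defC := central_complement sylPC cycP sZP oZ p_pr (subsetIr _ _).
  (* Frattini's argument replaces [y] by an [n] normalising [P]. It acts on [P] as a power [k], not
     1 modulo [p], because [y] does not centralise [Z]. *)
  have : y \in C * 'N_T(P) by rewrite (Frattini_arg nsCT sylPC) inE Hy.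
  case/mulsgP=> c n Cc /setIP[Tn nPn] yE.
  have [x Px] := cyclicP cycP; have Pxx : x \in P by rewrite Px cycle_id.
  have [k xk] : exists k, x ^ n = x ^+ k by apply/cycleP; rewrite -Px memJ_norm.
  have nkp : ~~ (k == 1 %[mod p]).
    apply: contra nCy => kp; rewrite yE groupM //; first by case/setIP: Cc.
    apply/centP => z Zz; apply/commute_sym/commgP/conjg_fixP.
    have [q zE] : exists q, z = x ^+ q by apply/cycleP; rewrite -Px (subsetP sZP).
    have -> : z ^ n = z ^+ k by rewrite zE conjXg xk -!expgM mulnC.
    rewrite -[RHS]expg1; apply/eqP; rewrite eq_expg_mod_order.
    have zp : #[z] %| p by rewrite -oZ order_dvdG.
    by rewrite -(modn_dvdm k zp) (eqP kp) modn_dvdm.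
  have nsOT : 'O_p^'(C) <| T := char_normal_trans (pcore_char _ _) nsCT.
  have nOT := normal_norm nsOT; have [nsOC _ _ _ _] := sdprod_context defC.
  have Cx := subsetP sPC x Pxx; have CT := subsetP (normal_sub nsCT).
  have NT t : t \in T -> t \in 'N('O_p^'(C)) := fun Tt => subsetP nOT t Tt.
  have abCO : abelian (C / 'O_p^'(C)) by rewrite -(isog_abelian (sdprod_isog defC)).
  have Exy : coset 'O_p^'(C) (x ^ y) = coset 'O_p^'(C) (x ^+ k).
    have [nx nc nn] : [/\ x \in 'N('O_p^'(C)), c \in 'N('O_p^'(C)) & n \in 'N('O_p^'(C))].
      by split; apply: NT => //; apply: CT.
    have Exc : coset 'O_p^'(C) (x ^ c) = coset 'O_p^'(C) x.
      by rewrite morphJ //= conjgE (centsP abCO (coset _ x) _ (coset _ c)) ?mem_quotient // mulKg.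
    have E1 := morphJ (coset_morphism 'O_p^'(C)) (groupJ nx nc) nn.
    have E2 := morphJ (coset_morphism 'O_p^'(C)) nx nn.
    by rewrite yE conjgM -xk; move: E1 E2 => /= -> ->; rewrite Exc.
  have Ty : y \in T by rewrite inE Hy.
  have Tx : x \in T := CT x Cx.
  have Txy : x ^ y \in 'N('O_p^'(C)) := NT _ (groupJ Tx Ty).
  have Txk : x ^+ k \in 'N('O_p^'(C)) := NT _ (groupX k Tx).
  have /rcosetP[o Oo xyE] : x ^ y \in 'O_p^'(C) :* x ^+ k by apply/(rcoset_kercosetP Txy Txk).
  have NM t : t \in H -> t \in 'N(M) := fun Ht => subsetP nMH t Ht.
  have Hx := subsetP sPH x Pxx.
  have Ho : o \in H by case/setIP: (subsetP (normal_sub nsOC) o Oo).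
  have Mxy : coset M (x ^ y) = coset M x by rewrite morphJ ?NM //= (coset_id My) conjg1.
  (* Modulo [M], which contains [y], the relation [x ^ y = o * x ^+ k] identifies the p-element [u]
     with the inverse of the p'-element [o]. So [u] lies in [M], and it generates [P]. *)
  pose u := x ^+ k * x^-1.
  have Mu : coset M u = coset M o^-1.
    apply: (mulIg (coset M x)); rewrite -!morphM ?NM ?groupM ?groupX ?groupV //= mulgKV.
    rewrite morphM ?NM ?groupV //= -Mxy xyE morphM ?NM ?groupX //=.
    by rewrite mulgA -morphM ?NM ?groupV //= mulVg morph1 mul1g.
  have Pu : u \in P by rewrite groupM ?groupX ?groupV.
  have uM : u \in M.
    apply: coset_idr; first by rewrite NM // (subsetP sPH).
    apply/eqP; rewrite -order_eq1.
    have p1 : p.-nat #[coset M u].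
      by apply: (morph_p_elt (coset_morphism M)); rewrite ?(mem_p_elt pP) ?NM ?(subsetP sPH).
    have p2 : p^'.-nat #[coset M u].
      rewrite Mu; apply: (morph_p_elt (coset_morphism M)); rewrite ?NM ?groupV //.
      by rewrite p_eltV; apply: mem_p_elt (pcore_pgroup _ _) Oo.
    by rewrite (pnat_1 p1 p2).
  have px : p %| #[x].
    by rewrite orderE -Px; case: (pgroup_pdiv pP ntP).
  (* [#[x].-1] plays the exponent -1, so the exponent is [k - 1] modulo [#[x]], prime to [p]. *)
  have uE : u = x ^+ (k + #[x].-1) by rewrite /u invg_expg -expgD.
  have gen : generator <[x]> u.
    rewrite uE generator_coprime; have [q xq] := p_natP (mem_p_elt pP Pxx : p.-nat #[x]).
    rewrite [in X in coprime X _]xq coprimeXl // prime_coprime //; apply: contra nkp => pk.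
    rewrite -(eqn_modDr #[x].-1) add1n prednK ?order_gt0 //.
    by rewrite -[#[x] %% p]/((#[x]) %% p)%N (eqP px) (eqP pk).
  by rewrite Px (eqP gen) cycle_subG.
exists M; split=> // N nsN ntN.
have [ti|nti] := eqVneq (M :&: N) 1.
  case/eqP: ntN; apply: p'normal => //.
  have sylN : p.-Sylow(N) (N :&: P) := Sylow_setI_normal nsN sylP.
  have N1 : N :&: P = 1 by apply/trivgP; rewrite -ti subsetI subsetIl andbT (subset_trans (subsetIr _ _)).
  have c1 : 1%N = (#|N|`_p)%N.
    by transitivity #|N :&: P|; [rewrite N1 cards1 | exact: card_Hall sylN].
  by rewrite /pgroup -[#|N|](partnC p) ?cardG_gt0 // -c1 mul1n part_pnat.
rewrite -(minMP [group of M :&: N]) ?subsetIl ?subsetIr //= nti normsI //.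
exact: normal_norm.
Qed.
End CyclicSylow.

(** * Passage to the quotient by a normal p'-subgroup *)

Section StarQuotient.
Variables (p : nat) (F : closedFieldType) (theta : F -> algC).
Hypothesis pcharF : p \in [pchar F].
Hypothesis th : brauer_lift theta.
Variables (gT : finGroupType) (G O : {group gT}).
Hypothesis nsOG : O <| G.
Hypothesis p'O : p^'.-group O.
Notation Q := (G / O)%G.
Notation prG i := (preg_restr p ('chi[G]_i)).
Notation prQ i := (preg_restr p ('chi[Q]_i)).
Notation inflI := (@mod_Iirr gT G O).
Notation decG := (@dec p F theta gT G).
Notation decQ := (@dec p F theta _ Q).

Let nOG : G \subset 'N(O) := normal_norm nsOG.

Lemma p_regular_coset x : x \in G -> (coset O x \in p_regular p Q) = (x \in p_regular p G).
Proof.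
move=> Gx; have nOx := subsetP nOG x Gx.
rewrite !p_regularE Gx mem_quotient //=; apply/idP/idP => [px|px]; last exact: (morph_p_elt (coset_morphism O)).
have px1 : p^'.-elt (coset O x.`_p).
  have -> : coset O x.`_p = (coset O x).`_p by rewrite morph_constt.
  by rewrite (constt1P _) ?p_elt1.
have p1 : coset O x.`_p = 1%g.
  apply/eqP; rewrite -order_eq1 (pnat_1 _ px1) //.
  by apply: (morph_p_elt (coset_morphism O)); rewrite ?groupX ?p_elt_constt.
have Ox : x.`_p \in O by apply: coset_idr; rewrite ?groupX.
have : x.`_p == 1%g.
  by rewrite -order_eq1 (pnat_1 (p_elt_constt p x) (mem_p_elt p'O Ox)).
by move/eqP/constt1P.
Qed.

Lemma preg_restr_mod (f : 'CF(Q)) : preg_restr p (f %% O)%CF = (preg_restr p f %% O)%CF.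
Proof.
by apply/cfun_inP => x Gx; rewrite preg_restrE !cfModE // preg_restrE p_regular_coset.
Qed.

Lemma mod_inj : injective (fun f : 'CF(Q) => (f %% O)%CF).
Proof. exact: can_inj (cfModK nsOG). Qed.

Lemma brauer_char_mod n (r : mx_representation F Q n) : exists rG : mx_representation F G n,
  (mx_irreducible r -> mx_irreducible rG) /\ brauer_char p theta rG = (brauer_char p theta r %% O)%CF.
Proof.
pose rG := morphim_repr (f := coset_morphism O) r nOG.
exists rG; split; first by move=> irr; apply/morphim_mx_irr.
apply/cfun_inP => x Gx; rewrite cfModE // [LHS]brauer_charE [RHS]brauer_charE p_regular_coset //.
Qed.

Lemma dec_mod : exists2 h : 'I_(size (ibr p theta Q)) -> 'I_(size (ibr p theta G)),
  forall i k, decG (inflI i) (h k) = decQ i k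
  & forall i k', decG (inflI i) k' != 0 -> exists k, k' = h k.
Proof.
have /choice[h hE] (k : 'I_(size (ibr p theta Q))) : exists k', @ib p F theta gT G k' = (@ib p F theta _ Q k %% O)%CF.
  have [n [r [irr ->]]] := ib_IBr pcharF th k.
  have [rG [irrG <-]] := brauer_char_mod r.
  have [|k' E] := @IBr_ib p F theta pcharF th gT G (brauer_char p theta rG); last by exists k'.
  by exists n, rG; split=> //; exact: irrG.
have hinj : injective h.
  by move=> k l hkl; apply: (ib_inj pcharF th (G := Q)); apply: mod_inj; rewrite -!hE hkl.
have E i k' : decG (inflI i) k' = \sum_l decQ i l * (h l == k')%:R.
  rewrite decE mod_IirrE // preg_restr_mod (preg_restr_dec pcharF th) !linear_sum.
  by apply: eq_bigr => l _; rewrite !linearZ /= -hE (bcoef_ib pcharF th).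
exists h => [i k|i k' di].
  rewrite E (bigD1 k) //= eqxx mulr1 big1 ?addr0 // => l lk.
  by rewrite (inj_eq hinj) (negbTE lk) mulr0.
apply: contrapT => no; move: di; rewrite E big1 ?eqxx // => l _.
by case: eqP => [hk|]; [case: no; exists l | rewrite mulr0].
Qed.

Lemma linked_mod i j : linked p theta (inflI i) (inflI j) = linked p theta i j.
Proof.
have [h hE hI] := dec_mod; apply/linkedP/linkedP => [[k' di dj]|[k di dj]].
  by have [k kE] := hI _ _ di; exists k; rewrite -hE -kE.
by exists (h k); rewrite hE.
Qed.

Lemma pr_mod i j : (prG (inflI i) = prG (inflI j)) <-> (prQ i = prQ j).
Proof. by rewrite !mod_IirrE // !preg_restr_mod; split=> [/mod_inj//|->]. Qed.

(** The sum over [O] acts by a scalar reducing to [#|O|], nonzero modulo [p]; so the restriction to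
    the normal subgroup [O] contains the trivial character, and by Clifford's theorem is trivial. *)
Lemma in_block_cfker i : in_block p theta i -> O \subset cfker 'chi[G]_i.
Proof.
move=> bi; have [R [v [f ad]]] := adapted_place_exists pcharF th (part_pnat p^' #|G|).
have [r vr fr] := in_block_class_ratio pcharF th ad (normal_sub nsOG) nOG bi.
apply: constt0_Res_cfker => //; rewrite irr_consttE irr0.
apply: contraTneq (nat_neq0_p' pcharF (p'O : p^'.-nat #|O|)) => i1.
suff r0 : class_ratio i O = 0.
  rewrite negbK -fr; have [[vinj _] _] := ad.
  have -> : r = 0 by apply: vinj; rewrite vr r0 rmorph0.
  by rewrite rmorph0 eqxx.
move/eqP: i1; rewrite cfdotE mulf_eq0 invr_eq0 (negbTE (neq0CG _)) /= => /eqP S0.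
rewrite /class_ratio; have -> : \sum_(g in O) 'chi_i g = 0; last by rewrite mul0r.
rewrite -[RHS]S0; apply: eq_bigr => g Og.
by rewrite cfResE ?normal_sub // cfun1E Og rmorph1 mulr1.
Qed.

Lemma in_block_mod i : in_block p theta (inflI i) <-> in_block p theta i.
Proof.
split; last first.
  move: i; apply: in_block_ind => [|i j _ lij /in_block_linked]; first by rewrite mod_Iirr0 in_block0.
  by apply; rewrite linked_mod.
have H : forall l, in_block p theta l -> exists2 i, l = inflI i & in_block p theta i.
  apply: in_block_ind => [|l m bl llm [i1 lE bi]]; first by exists 0; rewrite ?mod_Iirr0 ?in_block0.
  have mE := quo_IirrK nsOG (in_block_cfker (in_block_linked bl llm)).
  exists (quo_Iirr O m) => //; apply: in_block_linked bi _.
  by rewrite -linked_mod mE -lE.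
by move/H=> [j /(can_inj (mod_IirrK nsOG))->].
Qed.

Lemma star_quotient : star_block p theta G -> star_block p theta Q.
Proof.
case=> c [bc lc st]; have cE := quo_IirrK nsOG (in_block_cfker bc).
rewrite -cE in bc lc st; exists (quo_Iirr O c); split.
- exact/in_block_mod.
- by move=> i /in_block_mod/lc; rewrite linked_mod.
move=> i j /in_block_mod bi /in_block_mod bj; rewrite -linked_mod => lij.
by have [] := st _ _ bi bj lij => /pr_mod; [constructor 1 | constructor 2 | constructor 3].
Qed.
End StarQuotient.

Close Scope ring_scope.

Theorem theorem2 (p : nat) (F : closedFieldType) (theta : F -> algC)
    (gT : finGroupType) (G P : {group gT}) :
  prime p -> p \in [pchar F]%R -> brauer_lift theta ->
  ~ p_solvable p G ->
  p.-Sylow(G) P -> cyclic P -> P :!=: 1 ->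
  exists K : {group gT},
    [/\ [/\ K <| G, 'O_p^'(G) \proper K
          & forall N : {group gT}, N <| G -> 'O_p^'(G) \proper N -> K \subset N],
        simple (K / 'O_p^'(G)), ~~ abelian (K / 'O_p^'(G))
      & in_Xp p theta G -> in_Xp p theta (K / 'O_p^'(G))%G].
Proof.
move=> p_pr pcharF th nsolG sylP cycP ntP.
pose O := 'O_p^'(G)%G; have nsOG : O <| G := pcore_normal _ _.
have [sOG nOG] := andP nsOG; have p'O : p^'.-group O := pcore_pgroup _ _.
have [sPG pP _] := and3P sylP; have nOP := subset_trans sPG nOG.
have sylPb : p.-Sylow(G / O) (P / O) := quotient_pHall nOP sylP.
have cycPb : cyclic (P / O) := quotient_cyclic _ cycP.
have tiOP : O :&: P = 1 by rewrite coprime_TIg // coprime_sym (pnat_coprime pP p'O).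
have ntPb : P / O != 1.
  by rewrite -(isog_eq1 (quotient_isog nOP tiOP)).
have O1 : 'O_p^'(G / O) = 1 := trivg_pcore_quotient _ _.
(* Otherwise 1, [O], the preimage of [P / O] and [G] form a series whose factors are p-groups or
   p'-groups. *)
have nPb : ~~ (P / O <| G / O).
  apply/negP => nsPb; apply: nsolG.
  pose R := (coset O @*^-1 (P / O))%G.
  have nsRG : R <| G by rewrite -(quotientGK nsOG) cosetpre_normal.
  have sOR : O \subset R by exact: sub_cosetpre.
  have RO : R / O = P / O by rewrite cosetpreK.
  exists [:: O; R; G] => //=; rewrite sub1G nsOG sOR nsRG (normal_sub nsRG) normal_refl /= andbT.
  apply/and3P; split.
  - by rewrite (quotient_pgroup _ p'O) orbT.
  - by rewrite RO quotient_pgroup.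
  apply/orP; right.
  have sPR : P \subset R by rewrite -sub_quotient_pre // subxx.
  rewrite /pgroup card_quotient ?normal_norm //.
  apply: pnat_dvd (indexgS G sPR) _; by case/and3P: sylP.
have [M [nsM simM naM sPM minM]] := minnormal_cyclic_Sylow p_pr sylPb cycPb ntPb O1 nPb.
pose K := (coset O @*^-1 M)%G.
have KO : (K / O)%G = M by apply: val_inj; rewrite /= cosetpreK.
have [ntM _] := simpleP _ simM.
have KO' : K / 'O_p^'(G) = M by rewrite /= cosetpreK.
exists K; split.
- split.
  + by rewrite -(quotientGK nsOG) cosetpre_normal.
  + rewrite properE sub_cosetpre /=; apply: contra ntM => sKO.
    by rewrite -KO' -subG1 quotient_sub1 // subsetIl.
  move=> N nsN; rewrite properE => /andP[sON nNO].
  rewrite -(quotientGK (normalS sON (normal_sub nsN) nsOG)) morphpreS // minM ?quotient_normal //.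
  apply: contra nNO => /eqP NO1; rewrite -quotient_sub1 ?NO1 //.
  exact: subset_trans (normal_sub nsN) nOG.
- by rewrite KO'.
- by rewrite KO'.
case=> _ /(is_star_block pcharF th)/(star_quotient pcharF th nsOG p'O) starQ.
have -> : (K / 'O_p^'(G))%G = M by exact: KO.
have sMG := normal_sub nsM.
have sylPM : p.-Sylow(M) (P / O) := pHall_subl sPM sMG sylPb.
have pPb := pHall_pgroup sylPb.
split; first by exists (P / O)%G.
apply/(is_star_block pcharF th).
have p'ind : p^'.-nat #|(G / O)%G : M|.
  by apply: pnat_dvd (indexgS _ sPM) _; case/and3P: sylPb.
have npM : ~~ p.-group M.
  apply: contra naM => pM; have [_ sM] := simpleP _ simM.
  have [/= Z1|/= ZM] := sM 'Z(M)%G (center_normal M); last by rewrite -ZM center_abelian.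
  by case/eqP: ntM; apply: trivg_center_pgroup pM Z1.
have [t [Pt t1]] : exists t, t \in P / O /\ t != 1.
  by have [t Pt t1] := trivgPn _ ntPb; exists t.
have Xt : t \in psing p M.
  rewrite inE (subsetP sPM) //=; apply: contra t1 => p't.
  by rewrite -order_eq1 (pnat_1 (mem_p_elt pPb Pt) p't).
pose Z := 'Ohm_1(P / O)%G; have sZP : Z \subset P / O := Ohm_sub 1 _.
have oZ : #|Z| = p := Ohm1_cyclic_pgroup_prime cycPb pPb ntPb.
pose C := 'C_M(Z)%G.
have sPC : P / O \subset C.
  by rewrite subsetI sPM centsC (subset_trans sZP) //; exact: cyclic_abelian.
have sylPC : p.-Sylow(C) (P / O) := pHall_subl sPC (subsetIl _ _) sylPM.
have defC := central_complement sylPC cycPb sZP oZ p_pr (subsetIr _ _).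
apply: (star_normal pcharF th nsM p'ind simM npM Xt _ starQ) => l m bl bm.
exact: (exceptional_preg_restr pcharF th sylPM cycPb sZP oZ defC (pcore_pgroup _ _) bl bm).
Qed.
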